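(* Let $\omega(x)=1+x^2$ on $\mathbb{R}$, let $\beta\geq3/2$, let $\mu_\beta$ be the probability measure on $\mathbb{R}$ with density proportional to $\omega^{-\beta}$, and let $Lf=\omega f''-2(\beta-1)xf'$, with associated semigroup $(\mathbf{P}_t)_{t\geq0}$. Then $\lambda_1(-L)\geq2(\beta-1)$ and for all $f\in\mathcal{C}_c^\infty(\mathbb{R})$, $$2(\beta-1)\mathrm{Var}_{\mu_\beta}(f)=\int_{\mathbb{R}}\omega f'^2\,d\mu_\beta-2\int_0^{+\infty}\!\int_{\mathbb{R}}\omega^2\big((\mathbf{P}_tf)''\big)^2\,d\mu_\beta\,dt.$$ Furthermore, if $\beta>3/2$, then $\lambda_1(-L)=2(\beta-1)$, as linear functions are eigenfunctions of $-L$ associated with $2(\beta-1)$.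
   Context: The operator $L$, defined on $\mathcal{C}_c^\infty(\mathbb{R})$, is symmetric and essentially self-adjoint in $L^2(\mu_\beta)$; its self-adjoint extension, still denoted $L$, has domain $\mathcal{D}(L)\subset L^2(\mu_\beta)$, and $\mathbf{P}_t=e^{tL}$ is the $L^2(\mu_\beta)$-semigroup it generates. The spectral gap is $$\lambda_1(-L)=\inf\left\{\frac{\int_{\mathbb{R}}-f\,Lf\,d\mu_\beta}{\mathrm{Var}_{\mu_\beta}(f)}\ :\ f\in\mathcal{D}(L),\ \mathrm{Var}_{\mu_\beta}(f)\neq0\right\}.$$ *)

(* Defs.v *)
From HB Require Import structures.
From mathcomp Require Import all_boot all_order all_algebra.
From mathcomp Require Import all_classical all_reals all_analysis measurable_realfun.

Set Implicit Arguments.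
Unset Strict Implicit.
Unset Printing Implicit Defensive.

Import Order.TTheory GRing.Theory Num.Theory.
Import numFieldNormedType.Exports.

Local Open Scope ring_scope.
Local Open Scope classical_set_scope.

Definition omega {R : realType} (x : R) : R := 1 + x ^+ 2.

Definition weight {R : realType} (beta : R) (A : set (measurableTypeR R)) : \bar R :=
  (\int[lebesgue_measure]_(x in A) (omega x `^ (- beta))%:E)%E.

Section weight_measure.
Context {R : realType} (beta : R).

Lemma measurable_omega_powR :
  measurable_fun [set: measurableTypeR R] (fun x : R => omega x `^ (- beta)).
Proof.
apply: (measurableT_comp (measurable_powR _)) => //.
by apply: measurable_funD => //; exact: measurable_funX.
Qed.

Let weight0 : weight beta set0 = 0%E.
Proof. by rewrite /weight integral_set0. Qed.

Let weight_ge0 A : (0 <= weight beta A)%E.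
Proof. by apply: integral_ge0 => x _; rewrite lee_fin powR_ge0. Qed.

Let weight_sigma_additive : semi_sigma_additive (weight beta).
Proof.
move=> /= F mF tF mUF; rewrite /weight; apply: cvg_toP.
  apply: ereal_nondecreasing_is_cvgn => m n mn.
  apply: lee_sum_nneg_natr => // k _ _; apply: integral_ge0 => /= x _.
  by rewrite lee_fin powR_ge0.
rewrite ge0_integral_bigcup//=.
- by apply/measurable_funTS/measurable_EFinP; exact: measurable_omega_powR.
- by move=> x _; rewrite lee_fin powR_ge0.
Qed.

HB.instance Definition _ := isMeasure.Build _ _ _ (weight beta)
  weight0 weight_ge0 weight_sigma_additive.

End weight_measure.

(* The total mass of [weight beta] is positive, and finite for beta > 1/2; the
   second argument of [mnormalize] is a default that is only used otherwise. *)
Definition mu {R : realType} (beta : R) : probability (measurableTypeR R) R :=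
  mnormalize (weight beta) (dirac (0 : measurableTypeR R)).

Definition smooth {R : realType} (f : R -> R) : Prop :=
  forall n x, derivable (f^`(n)) x 1.

Definition test_function {R : realType} (f : R -> R) : Prop :=
  smooth f /\ compact (closure [set x | f x != 0]).

Definition L0 {R : realType} (beta : R) (f : R -> R) : R -> R :=
  fun x => omega x * (f^`(2))%classic x - 2 * (beta - 1) * x * (f^`())%classic x.

(* Elements of L^2(m) are handled through their square-integrable
   representatives, and an unbounded operator A of L^2(m) through its graph:
   [A f g] means that f is in the domain of A and that A f = g in L^2(m). *)
Section L2_operators.
Context {R : realType} (m : probability (measurableTypeR R) R).
Implicit Types (f g : R -> R) (A : (R -> R) -> (R -> R) -> Prop).

Definition L2 f : Prop := f \in Lfun m 2%:E.

Definition L2dist f g : \bar R := ('N[m]_2%:E [EFin \o (f \- g)%R])%E.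

Definition op_closure (D : (R -> R) -> Prop) (T : (R -> R) -> R -> R) f g :=
  [/\ L2 f, L2 g & exists u : nat -> R -> R,
    [/\ forall n, D (u n),
        L2dist (u n) f @[n --> \oo] --> 0%E
      & L2dist (T (u n)) g @[n --> \oo] --> 0%E]].

(* Strongly continuous semigroups of bounded linear operators; only the values
   of P at nonnegative times and on L^2(m) matter. *)
Record C0_semigroup (P : R -> (R -> R) -> R -> R) : Prop := {
  semigroup_L2 : forall (t : R) f, 0 <= t -> L2 f -> L2 (P t f) ;
  semigroup_linear : forall (t a : R) f g, 0 <= t -> L2 f -> L2 g ->
    P t (fun x => a * f x + g x) = (fun x => a * P t f x + P t g x) %[ae m] ;
  semigroup_bounded : forall t : R, 0 <= t -> exists M : R, forall f, L2 f ->
    ('N[m]_2%:E [EFin \o P t f] <= M%:E * 'N[m]_2%:E [EFin \o f])%E ;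
  semigroup_0 : forall f, L2 f -> P 0 f = f %[ae m] ;
  semigroup_D : forall (s t : R) f, 0 <= s -> 0 <= t -> L2 f ->
    P (s + t) f = P s (P t f) %[ae m] ;
  semigroup_cvg : forall f, L2 f -> L2dist (P t f) f @[t --> 0^'+] --> 0%E }.

Definition generates A (P : R -> (R -> R) -> R -> R) : Prop :=
  C0_semigroup P /\
  forall f g, L2 f -> L2 g -> (A f g <->
    L2dist (fun x => t^-1 * (P t f x - f x)) g @[t --> 0^'+] --> 0%E).

(* The spectral gap lambda_1(-A), as an infimum in the extended reals. *)
Definition spectral_gap_opp A : \bar R :=
  ereal_inf [set r | exists f g, [/\ A f g, ('V_m[f] != 0)%E &
    r = ((\int[m]_x (- f x * g x)) / fine 'V_m[f])%:E]].

Definition eigenfunction_opp A (lambda : R) f : Prop :=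
  ~ (f = cst 0 %[ae m]) /\ A f (fun x => - (lambda * f x)).

End L2_operators.

(* [L0 beta] is essentially self-adjoint on the test functions, which means that
   its closure is self-adjoint: the closure is its self-adjoint extension. *)
Definition Lop {R : realType} (beta : R) : (R -> R) -> (R -> R) -> Prop :=
  op_closure (mu beta) test_function (L0 beta).

(* Main.v *)
(* Write [lam = 2 (beta - 1)] and [L = L0 beta]; the norms and integrals are those
   of [L^2(mu)].  For a test function [u], integration by parts gives
   [- int u Lu = int omega u'^2] and
   [int (Lu)^2 + lam int u Lu = int omega^2 u''^2], and both pass to the closure.
   When [int f = 0], the function [q = omega^(beta - 1) int_(-oo)^x f omega^(-beta)]
   has compact support, [omega q' = lam x q + f], and expanding
   [int omega (f' + lam q)^2 + lam int (omega q')^2 >= 0] yields the Poincare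
   inequality with constant [lam].
   For a semigroup generated by [L], put [A = |P_t f|^2 - (int f)^2],
   [B = <P_t f, P_t L f>] and [C = |P_t L f|^2].  Then [A' = 2 B], [B' = 2 C] and
   [lam A <= - B]; since [B] is nondecreasing and [A >= 0], both [A] and [B] tend
   to [0], so that [int_0^oo (C + lam B) dt = - (B(0) + lam A(0)) / 2].  The
   integrand [C + lam B] is [int omega^2 ((P_t f)'')^2] because [P_t f] has a
   smooth representative: [L v = g] forces
   [v' = omega^(beta - 1) int_(-oo)^x g omega^(-beta)], and this bootstraps along
   the orbit [P_t L^k f]. *)

Require Import Defs.
From HB Require Import structures.
From mathcomp Require Import all_boot all_order all_algebra.
From mathcomp Require Import all_classical all_reals all_analysis.
From mathcomp Require Import measurable_realfun ring lra.

Set Implicit Arguments.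
Unset Strict Implicit.
Unset Printing Implicit Defensive.

Import Order.TTheory GRing.Theory Num.Theory.
Import numFieldNormedType.Exports.

Local Open Scope ring_scope.
Local Open Scope classical_set_scope.

(** * Semi-inner products *)

(** Elements of L^2 are functions here, not classes, and the laws of the semigroup hold almost
    everywhere. The semigroup theory is therefore written over a space with a semi-inner product,
    where null vectors stay and equality means that the difference has seminorm 0. [C0_semigroup]
    bounds each P_t separately, whereas differentiating an orbit from the left requires a bound
    uniform in time on compact intervals. That bound is extracted from strong continuity and
    completeness. Elements of the closure have no derivatives a priori. The bridge is that, for a
    test function, u' is an explicit weighted integral of Lu, bounded locally uniformly by the norm
    of Lu; convergence in graph norm thus yields locally uniform convergence of derivatives. In the
    Poincare inequality, q is formally v' for a solution of L v = f. Both squares vanish when q is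
    constant, that is when f = - lam x q; the linear functions are the equality case, which is why
    the constant is sharp as soon as they are square integrable. *)

Record semi_inner_product {R : realType} {V : lmodType R} (ip : V -> V -> R) :
    Prop := {
  ipC : forall x y, ip x y = ip y x ;
  ip_lin : forall a x y z, ip (a *: x + y) z = a * ip x z + ip y z ;
  ip_ge0 : forall x, 0 <= ip x x }.

Section semi_inner_product.
Context {R : realType} {V : lmodType R} {ip : V -> V -> R}.
Context (ipP : semi_inner_product ip).
Implicit Types (x y z : V) (a b : R).

Definition seminorm (f : V -> V -> R) x : R := Num.sqrt (f x x).
Local Notation nm := (seminorm ip).
Local Notation "x ~~~ y" := (nm (x - y) = 0) (at level 70).

Lemma ipDl x y z : ip (x + y) z = ip x z + ip y z.
Proof. by rewrite -[x]scale1r (ip_lin ipP) mul1r scale1r. Qed.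

Lemma ip0l z : ip 0 z = 0.
Proof. by apply: (addrI (ip 0 z)); rewrite -ipDl !addr0. Qed.

Lemma ipZl a x z : ip (a *: x) z = a * ip x z.
Proof. by rewrite -[a *: x]addr0 (ip_lin ipP) ip0l addr0. Qed.

Lemma ipNl x z : ip (- x) z = - ip x z.
Proof. by rewrite -scaleN1r ipZl mulN1r. Qed.

Lemma ipBl x y z : ip (x - y) z = ip x z - ip y z.
Proof. by rewrite ipDl ipNl. Qed.

Lemma ipDr x y z : ip z (x + y) = ip z x + ip z y.
Proof. by rewrite (ipC ipP) ipDl ![ip _ z](ipC ipP). Qed.

Lemma ipZr a x z : ip z (a *: x) = a * ip z x.
Proof. by rewrite (ipC ipP) ipZl (ipC ipP). Qed.

Lemma ipNr x z : ip z (- x) = - ip z x.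
Proof. by rewrite (ipC ipP) ipNl (ipC ipP). Qed.

Lemma ip0r z : ip z 0 = 0.
Proof. by rewrite (ipC ipP) ip0l. Qed.

Definition ipE := (ipDl, ipDr, ipNl, ipNr, ipZl, ipZr, ip0l, ip0r).

Lemma nm_ge0 x : 0 <= nm x.
Proof. exact: sqrtr_ge0. Qed.

Lemma nm_sq x : nm x ^+ 2 = ip x x.
Proof. by rewrite sqr_sqrtr// (ip_ge0 ipP). Qed.

Lemma nm_le x a : 0 <= a -> ip x x <= a ^+ 2 -> nm x <= a.
Proof.
move=> a0 xa; rewrite -(@ler_pXn2r _ 2)// ?nnegrE ?nm_ge0//.
by rewrite nm_sq.
Qed.

(** The usual projection argument divides by the square of one vector. When both squares are 0,
    nonnegativity at [x + y] and at [x - y] forces [ip x y = 0]. *)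
Lemma cauchy_schwarz_sq x y : ip x y ^+ 2 <= ip x x * ip y y.
Proof.
have gen u v : 0 < ip v v -> ip u v ^+ 2 <= ip u u * ip v v.
  move=> v0; have := ip_ge0 ipP (ip v v *: u - ip u v *: v).
  rewrite !ipE (ipC ipP v u) => h.
  rewrite -subr_ge0 -(pmulr_rge0 _ v0); apply: le_trans h _.
  by rewrite le_eqVlt; apply/orP; left; apply/eqP; ring.
have [y0|y0] := ltP 0 (ip y y); first exact: gen.
have {y0}y0 : ip y y = 0 by apply/eqP; rewrite eq_le y0 (ip_ge0 ipP).
have [x0|x0] := ltP 0 (ip x x).
  by rewrite mulrC (ipC ipP); exact: gen.
have {x0}x0 : ip x x = 0 by apply/eqP; rewrite eq_le x0 (ip_ge0 ipP).
have := ip_ge0 ipP (x + y); have := ip_ge0 ipP (x - y).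
rewrite !ipE (ipC ipP y x) x0 y0 => h1 h2.
have -> : ip x y = 0 by lra.
by rewrite expr0n/= mulr0.
Qed.

Lemma cauchy_schwarz x y : `|ip x y| <= nm x * nm y.
Proof.
rewrite -(@ler_pXn2r _ 2)// ?nnegrE ?mulr_ge0 ?nm_ge0//.
by rewrite exprMn !nm_sq -normrX ger0_norm ?sqr_ge0// cauchy_schwarz_sq.
Qed.

Lemma nmD x y : nm (x + y) <= nm x + nm y.
Proof.
apply: nm_le; first by rewrite addr_ge0 ?nm_ge0.
rewrite sqrrD !nm_sq !ipE (ipC ipP y x).
have := le_trans (ler_norm _) (cauchy_schwarz x y); rewrite mulr2n; lra.
Qed.

Lemma nmZ a x : nm (a *: x) = `|a| * nm x.
Proof.
by rewrite /seminorm !ipE mulrA -expr2 sqrtrM ?sqr_ge0// sqrtr_sqr.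
Qed.

Lemma nmN x : nm (- x) = nm x.
Proof. by rewrite -scaleN1r nmZ normrN1 mul1r. Qed.

Lemma nm0 : nm 0 = 0.
Proof. by rewrite /seminorm ip0l sqrtr0. Qed.

Lemma nmBC x y : nm (x - y) = nm (y - x).
Proof. by rewrite -opprB nmN. Qed.

Lemma nmB x y z : nm (x - z) <= nm (x - y) + nm (y - z).
Proof. by rewrite -(subrKA y x) nmD. Qed.

Lemma nmB_ge x y : nm x - nm y <= nm (x - y).
Proof. by rewrite lerBlDr -{1}(subrK y x) nmD. Qed.

Lemma nm_dist x y : `|nm x - nm y| <= nm (x - y).
Proof. by rewrite ler_norml nmB_ge lerNl opprB nmBC nmB_ge. Qed.

Lemma nm_le0 x : nm x <= 0 -> nm x = 0.
Proof. by move=> x0; apply/eqP; rewrite eq_le x0 nm_ge0. Qed.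

Lemma eqv_refl x : x ~~~ x.
Proof. by rewrite subrr nm0. Qed.

Lemma eqv_sym x y : x ~~~ y -> y ~~~ x.
Proof. by rewrite nmBC. Qed.

Lemma eqv_trans y x z : x ~~~ y -> y ~~~ z -> x ~~~ z.
Proof.
by move=> xy yz; apply: nm_le0; rewrite (le_trans (nmB x y z))// xy yz addr0.
Qed.

Lemma eqvD x y x' y' : x ~~~ x' -> y ~~~ y' -> x + y ~~~ x' + y'.
Proof.
move=> xx' yy'; apply: nm_le0; rewrite opprD addrACA.
by rewrite (le_trans (nmD _ _))// xx' yy' addr0.
Qed.

Lemma eqvZ a x y : x ~~~ y -> a *: x ~~~ a *: y.
Proof. by move=> xy; rewrite -scalerBr nmZ xy mulr0. Qed.

Lemma eqvB x y x' y' : x ~~~ x' -> y ~~~ y' -> x - y ~~~ x' - y'.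
Proof.
by move=> xx' yy'; apply: eqvD => //; rewrite -(scaleN1r y) -(scaleN1r y'); exact: eqvZ.
Qed.

Lemma nm_eqv x y : x ~~~ y -> nm x = nm y.
Proof.
move=> xy; apply/eqP; rewrite -subr_eq0 -normr_eq0 eq_le normr_ge0 andbT.
by rewrite -xy nm_dist.
Qed.

Lemma ip_eqv x y x' y' : x ~~~ x' -> y ~~~ y' -> ip x y = ip x' y'.
Proof.
move=> xx' yy'; apply/eqP; rewrite -subr_eq0 -normr_eq0 eq_le normr_ge0 andbT.
have -> : ip x y - ip x' y' = ip (x - x') y + ip x' (y - y').
  by rewrite !ipE; ring.
rewrite (le_trans (ler_normD _ _))//.
have := cauchy_schwarz (x - x') y; have := cauchy_schwarz x' (y - y').
by rewrite xx' yy' mul0r mulr0; lra.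
Qed.

Lemma cvg0_le (I : Type) (F : set_system I) {FF : Filter F} (f g : I -> R) :
  (\forall i \near F, 0 <= f i <= g i) ->
  g i @[i --> F] --> 0 -> f i @[i --> F] --> 0.
Proof. by move=> fg g0; apply: (squeeze_cvgr fg) => //; exact: cvg_cst. Qed.

Lemma ip_cvg (I : Type) (F : set_system I) {FF : Filter F} (u v : I -> V) x y :
  nm (u i - x) @[i --> F] --> 0 -> nm (v i - y) @[i --> F] --> 0 ->
  ip (u i) (v i) @[i --> F] --> ip x y.
Proof.
move=> ux vy; apply/subr_cvg0/norm_cvg0P.
apply: (@cvg0_le _ F FF _ (fun i => nm (u i - x) * nm (v i - y) +
  nm x * nm (v i - y) + nm (u i - x) * nm y)).
  apply: nearW => i; rewrite normr_ge0/=.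
  have -> : ip (u i) (v i) - ip x y =
      ip (u i - x) (v i - y) + ip x (v i - y) + ip (u i - x) y.
    by rewrite !ipE; ring.
  rewrite (le_trans (ler_normD _ _))// lerD ?cauchy_schwarz//.
  by rewrite (le_trans (ler_normD _ _))// lerD ?cauchy_schwarz.
rewrite (_ : 0 = 0 * 0 + nm x * 0 + 0 * nm y); last by rewrite !(mul0r, mulr0) !addr0.
by apply: cvgD; [apply: cvgD; apply: cvgM => //|apply: cvgM => //]; exact: cvg_cst.
Qed.

Lemma nm_lin_cvg (I : Type) (F : set_system I) {FF : Filter F} (a b : I -> R)
    (u v : I -> V) (a0 b0 : R) x y :
  a i @[i --> F] --> a0 -> b i @[i --> F] --> b0 ->
  nm (u i - x) @[i --> F] --> 0 -> nm (v i - y) @[i --> F] --> 0 ->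
  nm (a i *: u i + b i *: v i - (a0 *: x + b0 *: y)) @[i --> F] --> 0.
Proof.
move=> ha hb hu hv.
have part (c : I -> R) (c0 : R) (z : I -> V) z0 : c i @[i --> F] --> c0 ->
    nm (z i - z0) @[i --> F] --> 0 -> nm (c i *: z i - c0 *: z0) @[i --> F] --> 0.
  move=> hc hz.
  apply: (@cvg0_le _ F FF _ (fun i => `|c i| * nm (z i - z0) + `|c i - c0| * nm z0)).
    apply: nearW => i; rewrite nm_ge0/=.
    have -> : c i *: z i - c0 *: z0 = c i *: (z i - z0) + (c i - c0) *: z0.
      by rewrite scalerBr scalerBl subrKA.
    by rewrite (le_trans (nmD _ _))// !nmZ.
  rewrite -[X in _ --> X](_ : `|c0| * 0 + 0 * nm z0 = 0); last by rewrite mulr0 mul0r addr0.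
  apply: cvgD; apply: cvgM => //; first exact: cvg_norm; last exact: cvg_cst.
  exact/norm_cvg0P/subr_cvg0.
apply: (@cvg0_le _ F FF _ (fun i => nm (a i *: u i - a0 *: x) + nm (b i *: v i - b0 *: y))).
  by apply: nearW => i; rewrite nm_ge0/= opprD addrACA nmD.
by rewrite -[X in _ --> X]addr0; apply: cvgD; exact: part.
Qed.

(** The factor 3/2 is the sum of the powers of 1/3. Keeping the difference of the two powers on the
    right makes the induction telescope. *)
Lemma geometric_steps (u : nat -> V) :
  (forall n, nm (u n.+1 - u n) <= 3^-1 ^+ n) ->
  forall n k, nm (u n - u (n + k)%N) <= 3 / 2 * (3^-1 ^+ n - 3^-1 ^+ (n + k)).
Proof.
move=> hu n; elim => [|k IH]; first by rewrite addn0 !subrr nm0 mulr0.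
rewrite (le_trans (nmB _ (u (n + k)%N) _))//.
rewrite addnS; have := hu (n + k)%N; rewrite nmBC exprS.
by move: IH; set A := nm _; set B := nm _; lra.
Qed.

Lemma geometric_tail (u : nat -> V) x :
  (forall n, nm (u n.+1 - u n) <= 3^-1 ^+ n) -> nm (u n - x) @[n --> \oo] --> 0 ->
  forall n, nm (u n - x) <= 3 / 2 * 3^-1 ^+ n.
Proof.
move=> hu ux n; apply/ler_addgt0Pr => e e0.
have [N _ HN] : \forall k \near \oo, nm (u k - x) < e.
  exact: (cvgr_lt 0).
have := HN (n + N)%N (leq_addl _ _) => /= h1.
rewrite (le_trans (nmB _ (u (n + N)%N) _))//.
have : 0 <= (3^-1 : R) ^+ (n + N) by rewrite exprn_ge0.
have := geometric_steps hu n N; lra.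
Qed.

End semi_inner_product.

(** * Semigroups modulo null vectors *)

(** Abstract form of [C0_semigroup]: almost everywhere equalities become the vanishing of a
    seminorm, and only nonnegative times are constrained. *)
Record semigroup_mod_null {R : realType} {V : lmodType R} (nm : V -> R)
    (Q : R -> V -> V) : Prop := {
  sg_lin : forall t a x y, 0 <= t ->
    nm (Q t (a *: x + y) - (a *: Q t x + Q t y)) = 0 ;
  sg_bnd : forall t, 0 <= t -> exists M, forall x, nm (Q t x) <= M * nm x ;
  sg_0 : forall x, nm (Q 0 x - x) = 0 ;
  sg_D : forall s t x, 0 <= s -> 0 <= t -> nm (Q (s + t) x - Q s (Q t x)) = 0 ;
  sg_cvg : forall x, nm (Q t x - x) @[t --> 0^'+] --> 0 }.

Definition infinitesimal {R : realType} {V : lmodType R} (nm : V -> R)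
    (Q : R -> V -> V) (x y : V) : Prop :=
  nm (t^-1 *: (Q t x - x) - y) @[t --> 0^'+] --> 0.

Section semigroup.
Context {R : realType} {V : lmodType R} {ip : V -> V -> R}.
Context (ipP : semi_inner_product ip).
Local Notation nm := (seminorm ip).
Local Notation "x ~~~ y" := (nm (x - y) = 0) (at level 70).
Context (complete : forall u : nat -> V,
  (forall n, nm (u n.+1 - u n) <= 3^-1 ^+ n) ->
  exists x, nm (u n - x) @[n --> \oo] --> 0).
Context {Q : R -> V -> V} (QP : semigroup_mod_null nm Q).
Implicit Types (x y z : V) (a b t s h : R).

Let nmge0 := nm_ge0 (ip := ip).

Lemma sgB t x y : 0 <= t -> Q t (x - y) ~~~ Q t x - Q t y.
Proof.
move=> t0; have := sg_lin QP (-1) y x t0.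
by rewrite !scaleN1r ![- _ + _]addrC.
Qed.

Lemma sgZ t a x : 0 <= t -> Q t (a *: x) ~~~ a *: Q t x.
Proof.
move=> t0; have [M HM] := sg_bnd QP t0.
have := sg_lin QP a x 0 t0; rewrite addr0; move/(eqv_trans ipP); apply.
rewrite addrAC subrr add0r; apply: nm_le0.
by rewrite (le_trans (HM _))// (nm0 ipP) mulr0.
Qed.

Definition opnorm t : R := sup [set nm (Q t x) | x in [set x | nm x <= 1]].

Lemma has_sup_opnorm t : 0 <= t ->
  has_sup [set nm (Q t x) | x in [set x | nm x <= 1]].
Proof.
move=> t0; split; first by exists (nm (Q t 0)), 0 => //=; rewrite (nm0 ipP).
have [M HM] := sg_bnd QP t0; exists `|M| => _ [x /= x1 <-].
rewrite (le_trans (HM x))// (le_trans (ler_norm _))// normrM (ger0_norm (nmge0 _)).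
by rewrite ler_piMr.
Qed.

Lemma opnorm_ge0 t : 0 <= t -> 0 <= opnorm t.
Proof.
move=> t0; apply: le_trans (nmge0 (Q t 0)) _.
apply: ub_le_sup; first by have [] := has_sup_opnorm t0.
by exists 0 => //=; rewrite (nm0 ipP).
Qed.

Lemma opnormP t x : 0 <= t -> nm (Q t x) <= opnorm t * nm x.
Proof.
move=> t0; have [x0|] := eqVneq (nm x) 0.
  by have [M HM] := sg_bnd QP t0; rewrite (le_trans (HM x))// x0 !mulr0.
move=> x0; have xgt0 : 0 < nm x by rewrite lt_neqAle eq_sym x0 nmge0.
rewrite -ler_pdivrMr// mulrC.
have -> : (nm x)^-1 * nm (Q t x) = nm (Q t ((nm x)^-1 *: x)).
  by rewrite (nm_eqv ipP (sgZ _ _ t0)) (nmZ ipP) ger0_norm// invr_ge0.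
apply: ub_le_sup; first by have [] := has_sup_opnorm t0.
exists ((nm x)^-1 *: x) => //=.
by rewrite (nmZ ipP) ger0_norm ?invr_ge0// mulVf.
Qed.

Lemma opnorm_near t c : 0 <= t -> c < opnorm t ->
  exists x, nm x <= 1 /\ c < nm (Q t x).
Proof.
move=> t0 ct; have e0 : 0 < opnorm t - c by rewrite subr_gt0.
have [_ [x /= x1 <-] xc] := sup_adherent e0 (has_sup_opnorm t0).
by exists x; split => //; move: xc; rewrite /opnorm; lra.
Qed.

Lemma sg_near0 x e : 0 < e ->
  exists2 d, 0 < d & forall h, 0 <= h -> h < d -> nm (Q h x - x) < e.
Proof.
move=> e0; have : \forall t \near 0^'+, nm (Q t x - x) < e.
  exact: (cvgr_lt 0 (sg_cvg QP x)).
case=> d /= d0 H; exists d => // h h0 hd.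
have [->|hn0] := eqVneq h 0; first by rewrite (sg_0 QP).
apply: H; last by rewrite lt_neqAle eq_sym hn0.
by rewrite /= sub0r normrN ger0_norm.
Qed.

(* Sokal's gliding hump: if the operator norms were unbounded near 0, a
   rapidly convergent series of near-extremal vectors would have a sum whose
   orbit is unbounded near 0. *)
Lemma sg_locally_bounded : exists2 d, 0 < d & exists2 M, 0 <= M &
  forall t x, 0 <= t -> t <= d -> nm (Q t x) <= M * nm x.
Proof.
apply: contrapT => nbd.
(* Negating the bound with d = 1/(n+1) and M = 6 (n+1) 3^n yields a time at most 1/(n+1) with a
   larger operator norm, together with a vector of the unit ball attaining at least 2/3 of that
   norm. *)
have key n : exists p : R * V, [/\ 0 <= p.1, p.1 <= n.+1%:R^-1, nm p.2 <= 1 &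
    2 / 3 * opnorm p.1 < nm (Q p.1 p.2) /\ 6 * n.+1%:R * 3 ^+ n < opnorm p.1].
  apply: contrapT => hn; apply: nbd; exists n.+1%:R^-1 => //.
  exists (6 * n.+1%:R * 3 ^+ n); first by rewrite !mulr_ge0.
  move=> t x t0 tn; apply: le_trans (opnormP x t0) _.
  rewrite ler_wpM2r//; rewrite leNgt; apply/negP => bt; apply: hn.
  have ot : 0 < opnorm t by apply: le_lt_trans bt; rewrite !mulr_ge0.
  have [|y [y1 hy]] := @opnorm_near t (2 / 3 * opnorm t) t0; first by lra.
  by exists (t, y).
have {key}[p hp] := choice key.
pose st n x := x + 3^-1 ^+ n *: (p n).2.
pose sf n x := x - 3^-1 ^+ n *: (p n).2.
(* Since 2 Q y = Q (x + y) - Q (x - y), at least one of the two signs gives a vector whose image has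
   norm at least that of Q y. *)
pose u := fix u n := if n is m.+1 then
  (if 3^-1 ^+ m * nm (Q (p m).1 (p m).2) <= nm (Q (p m).1 (st m (u m)))
   then st m (u m) else sf m (u m)) else 0.
have ge3 n : 0 <= (3^-1 : R) ^+ n by rewrite exprn_ge0.
have hu n : nm (u n.+1 - u n) <= 3^-1 ^+ n.
  have [p0 _ p1 _] := hp n.
  have q : nm (3^-1 ^+ n *: (p n).2) <= 3^-1 ^+ n.
    by rewrite (nmZ ipP) ger0_norm// ler_piMr.
  rewrite [u n.+1]/=; case: ifP => _; rewrite /st /sf addrC addKr ?(nmN ipP)//.
have lb n : 3^-1 ^+ n * nm (Q (p n).1 (p n).2) <= nm (Q (p n).1 (u n.+1)).
  have [p0 _ _ _] := hp n.
  rewrite [u n.+1]/=; case: ifPn => // /negbTE hh.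
  have {hh} := negbT hh; rewrite -ltNge => hh.
  set y := 3^-1 ^+ n *: (p n).2.
  have : nm (Q (p n).1 (y + y)) <= nm (Q (p n).1 (st n (u n))) +
      nm (Q (p n).1 (sf n (u n))).
    rewrite (_ : y + y = st n (u n) - sf n (u n)); last first.
      by rewrite /st /sf -/y opprB [RHS]addrC addrA subrK.
    rewrite (nm_eqv ipP (sgB _ _ p0)) -(nmN ipP (Q _ (sf _ _))).
    exact: nmD.
  rewrite -mulr2n -scaler_nat.
  rewrite (nm_eqv ipP (sgZ _ _ p0)) (nmZ ipP) (nm_eqv ipP (sgZ _ _ p0)) (nmZ ipP).
  rewrite (ger0_norm (ge3 n)) ger0_norm; last by lra.
  by move: hh; set A := nm _; set B := nm _; set C := nm _; lra.
have [x ux] := complete hu.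
have tail := geometric_tail ipP hu ux.
(* The image of u_(n+1) has norm at least (2/3) 3^-n |Q|, and the tail u_(n+1) - x costs at most
   (1/2) 3^-n |Q|. What remains is (1/6) 3^-n |Q|, which exceeds n + 1. *)
have big n : n.+1%:R <= nm (Q (p n).1 x).
  have [p0 _ _ [h1 h2]] := hp n.
  have := opnormP (u n.+1 - x) p0; rewrite (nm_eqv ipP (sgB _ _ p0)).
  have := nmB_ge ipP (Q (p n).1 (u n.+1)) (Q (p n).1 x).
  have := lb n.
  have := tail n.+1; rewrite exprS.
  have ok := opnorm_ge0 p0.
  move=> ht hl hb ho.
  have : opnorm (p n).1 * nm (u n.+1 - x) <= opnorm (p n).1 * (2^-1 * 3^-1 ^+ n).
    by rewrite ler_wpM2l//; move: ht; set A := nm _; lra.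
  have : 3^-1 ^+ n * (2 / 3 * opnorm (p n).1) <= 3^-1 ^+ n * nm (Q (p n).1 (p n).2).
    by rewrite ler_wpM2l// ltW.
  have : 3^-1 ^+ n * (6 * n.+1%:R * 3 ^+ n) <= 3^-1 ^+ n * opnorm (p n).1.
    by rewrite ler_wpM2l// ltW.
  rewrite mulrCA -exprMn mulVf// expr1n mulr1.
  move: hl hb ho; set A := nm _; set B := nm _; set C := nm _; set D := nm _.
  by rewrite [opnorm _ * (_ * _)]mulrCA [_ ^+ n * (_ * _)]mulrCA [opnorm _ * _ ^+ n]mulrC; lra.
have [d d0 hd] := sg_near0 x ltr01.
(* With N + 1 above 1/d the time falls below d, so that Q x is within 1 of x; with N + 1 above |x| +
   1 this contradicts [big N]. *)
pose N := Num.trunc (Num.max d^-1 (nm x + 1)).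
have hN : Num.max d^-1 (nm x + 1) < N.+1%:R by exact: truncnS_gt.
move: hN; rewrite gt_max => /andP[hN1 hN2].
have [p0 pN _ _] := hp N.
have : (p N).1 < d.
  by rewrite (le_lt_trans pN)// invf_plt ?posrE.
move=> /(hd _ p0).
have := nmB_ge ipP (Q (p N).1 x) x; have := big N.
by move: hN2; set A := nm _; set B := nm _; set C := nm _; lra.
Qed.

(** The interval is covered by steps of length d, each costing a factor M. The constant [M + M * K]
    dominates both cases of the induction, t <= d and t > d. *)
Lemma sg_bounded T : exists2 M, 0 <= M &
  forall t x, 0 <= t -> t <= T -> nm (Q t x) <= M * nm x.
Proof.
have [d d0 [M M0 HM]] := sg_locally_bounded.
suff H n : exists2 M, 0 <= M &
    forall t x, 0 <= t -> t <= n%:R * d -> nm (Q t x) <= M * nm x.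
  have [K K0 HK] := H (Num.trunc (T / d)).+1; exists K => // t x t0 tT.
  apply: HK => //; rewrite (le_trans tT)// -ler_pdivrMr//.
  exact/ltW/truncnS_gt.
elim: n => [|n [K K0 HK]].
  exists M => // t x t0; rewrite mul0r => t0'.
  by apply: HM => //; rewrite (le_trans t0')// ltW.
exists (M + M * K); first by rewrite addr_ge0// mulr_ge0.
move=> t x t0; rewrite -natr1 mulrDl mul1r => tn.
have [td|td] := leP t d.
  by rewrite (le_trans (HM _ _ t0 td))// mulrDl lerDl !mulr_ge0.
have td0 : 0 <= t - d by rewrite subr_ge0 ltW.
have := sg_D QP x (ltW d0) td0; rewrite subrKC => /(nm_eqv ipP) ->.
rewrite (le_trans (HM _ _ (ltW d0) _))// mulrDl -mulrA ler_wpDl ?mulr_ge0//.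
by rewrite ler_wpM2l// HK// lerBlDr.
Qed.

Lemma sg_increment s h x : 0 <= s -> 0 <= h ->
  Q (s + h) x - Q s x ~~~ Q s (Q h x - x).
Proof.
move=> s0 h0; apply: (eqv_trans ipP _ (eqv_sym ipP (sgB _ _ s0))).
by apply: (eqvB ipP); [exact: (sg_D QP)|exact: (eqv_refl ipP)].
Qed.

(** For s < t the earlier operator is factored out, Q_t x - Q_s x = Q_s (Q_(t-s) x - x), and s
    varies: continuity from the left rests on the uniform bound. Dividing by [M + 1] avoids the case
    M = 0. *)
Lemma sg_continuous t x e : 0 <= t -> 0 < e -> exists2 d, 0 < d &
  forall s, 0 <= s -> `|s - t| < d -> nm (Q s x - Q t x) < e.
Proof.
move=> t0 e0; have [M M0 HM] := sg_bounded t.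
have eM : 0 < e / (M + 1) by rewrite divr_gt0// ltr_wpDl.
have [d d0 hd] := sg_near0 x eM; exists d => // s s0.
have fin y : nm y < e / (M + 1) -> M * nm y < e.
  rewrite ltr_pdivlMr ?ltr_wpDl// mulrC mulrDl mul1r; apply: le_lt_trans.
  by rewrite lerDl.
have [ts|st] := leP t s.
  rewrite ger0_norm ?subr_ge0// => std.
  have st0 : 0 <= s - t by rewrite subr_ge0.
  rewrite (_ : Q s x = Q (t + (s - t)) x); last by rewrite subrKC.
  rewrite (nm_eqv ipP (sg_increment x t0 st0)).
  by apply: le_lt_trans (HM _ _ t0 (lexx _)) _; exact/fin/hd.
rewrite ltr0_norm ?subr_lt0// opprB => std.
have ts0 : 0 <= t - s by rewrite subr_ge0 ltW.
rewrite (nmBC ipP) (_ : Q t x = Q (s + (t - s)) x); last by rewrite subrKC.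
rewrite (nm_eqv ipP (sg_increment x s0 ts0)).
by apply: le_lt_trans (HM _ _ s0 (ltW st)) _; exact/fin/hd.
Qed.

Lemma sg_commute s t x : 0 <= s -> 0 <= t -> Q s (Q t x) ~~~ Q t (Q s x).
Proof.
move=> s0 t0; apply: (eqv_trans ipP (eqv_sym ipP (sg_D QP x s0 t0))).
by rewrite [s + t]addrC; exact: (sg_D QP).
Qed.

(** Q_t commutes with difference quotients and is bounded, so orbits that start in the domain of the
    generator stay in it. *)
Lemma infinitesimal_sg t x y : 0 <= t -> infinitesimal nm Q x y ->
  infinitesimal nm Q (Q t x) (Q t y).
Proof.
move=> t0 xy; have [M M0 HM] := sg_bounded t.
apply: (@cvg0_le _ _ _ _ _ (fun h => M * nm (h^-1 *: (Q h x - x) - y))); last first.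
  by rewrite -[X in _ --> X](mulr0 M); apply: cvgM; [exact: cvg_cst|exact: xy].
near=> h; have h0 : 0 <= h by near: h; exact: nbhs_right_ge.
rewrite nmge0/= (le_trans _ (HM _ _ t0 (lexx _)))//.
rewrite le_eqVlt; apply/orP; left; apply/eqP/(nm_eqv ipP)/(eqv_sym ipP).
apply: (eqv_trans ipP (sgB _ _ t0)).
refine (eqvB ipP _ (eqv_refl ipP _)); apply: (eqv_trans ipP (sgZ _ _ t0)).
apply: (eqvZ ipP); apply: (eqv_trans ipP (sgB _ _ t0)).
by refine (eqvB ipP _ (eqv_refl ipP _)); exact: sg_commute.
Unshelve. all: by end_near. Qed.

Lemma infinitesimal_ltP x y e : infinitesimal nm Q x y -> 0 < e ->
  exists2 d, 0 < d &
  forall h, 0 < h -> h < d -> nm (h^-1 *: (Q h x - x) - y) < e.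
Proof.
move=> xy e0.
have : \forall t \near 0^'+, nm (t^-1 *: (Q t x - x) - y) < e.
  exact: (cvgr_lt 0 xy).
case=> d /= d0 H; exists d => // h h0 hd.
by apply: H => //; rewrite /= sub0r normrN gtr0_norm.
Qed.

(** The generator only gives a right derivative at time 0. On the right of t the quotient is the
    image under Q_t of the one at 0; on the left it is the image under the moving operator Q_(h+t),
    controlled by [sg_bounded], and continuity of the orbit of y replaces Q_(h+t) y by Q_t y. *)
Lemma sg_derivable t x y : 0 < t -> infinitesimal nm Q x y ->
  nm (h^-1 *: (Q (h + t) x - Q t x) - Q t y) @[h --> 0^'] --> 0.
Proof.
move=> t0 xy; apply/cvgrPdist_lt => /= e e0.
have [M M0 HM] := sg_bounded t.
have eM : 0 < e / (2 * (M + 1)) by rewrite divr_gt0// mulr_gt0// ltr_wpDl.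
have [d1 d10 hd1] := infinitesimal_ltP xy eM.
have e2 : 0 < e / 2 by rewrite divr_gt0.
have [d2 d20 hd2] := sg_continuous y (ltW t0) e2.
have fin z : nm z < e / (2 * (M + 1)) -> M * nm z < e / 2.
  rewrite ltr_pdivlMr ?mulr_gt0 ?ltr_wpDl// => zM.
  have := nmge0 z; have := mulr_ge0 M0 (nmge0 z); lra.
near=> h.
have hd : `|h| < Num.min d1 (Num.min d2 t).
  by near: h; apply: dnbhs0_lt; rewrite !lt_min d10 d20.
move: hd; rewrite !lt_min => /and3P[h1 h2 ht].
have hn0 : h != 0 by near: h; exact: nbhs_dnbhs_neq.
rewrite sub0r normrN (ger0_norm (nmge0 _)).
have [h0|h0] := ltP 0 h.
  move: h1; rewrite gtr0_norm// => h1.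
  have -> : nm (h^-1 *: (Q (h + t) x - Q t x) - Q t y) =
      nm (Q t (h^-1 *: (Q h x - x) - y)).
    apply: (nm_eqv ipP); apply: (eqv_sym ipP).
    apply: (eqv_trans ipP (sgB _ _ (ltW t0))).
    refine (eqvB ipP _ (eqv_refl ipP _)).
    apply: (eqv_trans ipP (sgZ _ _ (ltW t0))).
    apply: (eqvZ ipP); apply: (eqv_sym ipP).
    by rewrite [h + t]addrC; apply: sg_increment; exact: ltW.
  apply: le_lt_trans (HM _ _ (ltW t0) (lexx _)) _.
  by have := fin _ (hd1 _ h0 h1); lra.
have {hn0}h0 : h < 0 by rewrite lt_neqAle hn0.
move: h1 h2 ht; rewrite ltr0_norm// => h1 h2 ht.
have k0 : 0 < - h by rewrite oppr_gt0.
have s0 : 0 <= h + t by lra.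
have st : h + t <= t by lra.
apply: le_lt_trans (nmB ipP _ (Q (h + t) y) _) _.
have -> : nm (h^-1 *: (Q (h + t) x - Q t x) - Q (h + t) y) =
    nm (Q (h + t) ((- h)^-1 *: (Q (- h) x - x) - y)).
  apply: (nm_eqv ipP); apply: (eqv_sym ipP).
  apply: (eqv_trans ipP (sgB _ _ s0)).
  refine (eqvB ipP _ (eqv_refl ipP _)).
  apply: (eqv_trans ipP (sgZ _ _ s0)).
  rewrite invrN scaleNr -scalerN; apply: (eqvZ ipP).
  rewrite -(opprB (Q t x)) -opprD (nmN ipP).
  apply: (eqv_trans ipP (eqv_sym ipP (sg_increment _ s0 (ltW k0)))).
  by rewrite (_ : h + t - h = t); [exact: (eqv_refl ipP)|lra].
have := fin _ (hd1 _ k0 h1).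
have := HM (h + t) ((- h)^-1 *: (Q (- h) x - x) - y) s0 st.
have : nm (Q (h + t) y - Q t y) < e / 2.
  by apply: hd2 => //; rewrite addrK ltr0_norm.
by set A := nm _; set B := nm _; set C := nm _; lra.
Unshelve. all: by end_near. Qed.

Lemma sg_cvg_dnbhs t x : 0 < t -> nm (Q (h + t) x - Q t x) @[h --> 0^'] --> 0.
Proof.
move=> t0; apply/cvgrPdist_lt => /= e e0.
have [d d0 hd] := sg_continuous x (ltW t0) e0.
near=> h.
have : `|h| < Num.min d t by near: h; apply: dnbhs0_lt; rewrite lt_min d0.
rewrite lt_min => /andP[h1 ht].
rewrite sub0r normrN (ger0_norm (nmge0 _)).
apply: hd; last by rewrite addrK.
by move: ht; rewrite ltr_norml; lra.
Unshelve. all: by end_near. Qed.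

Lemma is_derive_ip_sg t x y x' y' : 0 < t ->
  infinitesimal nm Q x y -> infinitesimal nm Q x' y' ->
  is_derive t (1 : R) (fun s => ip (Q s x) (Q s x'))
    (ip (Q t y) (Q t x') + ip (Q t x) (Q t y')).
Proof.
move=> t0 xy xy'; set f := (fun s => _); set d := (X in is_derive _ _ _ X).
have key : (fun h => h^-1 *: ((f \o shift t) (h *: (1 : R)) - f t)) @ 0^' --> d.
  (* Leibniz splitting: the first difference is paired with the second factor at the shifted time h
     + t. *)
  have : (fun h => ip (h^-1 *: (Q (h + t) x - Q t x)) (Q (h + t) x') +
      ip (Q t x) (h^-1 *: (Q (h + t) x' - Q t x'))) @ 0^' --> d.
    apply: cvgD; apply: (ip_cvg ipP).
    - exact: sg_derivable.
    - exact: sg_cvg_dnbhs.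
    - by rewrite (eqv_refl ipP); exact: cvg_cst.
    - exact: sg_derivable.
  apply: cvg_trans; apply: near_eq_cvg; near=> h.
  rewrite /f /= [h *: 1]mulr1 (ipZl ipP) (ipZr ipP) !(ipE ipP).
  by rewrite -[_ *: _]/(_ * _); ring.
split; first by apply/cvg_ex; exists d.
exact/cvg_lim.
Unshelve. all: by end_near. Qed.

Lemma ip_sg_cvg0 x y : ip (Q s x) (Q s y) @[s --> 0^'+] --> ip (Q 0 x) (Q 0 y).
Proof.
rewrite (ip_eqv ipP (sg_0 QP x) (sg_0 QP y)).
by apply: (ip_cvg ipP); exact: (sg_cvg QP).
Qed.

End semigroup.

(** Orbits are differentiated at positive times only; the endpoint 0 enters through continuity from
    the right. *)
Lemma MVT_right0 {R : realType} (f df : R -> R) :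
  (forall t : R, 0 < t -> is_derive t (1 : R) f (df t)) ->
  f s @[s --> 0^'+] --> f 0 -> forall s t : R, 0 <= s -> s < t ->
  exists2 c, c \in `]s, t[%R & f t - f s = df c * (t - s).
Proof.
move=> fdf f0 s t s0 st; apply: MVT => //.
  by move=> u; rewrite in_itv/= => /andP[su _]; apply: fdf; exact: le_lt_trans su.
have : {within `[0, +oo[, continuous f}.
  apply/continuous_within_itvcyP; split => // u; rewrite in_itv/= andbT => u0.
  apply: differentiable_continuous; apply/derivable1_diffP.
  by have [] := fdf _ u0.
apply: continuous_subspaceW => u /=; rewrite !in_itv/= andbT => /andP[su _].
exact: le_trans su.
Qed.

(** * Decay along orbits and the time integral *)

Section semigroup_asymptotics.
Context {R : realType} {V : lmodType R} {ip : V -> V -> R}.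
Context (ipP : semi_inner_product ip).
Local Notation nm := (seminorm ip).
Context (complete : forall u : nat -> V,
  (forall n, nm (u n.+1 - u n) <= 3^-1 ^+ n) ->
  exists x, nm (u n - x) @[n --> \oo] --> 0).
Context {Q : R -> V -> V} (QP : semigroup_mod_null nm Q).
Local Notation gen := (infinitesimal nm Q).
Context (gen_sym : forall x y x' y',
  gen x y -> gen x' y' -> ip x y' = ip y x').
Context {c : V} (c1 : ip c c = 1) (gen_mean : forall x y, gen x y -> ip y c = 0).
Context {lam : R} (lam0 : 0 < lam).
Context (gen_poincare : forall x y, gen x y ->
  lam * (ip x x - ip x c ^+ 2) <= - ip x y).
Context (gen_pos : forall x y, gen x y -> 0 <= ip y y + lam * ip x y).
Context {x0 x1 x2 : V} (g01 : gen x0 x1) (g12 : gen x1 x2).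

Let A (t : R) := ip (Q t x0) (Q t x0).
Let B (t : R) := ip (Q t x0) (Q t x1).
Let C (t : R) := ip (Q t x1) (Q t x1).

Let genQ (t : R) x y : 0 <= t -> gen x y -> gen (Q t x) (Q t y).
Proof. exact: infinitesimal_sg. Qed.

Let dA (t : R) : 0 < t -> is_derive t (1 : R) A (2 * B t).
Proof.
move=> t0; have := is_derive_ip_sg ipP complete QP t0 g01 g01.
by rewrite (ipC ipP (Q t x1)) -mulr2n mulr_natl.
Qed.

Let dB (t : R) : 0 < t -> is_derive t (1 : R) B (2 * C t).
Proof.
move=> t0; have := is_derive_ip_sg ipP complete QP t0 g01 g12.
by rewrite (gen_sym (genQ (ltW t0) g01) (genQ (ltW t0) g12)) -mulr2n mulr_natl.
Qed.

Let dC (t : R) : 0 < t -> derivable C t 1.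
Proof.
by move=> t0; have [] := is_derive_ip_sg ipP complete QP t0 g12 g12.
Qed.

Let m (t : R) := ip (Q t x0) c.

Let m0R : m s @[s --> 0^'+] --> m 0.
Proof.
rewrite /m (ip_eqv ipP (sg_0 QP x0) (eqv_refl ipP c)).
apply: (ip_cvg ipP); first exact: (sg_cvg QP).
by rewrite (eqv_refl ipP); exact: cvg_cst.
Qed.

Let dm (t : R) : 0 < t -> is_derive t (1 : R) m 0.
Proof.
move=> t0.
have key : (fun h => h^-1 *: ((m \o shift t) (h *: (1 : R)) - m t)) @ 0^' -->
    (0 : R).
  have : (fun h => ip (h^-1 *: (Q (h + t) x0 - Q t x0)) c) @ 0^' --> ip (Q t x1) c.
    apply: (ip_cvg ipP); first exact: (sg_derivable ipP complete QP t0 g01).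
    by rewrite (eqv_refl ipP); exact: cvg_cst.
  rewrite (gen_mean (genQ (ltW t0) g01)).
  apply: cvg_trans; apply: near_eq_cvg; near=> h.
  by rewrite /m /= [h *: 1]mulr1 (ipZl ipP) (ipBl ipP).
split; first by apply/cvg_ex; exists 0.
exact/cvg_lim.
Unshelve. all: by end_near. Qed.

Let mE (t : R) : 0 <= t -> m t = m 0.
Proof.
rewrite le_eqVlt => /predU1P[<-//|t0].
have [s _] := MVT_right0 dm m0R (lexx 0) t0.
by rewrite mul0r => /eqP; rewrite subr_eq0 => /eqP.
Qed.

(** In the application [c] is the constant function 1. The right-hand side is G(+oo) - G(0) for G =
    (B + lam A) / 2; [gen_pos] makes the integrand nonnegative, as the fundamental theorem on a
    half-line requires, and the second step [x1], [x2] of the orbit makes B differentiable. *)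
Lemma integral_semigroup :
  (\int[lebesgue_measure]_(t in `[0%R, +oo[)
     (ip (Q t x1) (Q t x1) + lam * ip (Q t x0) (Q t x1))%:E =
   ((- ip x0 x1 - lam * (ip x0 x0 - ip x0 c ^+ 2)) / 2)%:E)%E.
Proof.
have q0 x y : ip (Q 0 x) (Q 0 y) = ip x y.
  exact: (ip_eqv ipP (sg_0 QP x) (sg_0 QP y)).
have m0 : m 0 = ip x0 c by exact: (ip_eqv ipP (sg_0 QP x0) (eqv_refl ipP c)).
(* W is the variance along the orbit: the mean m is conserved because the range of the generator is
   orthogonal to [c]. *)
pose W t := A t - m 0 ^+ 2.
have WB (t : R) : 0 <= t -> lam * W t <= - B t.
  by move=> t0; rewrite /W -(mE t0); exact: gen_poincare (genQ t0 g01).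
have W0 (t : R) : 0 <= t -> 0 <= W t.
  move=> t0; rewrite /W -(mE t0) subr_ge0.
  by rewrite (le_trans (cauchy_schwarz_sq ipP _ _))// c1 mulr1.
have Ble (s t : R) : 0 <= s -> s < t -> B s <= B t.
  move=> s0 st; have [u _] := MVT_right0 dB (ip_sg_cvg0 ipP QP (x := x0) (y := x1)) s0 st.
  move=> h; rewrite -subr_ge0 h mulr_ge0 ?mulr_ge0 ?(ip_ge0 ipP)//.
  by rewrite subr_ge0 ltW.
(* As A' = 2 B with B nondecreasing, W 0 >= W 0 - W t >= - 2 t B t. *)
have Bbound (t : R) : 0 < t -> - B t <= W 0 / 2 * t^-1.
  move=> t0; have [u] := MVT_right0 dA (ip_sg_cvg0 ipP QP (x := x0) (y := x0)) (lexx 0) t0.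
  rewrite in_itv/= subr0 => /andP[u0 ut] h; rewrite ler_pdivlMr//.
  have : B u * t <= B t * t by rewrite ler_wpM2r ?Ble// ltW.
  by move: h (W0 t (ltW t0)); rewrite /W; lra.
have Bcvg : B t @[t --> +oo%R] --> 0.
  apply/norm_cvg0P.
  apply: (@cvg0_le _ _ _ _ _ (fun t => W 0 / 2 * t^-1)).
    near=> t; have t0 : 0 < t by near: t; exact: nbhs_pinfty_gt.
    rewrite normr_ge0/= ler0_norm ?Bbound// -oppr_ge0.
    by rewrite (le_trans _ (WB _ (ltW t0)))// mulr_ge0 ?W0// ltW.
  rewrite -[X in _ --> X](mulr0 (W 0 / 2)); apply: cvgM; first exact: cvg_cst.
  exact/gtr0_cvgV0/cvg_id/nbhs_pinfty_gt.
have Wcvg : W t @[t --> +oo%R] --> 0.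
  apply: (@cvg0_le _ _ _ _ _ (fun t => lam^-1 * - B t)).
    near=> t; have t0 : 0 <= t by near: t; exact: nbhs_pinfty_ge.
    by rewrite W0//= ler_pdivlMl// WB.
  rewrite -[X in _ --> X](mulr0 lam^-1) -oppr0.
  by apply: cvgM; [exact: cvg_cst|exact: cvgN].
(* G is a primitive of C + lam B. Both B and W tend to 0, so only the contribution of the conserved
   mean survives at infinity. *)
pose G t := (B t + lam * A t) / 2.
have Gcvg : G t @[t --> +oo%R] --> lam * m 0 ^+ 2 / 2.
  have -> : G = (fun t => 2^-1 * (B t + lam * W t) + lam * m 0 ^+ 2 / 2).
    by apply/funext => t; rewrite /G /W; field.
  rewrite -[X in _ --> X]add0r; apply: cvgD; last exact: cvg_cst.
  rewrite -[X in _ --> X](mulr0 2^-1); apply: cvgM; first exact: cvg_cst.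
  rewrite -[X in _ --> X]add0r; apply: cvgD => //.
  by rewrite -[X in _ --> X](mulr0 lam); apply: cvgM; first exact: cvg_cst.
have dG (t : R) : 0 < t -> is_derive t (1 : R) G (C t + lam * B t).
  move=> t0; have hA := dA t0; have hB := dB t0.
  have -> : G = 2^-1 \*: (B + lam \*: A).
    by apply/funext => s; rewrite /G mulrC.
  apply: is_derive_eq.
  by rewrite -![_ *: _]/(_ * _); field.
rewrite (@ge0_continuous_FTC2y _ _ G 0 (lam * m 0 ^+ 2 / 2)).
- by rewrite /G /A /B !q0 m0 -EFinB; congr EFin; field.
- by move=> t t0; exact: gen_pos (genQ t0 g01).
- apply/continuous_within_itvcyP; split.
    move=> t; rewrite in_itv/= andbT => t0.
    apply: cvgD; last apply: cvgM; first 2 [exact: cvg_cst].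
    + by apply: differentiable_continuous; exact/derivable1_diffP/dC.
    + by apply: differentiable_continuous; apply/derivable1_diffP; have [] := dB t0.
  by apply: cvgD; [|apply: cvgM; [exact: cvg_cst|]]; exact: (ip_sg_cvg0 ipP QP).
- exact: Gcvg.
- by move=> t /dG[].
- apply: cvgM; last exact: cvg_cst.
  by apply: cvgD; [|apply: cvgM; [exact: cvg_cst|]]; exact: (ip_sg_cvg0 ipP QP).
- by move=> t; rewrite in_itv/= andbT => /dG[_ <-]; rewrite derive1E.
Unshelve. all: by end_near. Qed.

End semigroup_asymptotics.

(** * The space L^2(m) *)

Section L2_toolkit.
Context {R : realType} {m : probability (measurableTypeR R) R}.
Implicit Types f g h : R -> R.
Local Notation L2 := (L2 m).

Definition ip2 (m : probability (measurableTypeR R) R) (f g : R -> R) : R :=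
  \int[m]_x (f x * g x).
Local Notation ip := (ip2 m).
Definition L2norm (m : probability (measurableTypeR R) R) (f : R -> R) : R :=
  Num.sqrt (ip2 m f f).

Lemma L2_measurable f : L2 f -> measurable_fun setT f.
Proof. by rewrite /L2 inE => /andP[/[!inE]]. Qed.

Lemma integrable_le f g : measurable_fun setT f ->
  m.-integrable setT (EFin \o g) -> (forall x, `|f x| <= g x) ->
  m.-integrable setT (EFin \o f).
Proof.
move=> mf ig fg; apply: le_integrable ig => //; first exact/measurable_EFinP.
move=> x _ /=; rewrite lee_fin (le_trans (fg x))//; exact: ler_norm.
Qed.

Lemma integral_sqr_norm f :
  (\int[m]_x (`|(EFin \o f) x| `^ 2) = \int[m]_x (f x ^+ 2)%:E)%E.
Proof.
by apply: eq_integral => x _ /=; rewrite powR_mulrn// real_normK ?num_real.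
Qed.

Lemma L2P f : L2 f <->
  measurable_fun setT f /\ m.-integrable setT (EFin \o (fun x => f x ^+ 2)).
Proof.
split=> [hf|[mf ff]]; first by split; [exact: L2_measurable|exact: Lfun2_integrable_sqr].
rewrite /L2 inE; apply/andP; split; rewrite inE//= /finite_norm unlock poweR_lty//.
rewrite integral_sqr_norm; move/integrableP : ff => [_].
by under eq_integral do rewrite /= ger0_norm ?sqr_ge0//.
Qed.

Lemma L2_le f g : measurable_fun setT f -> L2 g -> (forall x, `|f x| <= `|g x|) ->
  L2 f.
Proof.
move=> mf /L2P[mg gg] fg; apply/L2P; split => //.
apply: integrable_le gg _; first exact: measurable_funX.
by move=> x; rewrite normrX -[leRHS]real_normK ?num_real// lerXn2r ?nnegrE.
Qed.

Lemma L2_cst c : L2 (cst c).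
Proof. exact: Lfun_cst. Qed.

Lemma L2_bounded f c : measurable_fun setT f -> (forall x, `|f x| <= c) -> L2 f.
Proof.
move=> mf fc; apply: (L2_le mf (L2_cst c)) => x /=.
by rewrite (le_trans (fc x))// ler_norm.
Qed.

Lemma L2_lin a f g : L2 f -> L2 g -> L2 (fun x => a * f x + g x).
Proof.
move=> hf hg; pose F := Lfun_Sub (lee1n 2) hf; pose G := Lfun_Sub (lee1n 2) hg.
exact: (LfunP (a *: F + G)).
Qed.

Lemma L2Z a f : L2 f -> L2 (fun x => a * f x).
Proof.
by move=> hf; have := L2_lin a hf (L2_cst 0); under eq_fun do rewrite addr0.
Qed.

Lemma L2D f g : L2 f -> L2 g -> L2 (f \+ g).
Proof.
by move=> hf hg; have := L2_lin 1 hf hg; under eq_fun do rewrite mul1r.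
Qed.

Lemma L2B f g : L2 f -> L2 g -> L2 (f \- g).
Proof.
move=> hf hg; have := L2_lin (-1) hg hf.
by under eq_fun do rewrite mulN1r addrC.
Qed.

Lemma L2_integrableM f g : L2 f -> L2 g ->
  m.-integrable setT (EFin \o (fun x => f x * g x)).
Proof. by move=> hf hg; exact/Lfun1_integrable/Lfun2_mul_Lfun1. Qed.

Lemma L2_integrable f : L2 f -> m.-integrable setT (EFin \o f).
Proof.
move=> hf; have := L2_integrableM hf (L2_cst 1).
by under eq_fun do rewrite mulr1.
Qed.

Lemma ip2C f g : ip f g = ip g f.
Proof. by apply: eq_Rintegral => x _; rewrite mulrC. Qed.

Lemma ip2_lin a f g h : L2 f -> L2 g -> L2 h ->
  ip (fun x => a * f x + g x) h = a * ip f h + ip g h.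
Proof.
move=> hf hg hh; rewrite /ip2.
under eq_Rintegral do rewrite mulrDl -mulrA.
rewrite RintegralD//=; last 2 first.
- have := L2_integrableM (L2Z a hf) hh.
  by apply: eq_integrable => // x _ /=; rewrite mulrA.
- exact: L2_integrableM.
rewrite RintegralZl//; exact: L2_integrableM.
Qed.

Lemma ip2_ge0 f : 0 <= ip f f.
Proof. by apply: Rintegral_ge0 => x _; rewrite -expr2 sqr_ge0. Qed.

Lemma EFin_ip2 f : L2 f -> (ip f f)%:E = (\int[m]_x (f x ^+ 2)%:E)%E.
Proof.
move=> hf; rewrite /ip2 /Rintegral fineK//.
exact: integrable_fin_num (L2_integrableM hf hf).
Qed.

Lemma nrm_sq f : L2norm m f ^+ 2 = ip f f.
Proof. by rewrite sqr_sqrtr ?ip2_ge0. Qed.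

Lemma Lnorm2E f : L2 f -> ('N[m]_2%:E [EFin \o f] = (L2norm m f)%:E)%E.
Proof.
move=> hf; rewrite unlock.
rewrite integral_sqr_norm -EFin_ip2//.
by rewrite poweR_EFin powR12_sqrt ?ip2_ge0.
Qed.

Lemma L2distE f g : L2 f -> L2 g -> L2dist m f g = (L2norm m (f \- g))%:E.
Proof. by move=> hf hg; rewrite /L2dist Lnorm2E//; exact: L2B. Qed.

Lemma nrm_eq0 f : L2 f -> L2norm m f = 0 -> f = cst 0 %[ae m].
Proof.
move=> hf f0; have h : ('N[m]_2%:E[EFin \o f] = 0)%E by rewrite Lnorm2E// f0.
have mf : measurable_fun setT (EFin \o f) by apply/measurable_EFinP; exact: L2_measurable.
have := Lnorm_eq0_eq0 (mu := m) (p := 2%:E) mf.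
rewrite lte_fin ltr0n => /(_ isT h); apply: filterS => x hx _; by have [] := hx I.
Qed.

Lemma ip2_ae f g f' g' : L2 f -> L2 g -> L2 f' -> L2 g' ->
  f = f' %[ae m] -> g = g' %[ae m] -> ip f g = ip f' g'.
Proof.
move=> hf hg hf' hg' ff gg; rewrite /ip2 /Rintegral; congr fine.
apply: ae_eq_integral => //.
- exact: measurable_int (L2_integrableM hf hg).
- exact: measurable_int (L2_integrableM hf' hg').
- apply: (filterS2 _ _ ff gg); first exact: (ae_filter_ringOfSetsType m).
  by move=> x h1 h2 _; rewrite /= h1// h2.
Qed.

(** Fatou's lemma on squares gives membership and the norm bound at once. It serves for
    completeness, for identifying pointwise limits with L^2 limits, and for the square integrability
    of [id]. *)
Lemma L2_fatou (u : nat -> R -> R) f K :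
  (forall n, measurable_fun setT (u n)) -> measurable_fun setT f ->
  {ae m, forall x, u n x @[n --> \oo] --> f x} ->
  (forall n, (\int[m]_x (u n x ^+ 2)%:E <= K%:E)%E) ->
  L2 f /\ ip f f <= K.
Proof.
move=> mu mf uf uK.
have mu2 n : measurable_fun setT (fun x => (u n x ^+ 2)%:E).
  by apply/measurable_EFinP; exact: measurable_funX.
have mf2 : measurable_fun setT (fun x => (f x ^+ 2)%:E).
  by apply/measurable_EFinP; exact: measurable_funX.
have ge : (\int[m]_x (f x ^+ 2)%:E <= K%:E)%E.
  have le := @fatou _ _ _ m setT measurableT _ mu2.
  have {}le := le (fun n x _ => sqr_ge0 (u n x)).
  have E : (\int[m]_x limn_einf (fun n => (u n x ^+ 2)%:E) =
      \int[m]_x (f x ^+ 2)%:E)%E.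
    apply: ae_eq_integral => //.
      apply: measurableT_comp => //.
      apply: measurable_fun_limn_esup => n.
      exact: (measurableT_comp (@oppe_measurable R setT) (mu2 n)).
    apply: (@filterS _ _ (ae_filter_ringOfSetsType m) _ _ _ uf) => x ux _.
    have : ((u n x ^+ 2)%:E @[n --> \oo] --> (f x ^+ 2)%:E)%E.
      apply: cvg_EFin; first exact: nearW.
      by rewrite /= !expr2; exact: cvgM.
    by move/cvg_limn_einf_sup => [].
  rewrite E in le; apply: (le_trans le); rewrite limn_einf_lim.
  apply: lime_le; first exact: is_cvg_einfs.
  apply: nearW => n; apply: (le_trans _ (uK n)).
  by apply: ereal_inf_lbound; exists n => /=.
have L2f : L2 f.
  apply/L2P; split => //; apply/integrableP; split => //.
  under eq_integral do rewrite /= ger0_norm ?sqr_ge0//.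
  exact: le_lt_trans ge (ltry _).
by split => //; rewrite -lee_fin EFin_ip2.
Qed.

End L2_toolkit.

(** * L^2(m) as a complete semi-inner product space *)

Section L2_complete.
Context {R : realType} {m : probability (measurableTypeR R) R}.
Implicit Types f g h : R -> R.
Local Notation L2 := (L2 m).
Local Notation ip := (ip2 m).
Local Notation nrm := (L2norm m).

(** Defined on bundled square-integrable functions, not on classes, so that the abstract lemmas
    apply to representatives and the seminorm of [ipV] is [L2norm] by conversion. *)
Definition ipV (f g : LfunType m (lee1n 2)) : R := ip f g.

Lemma ipVP : semi_inner_product ipV.
Proof.
split=> [x y|a x y z|x]; [exact: ip2C| |exact: ip2_ge0].
by apply: ip2_lin; exact: LfunP.
Qed.

Definition packL2 f (hf : L2 f) : LfunType m (lee1n 2) := Lfun_Sub (lee1n 2) hf.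

Lemma ip2_cauchy_schwarz f g : L2 f -> L2 g -> `|ip f g| <= nrm f * nrm g.
Proof. by move=> hf hg; exact: (cauchy_schwarz ipVP (packL2 hf) (packL2 hg)). Qed.

Lemma nrmD f g : L2 f -> L2 g -> nrm (f \+ g) <= nrm f + nrm g.
Proof. by move=> hf hg; exact: (nmD ipVP (packL2 hf) (packL2 hg)). Qed.

Lemma nrmB f g h : L2 f -> L2 g -> L2 h -> nrm (f \- h) <= nrm (f \- g) + nrm (g \- h).
Proof. by move=> hf hg hh; exact: (nmB ipVP (packL2 hf) (packL2 hg) (packL2 hh)). Qed.

Lemma nrmBC f g : nrm (f \- g) = nrm (g \- f).
Proof.
by rewrite /L2norm /ip2; congr Num.sqrt; apply: eq_Rintegral => x _ /=; ring.
Qed.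

Lemma nrm_le f a : 0 <= a -> ip f f <= a ^+ 2 -> nrm f <= a.
Proof.
by move=> a0 /ler_wsqrtr; rewrite sqrtr_sqr ger0_norm.
Qed.

Lemma nrm_le_fun f g : L2 f -> L2 g -> (forall x, `|f x| <= `|g x|) -> nrm f <= nrm g.
Proof.
move=> hf hg fg; apply: ler_wsqrtr; apply: le_Rintegral => //.
- exact: L2_integrableM.
- exact: L2_integrableM.
- move=> x _; rewrite -!expr2 -[leLHS]real_normK ?num_real//.
  by rewrite -[leRHS]real_normK ?num_real// lerXn2r ?nnegrE.
Qed.

Lemma ip2_cst1 f : ip f (cst 1) = \int[m]_x f x.
Proof. by apply: eq_Rintegral => x _; rewrite mulr1. Qed.

Lemma ip2_11 : ip (cst 1) (cst 1) = 1.
Proof.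
rewrite ip2_cst1 Rintegral_cst// mul1r; have /= := @probability_setT _ _ _ m.
by move=> ->.
Qed.

Lemma nrm1 : nrm (cst 1) = 1.
Proof. by rewrite /L2norm ip2_11 sqrtr1. Qed.

Lemma L2_norm f : L2 f -> L2 (fun x => `|f x|).
Proof.
move=> hf; apply: (L2_le _ hf) => [|x]; last by rewrite normr_id.
by apply: measurableT_comp => //; exact: L2_measurable hf.
Qed.

Lemma L1_le_nrm f : L2 f -> (\int[m]_x `|f x|%:E <= (nrm f)%:E)%E.
Proof.
move=> hf; have hn := L2_norm hf.
have := ip2_cauchy_schwarz hn (L2_cst 1).
rewrite nrm1 mulr1 ip2_cst1 => h.
have -> : (\int[m]_x `|f x|%:E = (\int[m]_x `|f x|)%:E)%E.
  by rewrite /Rintegral fineK//; exact: integrable_fin_num (L2_integrable hn).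
rewrite lee_fin (le_trans (ler_norm _))// (le_trans h)//.
by apply: nrm_le_fun => // x; rewrite normr_id.
Qed.

(** Riesz-Fischer argument: the norms of the increments are summable, so the series of their
    absolute values is integrable, hence finite almost everywhere, and the sequence converges
    there. *)
Lemma L2_complete (u : nat -> R -> R) : (forall n, L2 (u n)) ->
  (forall n, nrm (u n.+1 \- u n) <= 3^-1 ^+ n) ->
  exists2 f, L2 f & nrm (u n \- f) @[n --> \oo] --> 0.
Proof.
move=> hu du; pose d n := u n.+1 \- u n.
have hd n : L2 (d n) by exact: L2B.
have md n : measurable_fun setT (fun x => `|d n x|%:E).
  by apply/measurable_EFinP; exact: L2_measurable (L2_norm (hd n)).
pose g x := (\sum_(n <oo) `|d n x|%:E)%E.
have mg : measurable_fun setT g.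
  by apply: ge0_emeasurable_sum => // n x _ _; rewrite lee_fin.
have sg : (\int[m]_x g x <= (3 / 2)%:E)%E.
  rewrite integral_nneseries//.
  apply: lime_le; first by apply: is_cvg_nneseries => n _ _;
    apply: integral_ge0 => x _; rewrite lee_fin.
  apply: nearW => n.
  apply: (@le_trans _ _ ((3 / 2 * (1 - 3^-1 ^+ n))%:E)); last first.
    rewrite lee_fin; have : 0 <= (3^-1 : R) ^+ n by rewrite exprn_ge0.
    lra.
  elim: n => [|n IH]; first by rewrite big_geq// subrr mulr0.
  rewrite big_nat_recr//=; apply: (le_trans (leeD IH (L1_le_nrm (hd n)))).
  by rewrite lee_fin exprS; have := du n; rewrite -/(d n); lra.
have ig : m.-integrable setT g.
  apply/integrableP; split => //.
  under eq_integral do rewrite gee0_abs ?nneseries_ge0//.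
  exact: le_lt_trans sg (ltry _).
(* An upper limit is defined and measurable everywhere; [fine] supplies real values on the null set
   where it may be infinite. *)
pose f x := fine (limn_esup (fun n => (u n x)%:E)).
have mf : measurable_fun setT f.
  apply: measurableT_comp => //; apply: measurable_fun_limn_esup => n.
  by apply/measurable_EFinP; exact: L2_measurable (hu n).
have uf : {ae m, forall x, u n x @[n --> \oo] --> f x}.
  apply: (@filterS _ _ (ae_filter_ringOfSetsType m) _ _ _ (integrable_ae measurableT ig)).
  move=> x /(_ I) gx.
  have : cvgn (u ^~ x).
    have ub n : \sum_(0 <= k < n) `|d k x| <= fine (g x).
      rewrite -lee_fin fineK// -sumEFin.
      by apply: nneseries_lim_ge => k _ _; rewrite lee_fin.
    have c1 : cvgn [normed series (d ^~ x)].
      apply: nondecreasing_is_cvgn; last first.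
        by exists (fine (g x)) => _ [n _ <-]; exact: ub.
      apply/nondecreasing_seqP => n.
      change (\sum_(0 <= k < n) `|d k x| <= \sum_(0 <= k < n.+1) `|d k x|).
      by rewrite big_nat_recr//= lerDl.
    have -> : u ^~ x = (fun n => series (d ^~ x) n + u 0%N x).
      by apply/funext => n; rewrite /series/= telescope_sumr ?subrK.
    by apply: is_cvgD; [exact: normed_cvg|exact: is_cvg_cst].
  move=> ux; have h : (u n x)%:E @[n --> \oo] --> (limn (u ^~ x))%:E.
    by apply: cvg_EFin; [exact: nearW|exact: ux].
  by rewrite /f (cvg_limn_einf_sup h).2.
have st n k : nrm (u (n + k)%N \- u n) <= 3 / 2 * 3^-1 ^+ n.
  rewrite nrmBC.
  have := geometric_steps ipVP (u := fun n => packL2 (hu n)) du n k.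
  have : 0 <= (3^-1 : R) ^+ (n + k) by rewrite exprn_ge0.
  set A := L2norm _ _; set B := seminorm _ _; have -> : B = A by []; lra.
(* Fatou is applied to u_(n+k) - u_n as k tends to infinity. *)
have tl n : L2 (f \- u n) /\ ip (f \- u n) (f \- u n) <= (3 / 2 * 3^-1 ^+ n) ^+ 2.
  apply: (@L2_fatou _ _ (fun k => u (n + k)%N \- u n)).
  - by move=> k; apply: L2_measurable; exact: L2B.
  - by apply: measurable_funB => //; exact: L2_measurable.
  - apply: (@filterS _ _ (ae_filter_ringOfSetsType m) _ _ _ uf) => x ux.
    apply: cvgB; last exact: cvg_cst.
    move: ux; rewrite -(cvg_shiftn n); apply: cvg_trans; apply: near_eq_cvg.
    by apply: nearW => k /=; rewrite addnC.
  - move=> k; rewrite -EFin_ip2; last exact: L2B.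
    rewrite lee_fin -nrm_sq lerXn2r ?nnegrE ?sqrtr_ge0 ?mulr_ge0 ?exprn_ge0//.
exists f.
  have [h _] := tl 0%N; have := L2D h (hu 0%N).
  by congr (L2 _); apply/funext => x /=; rewrite subrK.
apply: (@cvg0_le _ _ _ _ _ (fun n => 3 / 2 * 3^-1 ^+ n)).
  apply: nearW => n; rewrite sqrtr_ge0/= nrmBC.
  by apply: nrm_le; [rewrite ?mulr_ge0 ?exprn_ge0//; lra|have [] := tl n].
rewrite -[X in _ --> X](mulr0 (3 / 2)); apply: cvgM; first exact: cvg_cst.
by apply: cvg_expr; rewrite ger0_norm ?invr_ge0// invf_lt1 ?ltr1n.
Qed.

End L2_complete.

(** * Derivatives and smooth functions *)

Section calculus.
Context {R : realType}.
Implicit Types f g h df dg : R -> R.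

Definition has_derivative f df := forall x : R, is_derive x (1 : R) f (df x).

Lemma has_derivativeP f : (forall x : R, derivable f x 1) ->
  has_derivative f (f^`()).
Proof. by move=> df x; rewrite derive1E; exact: derivableP. Qed.

Lemma has_derivative_derivable f df : has_derivative f df ->
  forall x : R, derivable f x 1.
Proof. by move=> h x; have [] := h x. Qed.

Lemma has_derivativeE f df : has_derivative f df -> f^`() = df.
Proof. by move=> h; apply/funext => x; rewrite derive1E; have [] := h x. Qed.

Lemma has_derivative_eq f df dg : df =1 dg -> has_derivative f df ->
  has_derivative f dg.
Proof. by move=> e h x; rewrite -e. Qed.

Lemma has_derivative_continuous f df : has_derivative f df -> continuous f.
Proof.
move=> h x; apply: differentiable_continuous; apply/derivable1_diffP.
by have [] := h x.
Qed.

Lemma has_derivative_cst c : has_derivative (fun=> c) (fun=> 0).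
Proof. by move=> x; exact: is_derive_cst. Qed.

Lemma has_derivative_id : has_derivative id (fun=> 1).
Proof. by move=> x; exact: is_derive_id. Qed.

Lemma has_derivativeD f g df dg : has_derivative f df -> has_derivative g dg ->
  has_derivative (fun x => f x + g x) (fun x => df x + dg x).
Proof. by move=> hf hg x; have := hf x; have := hg x => *; exact: is_deriveD. Qed.

Lemma has_derivativeN f df : has_derivative f df ->
  has_derivative (fun x => - f x) (fun x => - df x).
Proof. by move=> hf x; have := hf x => *; exact: is_deriveN. Qed.

Lemma has_derivativeB f g df dg : has_derivative f df -> has_derivative g dg ->
  has_derivative (fun x => f x - g x) (fun x => df x - dg x).
Proof. by move=> hf hg; exact: has_derivativeD (has_derivativeN hg). Qed.

Lemma has_derivativeM f g df dg : has_derivative f df -> has_derivative g dg ->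
  has_derivative (fun x => f x * g x) (fun x => df x * g x + f x * dg x).
Proof.
move=> hf hg x; have := hf x; have := hg x => dgx dfx.
have := is_deriveM dfx dgx; congr (is_derive _ _ _ _).
by rewrite -![_ *: _]/(_ * _); ring.
Qed.

Lemma has_derivativeZ a f df : has_derivative f df ->
  has_derivative (fun x => a * f x) (fun x => a * df x).
Proof. by move=> hf x; have := hf x => h; exact: is_deriveZ. Qed.

Lemma has_derivative_comp f g df dg : has_derivative f df -> has_derivative g dg ->
  has_derivative (fun x => g (f x)) (fun x => dg (f x) * df x).
Proof.
move=> hf hg x; have h1 := hf x; have h2 := hg (f x).
exact: is_derive1_comp.
Qed.

Lemma has_derivative_sqr f df : has_derivative f df ->
  has_derivative (fun x => f x ^+ 2) (fun x => 2 * f x * df x).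
Proof.
move=> hf; under eq_fun do rewrite expr2.
by apply: has_derivative_eq (has_derivativeM hf hf) => x; ring.
Qed.

(** Turns smoothness into a closure property, so that no formula for derivatives of order n is ever
    written. *)
Lemma smooth_sub_closed (C : (R -> R) -> Prop) :
  (forall f, C f -> (forall x : R, derivable f x 1) /\ C f^`()) ->
  forall f, C f -> smooth f.
Proof.
move=> hC f Cf; suff H n : C f^`(n) by move=> n; have [] := hC _ (H n).
by elim: n => // n IH; rewrite derive1nS; have [] := hC _ IH.
Qed.

Lemma smooth_derivable f : smooth f -> has_derivative f (f^`()).
Proof. by move=> sf; apply: has_derivativeP; exact: (sf 0%N). Qed.

Lemma smooth_derive1 f : smooth f -> smooth f^`().
Proof. by move=> sf n; rewrite -derive1Sn; exact: sf. Qed.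

Inductive algebra_over (G : (R -> R) -> Prop) : (R -> R) -> Prop :=
| alg_gen f : G f -> algebra_over G f
| alg_cst c : algebra_over G (fun=> c)
| alg_add f g : algebra_over G f -> algebra_over G g ->
    algebra_over G (fun x => f x + g x)
| alg_mul f g : algebra_over G f -> algebra_over G g ->
    algebra_over G (fun x => f x * g x).

(** By the Leibniz rule the whole algebra is stable under derivation as soon as the derivatives of
    its generators lie in it. *)
Lemma algebra_smooth (G : (R -> R) -> Prop) :
  (forall f, G f -> exists2 df, has_derivative f df & algebra_over G df) ->
  forall f, algebra_over G f -> smooth f.
Proof.
move=> hG; apply: smooth_sub_closed => f Gf.
suff [df fdf Gdf] : exists2 df, has_derivative f df & algebra_over G df.
  by split; [exact: has_derivative_derivable fdf|rewrite (has_derivativeE fdf)].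
elim: Gf => [g /hG//|c|g h Gg [dg hg Gdg] Gh [dh hh Gdh]|
    g h Gg [dg hg Gdg] Gh [dh hh Gdh]].
- by exists (fun=> 0); [exact: has_derivative_cst|exact: alg_cst].
- by exists (fun x => dg x + dh x); [exact: has_derivativeD|exact: alg_add].
- exists (fun x => dg x * h x + g x * dh x); first exact: has_derivativeM.
  by apply: alg_add; exact: alg_mul.
Qed.

Lemma smooth_alg f : algebra_over smooth f -> smooth f.
Proof.
apply: algebra_smooth => g sg; exists (g^`()); first exact: smooth_derivable.
by apply: alg_gen; exact: smooth_derive1.
Qed.

Lemma smooth_cst c : smooth (fun=> c : R).
Proof. by apply: smooth_alg; exact: alg_cst. Qed.

Lemma smoothD f g : smooth f -> smooth g -> smooth (fun x => f x + g x).
Proof. by move=> hf hg; apply: smooth_alg; apply: alg_add; exact: alg_gen. Qed.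

Lemma smoothM f g : smooth f -> smooth g -> smooth (fun x => f x * g x).
Proof. by move=> hf hg; apply: smooth_alg; apply: alg_mul; exact: alg_gen. Qed.

Lemma smooth_id : smooth (id : R -> R).
Proof.
apply: (algebra_smooth (G := fun f => f = id)); last exact: alg_gen.
by move=> _ ->; exists (fun=> 1); [exact: has_derivative_id|exact: alg_cst].
Qed.

Lemma smoothN f : smooth f -> smooth (fun x => - f x).
Proof.
move=> sf; have -> : (fun x => - f x) = (fun x => (fun=> -1) x * f x).
  by apply/funext => x; rewrite mulN1r.
exact (smoothM (f := fun=> -1) (g := f) (@smooth_cst (-1)) sf).
Qed.

Lemma smoothB f g : smooth f -> smooth g -> smooth (fun x => f x - g x).
Proof. by move=> sf sg; exact (smoothD (g := fun x => - g x) sf (smoothN sg)). Qed.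

Lemma smooth_comp f g : smooth f -> smooth g -> smooth (fun x => g (f x)).
Proof.
move=> sf sg.
(* The derivative of u o f is (u' o f) f', a product of one generator of each kind. *)
pose G h := smooth h \/ exists2 u, smooth u & h = (fun x => u (f x)).
apply: (algebra_smooth (G := G)); last by apply: alg_gen; right; exists g.
move=> h [sh|[u su ->]].
  exists (h^`()); first exact: smooth_derivable.
  by apply: alg_gen; left; exact: smooth_derive1.
exists (fun x => derive1 u (f x) * derive1 f x).
  by apply: has_derivative_comp; exact: smooth_derivable.
apply: alg_mul; apply: alg_gen; last by left; exact: smooth_derive1.
by right; exists u^`(); first exact: smooth_derive1.
Qed.

End calculus.

(** * A smooth bump function *)

Section bump.
Context {R : realType}.

(** The classical flat function is the case k = 0. The negative powers are included because the
    derivative of each member is a combination of two later members of the family. *)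
Definition flat_exp (k : nat) (x : R) : R :=
  if 0 < x then x^-1 ^+ k * expR (- x^-1) else 0.

(** From e^y >= y^(k+2) / (k+2)! at y = 1/x. The quadratic decay makes the difference quotients at 0
    tend to 0. *)
Lemma flat_exp_bound k (x : R) : 0 <= flat_exp k x <= k.+2`!%:R * x ^+ 2.
Proof.
rewrite /flat_exp; case: ifPn => x0; last first.
  by rewrite lexx/= mulr_ge0// sqr_ge0.
rewrite mulr_ge0 ?exprn_ge0 ?invr_ge0 ?(ltW x0) ?expR_ge0//=.
have y0 : 0 < x^-1 by rewrite invr_gt0.
have := expR_ge1Dxn k.+1 (ltW y0).
set E := expR x^-1 => h.
have E0 : 0 < E := expR_gt0 _.
have F0 : 0 < (k.+2`!%:R : R) by rewrite ltr0n fact_gt0.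
rewrite expRN -/E ler_pdivrMr//.
have {}h : x^-1 ^+ k.+2 / k.+2`!%:R <= E by lra.
move: h; rewrite ler_pdivrMr// => h.
have -> : x^-1 ^+ k = x ^+ 2 * x^-1 ^+ k.+2.
  by rewrite !exprS; field; rewrite gt_eqF.
have := ler_wpM2l (sqr_ge0 x) h; nra.
Qed.

Lemma has_derivative_flat_exp k : has_derivative (flat_exp k)
  (fun x => - k%:R * flat_exp k.+1 x + flat_exp k.+2 x).
Proof.
move=> x; have [x0|x0|<-] := ltgtP 0 x.
- have xn0 : x != 0 by rewrite gt_eqF.
  have h1 := is_deriveV (f := id) xn0 (is_derive_id x (1 : R)).
  have h2 := is_deriveX k h1.
  rewrite (_ : _ ^+ k = (fun y : R => y^-1 ^+ k)) in h2; last exact: exprfctE.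
  have h3 := @is_derive1_comp R expR (fun y : R => - y^-1) x _ _
    (is_derive_expR (- x^-1)) (is_deriveN h1).
  have h4 := is_deriveM h2 h3.
  have E : \forall y \near x, y^-1 ^+ k * expR (- y^-1) = flat_exp k y.
    by near=> y; rewrite /flat_exp ifT//; near: y; exact: lt_nbhsr.
  have := near_eq_is_derive E h4; congr (is_derive _ _ _ _).
  rewrite /flat_exp x0 -![_ *: _]/(_ * _) /=; set e := expR _.
  case: k {h2 h4 E} => [|k]/=; first by rewrite expr0; field.
  by rewrite !exprS; set a := _ ^+ k; rewrite -natr1; field.
- have E : \forall y \near x, 0 = flat_exp k y.
    near=> y; rewrite /flat_exp ifF//; apply/negbTE; rewrite -leNgt ltW//.
    by near: y; exact: lt_nbhsl.
  have := near_eq_is_derive E (is_derive_cst (0 : R) x (1 : R)).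
  by congr (is_derive _ _ _ _); rewrite /flat_exp ltNge ltW//= mulr0 addr0.
- rewrite /flat_exp ltxx mulr0 addr0.
  have key : (fun h => h^-1 *: ((flat_exp k \o shift 0) (h *: (1 : R)) - flat_exp k 0))
      @ 0^' --> (0 : R).
    apply/norm_cvg0P.
    apply: (@cvg0_le _ _ _ _ _ (fun h => k.+2`!%:R * `|h|)).
      near=> h; have h0 : h != 0 by near: h; exact: nbhs_dnbhs_neq.
      rewrite normr_ge0/= /shift addr0 [h *: 1]mulr1 {2}/flat_exp ltxx subr0.
      have /andP[f0 fb] := flat_exp_bound k h.
      rewrite normrM (ger0_norm f0) normfV ler_pdivrMl ?normr_gt0//.
      apply: le_trans fb _; by rewrite [leRHS]mulrCA -expr2 real_normK ?num_real.
    rewrite -[X in _ --> X](mulr0 k.+2`!%:R); apply: cvgM; first exact: cvg_cst.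
    rewrite -[X in _ --> X](@normr0 _ R); apply: cvg_norm.
    by apply: cvg_within_filter; exact: cvg_id.
  split; first by apply/cvg_ex; exists 0.
  exact/cvg_lim.
Unshelve. all: by end_near. Qed.

Lemma smooth_flat_exp k : smooth (flat_exp k).
Proof.
apply: (algebra_smooth (G := fun f => exists k, f = flat_exp k)).
  move=> _ [j ->]; eexists; first exact: has_derivative_flat_exp.
  apply: alg_add; last by apply: alg_gen; exists j.+2.
  by apply: alg_mul; [exact: alg_cst|apply: alg_gen; exists j.+1].
by apply: alg_gen; exists k.
Qed.

(** [flat_exp 0] takes the value e^-1 at 1; the factor [expR 1] normalizes the value at 0 to 1, so
    that dilations of [cutoff] converge to 1. *)
Definition cutoff (x : R) : R := expR 1 * flat_exp 0 (1 - x ^+ 2).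

Lemma smooth_cutoff : smooth cutoff.
Proof.
have h : smooth (fun x : R => 1 - x * x).
  exact (smoothB (@smooth_cst R 1) (smoothM (@smooth_id R) (@smooth_id R))).
have -> : cutoff = (fun x => (fun=> expR 1) x * flat_exp 0 (1 - x * x)).
  by apply/funext => x; rewrite /cutoff expr2.
exact (smoothM (@smooth_cst R (expR 1)) (smooth_comp h (@smooth_flat_exp 0))).
Qed.

Lemma cutoff0 : cutoff 0 = 1.
Proof.
rewrite /cutoff expr0n/= subr0 /flat_exp ltr01 invr1 expr0 mul1r expRN.
by rewrite mulfV// expR_eq0.
Qed.

Lemma cutoff_eq0 x : 1 <= `|x| -> cutoff x = 0.
Proof.
move=> x1; rewrite /cutoff /flat_exp ifF ?mulr0//; apply/negbTE.
by rewrite -leNgt subr_le0 -[leRHS]real_normK ?num_real ?exprn_ege1.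
Qed.

End bump.

(** * Compactly supported functions *)

Section compact_support.
Context {R : realType}.
Implicit Types f F dF : R -> R.
Local Notation leb := (@lebesgue_measure R).

Definition vanishes_beyond (M : R) f := forall x, M <= `|x| -> f x = 0.

Lemma vanishes_beyondW M N f : M <= N -> vanishes_beyond M f -> vanishes_beyond N f.
Proof. by move=> MN fM x Nx; apply: fM; exact: le_trans Nx. Qed.

Lemma test_functionP f :
  test_function f <-> smooth f /\ exists2 M, 0 < M & vanishes_beyond M f.
Proof.
split=> [[sf /compact_bounded [N [Nr HN]]]|[sf [M M0 fM]]].
  (* Boundedness of the support holds for radii strictly above N, such as |N| + 1; a further 1 turns
     membership in the support into a contradiction. *)
  split => //; exists (`|N| + 2); first by rewrite ltr_wpDl.
  move=> x Nx; apply/eqP/negP => /negP fx0.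
  have : `|x| <= `|N| + 1.
    apply: HN; last exact: subset_closure.
    by rewrite (le_lt_trans (ler_norm _))// ltrDl.
  by lra.
split => //; apply: (subclosed_compact _ (@segment_compact _ (- M) M)).
  exact: closed_closure.
rewrite [X in _ `<=` X](closure_id _).1; last exact: interval_closed.
apply: closureS => x /= /eqP fx; rewrite in_itv/= -ler_norml leNgt.
by apply/negP => /ltW /fM.
Qed.

Lemma continuous_bounded f M : continuous f -> vanishes_beyond M f ->
  exists2 C : R, 0 <= C & forall x, `|f x| <= C.
Proof.
move=> cf fM; pose N : R := `|M|.
have N0 : - N <= N by rewrite ge0_cp ?normr_ge0.
have cn : {within `[- N, N], continuous (fun x => `|f x|)}.
  apply: continuous_subspaceT => x; apply: continuous_comp; first exact: cf.
  exact: norm_continuous.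
have [c _ hc] := EVT_max N0 cn.
exists `|f c| => // x; have [xN|xN] := leP `|x| N.
  by apply: hc; rewrite in_itv/= -ler_norml.
by rewrite fM ?normr0// (le_trans (ler_norm _))// ltW.
Qed.

(** The margin 1 leaves a whole ball around x on which F is 0. *)
Lemma vanishes_beyond_derive F dF M : has_derivative F dF ->
  vanishes_beyond M F -> vanishes_beyond (M + 1) dF.
Proof.
move=> FdF FM x Mx.
have E : \forall y \near x, 0 = F y.
  near=> y; rewrite FM//.
  have : `|x - y| < 1 by near: y; apply/nbhs_ballP; exists 1 => /=.
  have := ler_normD (x - y) y; rewrite subrK; lra.
have [_ <-] := near_eq_is_derive E (is_derive_cst (0 : R) x (1 : R)).
by have [_ <-] := FdF x.
Unshelve. all: by end_near. Qed.

(** All integrations by parts on test functions take this form: an explicit compactly supported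
    primitive is exhibited, and the boundary terms vanish. *)
Lemma Rintegral_derivative_vanishing F dF M : has_derivative F dF -> continuous dF ->
  vanishes_beyond M F -> \int[leb]_x dF x = 0.
Proof.
move=> FdF cdF FM; pose N : R := `|M| + 1.
have dFN : vanishes_beyond N dF.
  apply: vanishes_beyond_derive FdF _; apply: vanishes_beyondW FM; exact: ler_norm.
have N0 : - N < N by rewrite gtrN// ltr_wpDl.
have cF := has_derivative_continuous FdF.
have h : (\int[leb]_(x in `[(- N)%R, N]) (dF x)%:E = (F N)%:E - (F (- N)%R)%:E)%E.
  apply: continuous_FTC2 => //.
  - exact: continuous_subspaceT.
  - split; first by move=> x _; exact: (has_derivative_derivable FdF).
    + exact: cvg_at_right_filter (cF _).
    + exact: cvg_at_left_filter (cF _).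
  - by move=> x _; rewrite (has_derivativeE FdF).
have NN : M <= `|N| by rewrite ger0_norm ?addr_ge0// (le_trans (ler_norm M))// lerDl.
rewrite (FM N)// (FM (- N)) ?normrN// subee// in h.
rewrite /Rintegral; have -> : (\int[leb]_x (dF x)%:E = 0)%E; last by [].
rewrite -h [RHS]integral_mkcond; apply: eq_integral => x _.
rewrite patchE; case: ifPn => // xM.
rewrite dFN//; move: xM; rewrite notin_setE/= in_itv/= => /negP.
by rewrite -ler_norml -ltNge => /ltW.
Qed.

End compact_support.

(** * The measure mu_beta *)

Section omega.
Context {R : realType}.
Implicit Types x s : R.

Lemma omega_ge1 x : 1 <= omega x.
Proof. by rewrite /omega lerDl sqr_ge0. Qed.

Lemma omega_gt0 x : 0 < omega x.
Proof. exact: lt_le_trans (omega_ge1 x). Qed.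

Lemma omega_neq0 x : omega x != 0.
Proof. by rewrite gt_eqF ?omega_gt0. Qed.

Lemma has_derivative_omega : has_derivative (@omega R) (fun x => 2 * x).
Proof.
apply: (has_derivative_eq (df := fun x => 0 + 2 * x * 1)); first by move=> x; ring.
apply: has_derivativeD; first exact: has_derivative_cst.
exact (has_derivative_sqr (@has_derivative_id R)).
Qed.

Lemma omega_powRD x s t : omega x `^ (s + t) = omega x `^ s * omega x `^ t.
Proof. by rewrite powRD// (negbTE (omega_neq0 x)) implybT. Qed.

Lemma omega_powR1 x s : omega x `^ (1 + s) = omega x * omega x `^ s.
Proof. by rewrite omega_powRD powRr1// ltW ?omega_gt0. Qed.

Lemma omega_powR_gt0 x s : 0 < omega x `^ s.
Proof. exact/powR_gt0/omega_gt0. Qed.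

Lemma has_derivative_omega_powR s : has_derivative (fun x => omega x `^ s)
  (fun x => s * omega x `^ (s - 1) * (2 * x)).
Proof.
move=> x; have h1 := has_derivative_omega x.
have h2 := is_derive1_powR s (omega_gt0 x).
exact: (is_derive1_comp h2 h1).
Qed.

Lemma continuous_omega_powR s : continuous (fun x => omega x `^ s).
Proof. exact: has_derivative_continuous (has_derivative_omega_powR s). Qed.

Lemma continuous_omega : continuous (@omega R).
Proof. exact: has_derivative_continuous has_derivative_omega. Qed.

End omega.

Section mu_beta.
Context {R : realType} {beta : R} (hbeta : 3 / 2 <= beta).
Local Notation leb := (@lebesgue_measure R).
Local Notation w := (fun x : R => omega x `^ (- beta)).
Local Notation m := (mu beta).

Lemma weight_le x : w x <= (oneDsqr x)^-1.
Proof.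
have -> : (oneDsqr x)^-1 = omega x `^ (-1) by rewrite powR_inv1// ltW ?omega_gt0.
by apply: ler_powR; [exact: omega_ge1|have := hbeta; lra].
Qed.

(** Comparison with 1 / (1 + x^2), whose integral over a half-line is known, since beta >= 1. *)
Lemma integrable_weight : leb.-integrable setT (EFin \o w).
Proof.
have h : leb.-integrable setT (EFin \o (fun x : R => (oneDsqr x)^-1)).
  have c : continuous (fun x : R => (oneDsqr x)^-1) by exact: continuous_oneDsqrV.
  have g0 (x : R) : 0 <= (oneDsqr x)^-1 by rewrite invr_ge0.
  apply/integrableP; split.
    by apply/measurable_EFinP; exact: continuous_measurable_fun.
  under eq_integral do rewrite /= ger0_norm//.
  rewrite ge0_symfun_integralT//; last by move=> x /=; rewrite /oneDsqr sqrrN.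
  rewrite (_ : [set x | 0 <= x] = `[0, +oo[); last first.
    by apply/seteqP; split => x /=; rewrite in_itv/= andbT.
  by rewrite integral0y_oneDsqr -EFinM ltry.
apply: le_integrable h => //.
  by apply/measurable_EFinP; exact: measurable_omega_powR.
move=> x _ /=; rewrite lee_fin !ger0_norm ?invr_ge0 ?powR_ge0//.
exact: weight_le.
Qed.

Definition mass (beta : R) : R := \int[leb]_x (omega x `^ (- beta)).

Lemma EFin_mass : weight beta setT = (mass beta)%:E.
Proof.
rewrite /weight /mass /Rintegral fineK//.
exact: integrable_fin_num integrable_weight.
Qed.

Lemma mass_gt0 : 0 < mass beta.
Proof.
rewrite lt_neqAle; apply/andP; split; last first.
  by apply: Rintegral_ge0 => x _; rewrite powR_ge0.
apply/eqP => M0; have := EFin_mass; rewrite -M0 /weight => h.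
have h' : (\int[leb]_(x in setT) `|(w x)%:E| = 0)%E.
  rewrite -[RHS]h; apply: eq_integral => x _ /=.
  by rewrite ger0_norm ?powR_ge0.
have mw : measurable_fun setT (EFin \o w).
  by apply/measurable_EFinP; exact: measurable_omega_powR.
have [N [mN N0 hN]] := (ae_eq_integral_abs leb measurableT mw).1 h'.
(* A zero integral would make the positive weight vanish almost everywhere, so that [0, 1] would be
   a null set. *)
have I0 : leb `[0%R, 1%R]%classic = 0%E.
  apply: (subset_measure0 _ mN _ N0) => // x _; apply: hN => /= /(_ I) [] /eqP.
  by apply/negP; rewrite gt_eqF ?normr_gt0 ?gt_eqF ?omega_powR_gt0.
move: I0; rewrite lebesgue_measure_itv/= lte_fin ltr01 sube0 => /eqP.
by rewrite eqe oner_eq0.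
Qed.

Let kw x : R := (mass beta)^-1 * w x.

Let measurable_kw : measurable_fun setT kw.
Proof. by apply: measurable_funM => //; exact: measurable_omega_powR. Qed.

Let integrable_kw : leb.-integrable setT (EFin \o kw).
Proof.
have := integrableZl measurableT (mass beta)^-1 integrable_weight.
by apply: eq_integrable => // x _ /=; rewrite EFinM.
Qed.

Lemma mu_integral A : measurable A -> m A = (\int[leb]_(x in A) (kw x)%:E)%E.
Proof.
move=> mA; rewrite /mu /= /mnormalize.
have E : (weight beta : {measure set (measurableTypeR R) -> \bar R}) setT =
  (mass beta)%:E by exact: EFin_mass.
rewrite E.
rewrite eqe gt_eqF ?mass_gt0//= muleC.
rewrite [weight beta A]/(weight beta A) /weight -ge0_integralZl//.
- by apply/measurable_EFinP/measurable_funTS; exact: measurable_omega_powR.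
- by move=> x _; rewrite lee_fin powR_ge0.
- by rewrite lee_fin invr_ge0 ltW ?mass_gt0.
Qed.

(** The change of variables is stated for the Radon-Nikodym derivative. That derivative agrees with
    [kw] almost everywhere because both have the same integral over every measurable set. *)
Lemma ge0_integral_mu (f : R -> \bar R) : measurable_fun setT f ->
  (forall x, (0 <= f x)%E) ->
  (\int[m]_x f x = \int[leb]_x (f x * (kw x)%:E))%E.
Proof.
move=> mf f0.
have dom : m `<< leb.
  apply/null_content_dominatesP => A mA A0; rewrite mu_integral//.
  by apply: null_set_integral => //; apply/measurable_funTS/measurable_EFinP.
have RNi := Radon_Nikodym_SigmaFinite.f_integrable dom.
rewrite -(Radon_Nikodym_SigmaFinite.change_of_variables dom f0 measurableT mf).
have mRN := measurable_int _ RNi.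
have mk : measurable_fun setT (EFin \o kw) by exact/measurable_EFinP.
apply: ae_eq_integral => //; [exact: emeasurable_funM|exact: emeasurable_funM|].
apply: ae_eqe_mul2l; apply: integral_ae_eq => // E _ mE.
by rewrite -(Radon_Nikodym_SigmaFinite.f_integral dom mE); exact: mu_integral.
Qed.

Lemma integrable_mu (f : R -> R) : measurable_fun setT f ->
  m.-integrable setT (EFin \o f) <->
  leb.-integrable setT (EFin \o (fun x => f x * w x)).
Proof.
move=> mf; have M0 := mass_gt0.
have mfw : measurable_fun setT (fun x => f x * w x).
  by apply: measurable_funM => //; exact: measurable_omega_powR.
have E : (\int[m]_x `|(f x)%:E| =
    (mass beta)^-1%:E * \int[leb]_x `|(f x * w x)%:E|)%E.
  rewrite ge0_integral_mu//; last by do 2 apply: measurableT_comp => //.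
  rewrite -ge0_integralZl//; last 2 first.
  - by apply: measurableT_comp => //; exact/measurable_EFinP.
  - by rewrite lee_fin invr_ge0 ltW.
  apply: eq_integral => x _ /=; rewrite -!EFinM; congr EFin.
  by rewrite normrM (ger0_norm (powR_ge0 _ _)) /kw; ring.
split=> /integrableP[mF].
  rewrite E => h; apply/integrableP; split; first exact/measurable_EFinP.
  rewrite ltey; apply: contraTneq h => ->.
  by rewrite gt0_muley// lte_fin invr_gt0.
move=> h; apply/integrableP; split; first exact/measurable_EFinP.
by rewrite E lte_mul_pinfty// lee_fin invr_ge0 ltW.
Qed.

Lemma Rintegral_mu (f : R -> R) : m.-integrable setT (EFin \o f) ->
  \int[m]_x f x = (mass beta)^-1 * \int[leb]_x (f x * w x).
Proof.
move=> fi; have M0 := mass_gt0; pose g x := f x * w x.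
have mf : measurable_fun setT f by apply/measurable_EFinP; exact: measurable_int fi.
have gi := (integrable_mu mf).1 fi.
have mw : measurable_fun setT w by exact: measurable_omega_powR.
(* The nonnegative case, to be applied to positive and negative parts; these commute with
   multiplication by the nonnegative weight. *)
have part (F G : R -> \bar R) : measurable_fun setT F -> measurable_fun setT G ->
    (forall x, 0 <= F x)%E -> (forall x, G x = F x * (w x)%:E)%E ->
    (\int[m]_x F x = (mass beta)^-1%:E * \int[leb]_x G x)%E.
  move=> mF mG F0 FG; rewrite ge0_integral_mu// -ge0_integralZl//.
  - by apply: eq_integral => x _; rewrite FG /kw EFinM muleCA.
  - by move=> x _; rewrite FG mule_ge0// lee_fin powR_ge0.
  - by rewrite lee_fin invr_ge0 ltW.
have mF := measurable_int _ fi; have mG := measurable_int _ gi.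
have w0 x : 0 <= w x by exact: powR_ge0.
rewrite /Rintegral integralE [in RHS]integralE.
rewrite (part _ ((EFin \o g)^\+)%E); first last.
- move=> x; rewrite !funeposE /= -!EFin_max -EFinM; congr EFin.
  by rewrite maxr_pMl// mul0r.
- by move=> x; exact: funepos_ge0.
- exact: measurable_funepos.
- exact: measurable_funepos.
rewrite (part _ ((EFin \o g)^\-)%E); first last.
- move=> x; rewrite !funenegE /= -!EFin_max -EFinM; congr EFin.
  by rewrite maxr_pMl// mul0r mulNr.
- by move=> x; exact: funeneg_ge0.
- exact: measurable_funeneg.
- exact: measurable_funeneg.
have hp : (\int[leb]_x (EFin \o g)^\+ x \is a fin_num)%E.
  by apply: integrable_fin_num => //; exact: integrable_funepos.
have hn : (\int[leb]_x (EFin \o g)^\- x \is a fin_num)%E.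
  by apply: integrable_fin_num => //; exact: integrable_funeneg.
rewrite -muleBr//; last by rewrite fin_num_adde_defr.
by rewrite fineM// fin_numB hp hn.
Qed.

End mu_beta.

(** * Identities for test functions *)

Section test_functions.
Context {R : realType} {beta : R} (hbeta : 3 / 2 <= beta).
Local Notation leb := (@lebesgue_measure R).
Local Notation w := (fun x : R => omega x `^ (- beta)).
Local Notation m := (mu beta).
Local Notation lam := (2 * (beta - 1)).
Local Notation L := (L0 beta).
Local Notation ip := (ip2 m).
Implicit Types f g u v p q F dF : R -> R.

Lemma lam_gt0 : 0 < lam.
Proof. by have := hbeta; lra. Qed.

Definition cont_vanishing p := continuous p /\ exists M, vanishes_beyond M p.

Lemma continuousMfun f g : continuous f -> continuous g ->
  continuous (fun x => f x * g x : R).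
Proof. by move=> cf cg x; apply: continuousM; [exact: cf|exact: cg]. Qed.

Lemma continuousDfun f g : continuous f -> continuous g ->
  continuous (fun x => f x + g x : R).
Proof. by move=> cf cg x; apply: continuousD; [exact: cf|exact: cg]. Qed.

Lemma cont_vanishingM (h p : R -> R) : continuous h -> cont_vanishing p ->
  cont_vanishing (fun x => h x * p x).
Proof.
move=> ch [cp [M pM]]; split; first exact: continuousMfun.
by exists M => x Mx; rewrite pM// mulr0.
Qed.

Lemma cont_vanishingD p q : cont_vanishing p -> cont_vanishing q ->
  cont_vanishing (fun x => p x + q x).
Proof.
move=> [cp [M pM]] [cq [N qN]]; split; first exact: continuousDfun.
by exists (Num.max M N) => x; rewrite ge_max => /andP[Mx Nx]; rewrite pM// qN// addr0.
Qed.

Lemma cont_vanishingN p : cont_vanishing p -> cont_vanishing (fun x => - p x).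
Proof.
move=> [cp [M pM]]; split; first by move=> x; apply: continuousN; exact: cp.
by exists M => x Mx; rewrite pM// oppr0.
Qed.

Lemma cont_vanishing_sqr p : cont_vanishing p -> cont_vanishing (fun x => p x ^+ 2).
Proof. by move=> cp; exact: cont_vanishingM (proj1 cp) cp. Qed.

Lemma continuousNfun f : continuous f -> continuous (fun x => - f x : R).
Proof. by move=> cf x; apply: continuousN; exact: cf. Qed.

Lemma continuous_sqrfun f : continuous f -> continuous (fun x => f x ^+ 2 : R).
Proof. by move=> cf; exact: continuousMfun. Qed.

Lemma continuous_cstfun (c : R) : continuous ((fun=> c) : R -> R).
Proof. by move=> x; exact: cst_continuous. Qed.

Lemma continuous_idfun : continuous (fun x : R => x).
Proof. by move=> x; exact: cvg_id. Qed.

Lemma measurable_continuous p : continuous p -> measurable_fun setT p.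
Proof. exact: continuous_measurable_fun. Qed.

Lemma continuous_w : continuous w.
Proof. exact: continuous_omega_powR. Qed.

Lemma continuous_om : continuous (fun x : R => omega x).
Proof. exact: continuous_omega. Qed.

Lemma cont_vanishing_L2 p : cont_vanishing p -> L2 m p.
Proof.
move=> [cp [M pM]]; have [C _ hC] := continuous_bounded cp pM.
by apply: (L2_bounded _ hC); exact: measurable_continuous.
Qed.

Lemma mu_integral_derivative p F : cont_vanishing p ->
  has_derivative F (fun x => p x * w x) -> (exists M, vanishes_beyond M F) ->
  \int[m]_x p x = 0.
Proof.
move=> cvp FdF [N FN].
rewrite (Rintegral_mu hbeta); last by apply: L2_integrable; exact: cont_vanishing_L2.
rewrite (Rintegral_derivative_vanishing FdF _ FN) ?mulr0//.
by apply: continuousMfun; [exact: (proj1 cvp)|exact: continuous_w].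
Qed.

(** The form in which a completed square is used: [p] has the same integral as the nonnegative [n],
    because their difference times the weight has a compactly supported primitive [F]. *)
Lemma mu_integral_derivative_ge0 p n F : cont_vanishing p -> cont_vanishing n ->
  (forall x, 0 <= n x) ->
  has_derivative F (fun x => (p x - n x) * w x) -> (exists M, vanishes_beyond M F) ->
  0 <= \int[m]_x p x.
Proof.
move=> cvp cvn n0 FdF FN.
have pn : cont_vanishing (fun x => p x - n x).
  by apply: cont_vanishingD => //; exact: cont_vanishingN.
rewrite (_ : \int[m]_x p x = \int[m]_x (p x - n x) + \int[m]_x n x).
  rewrite (mu_integral_derivative pn FdF FN) add0r.
  by apply: Rintegral_ge0 => x _; exact: n0.
rewrite RintegralB//; first by rewrite subrK.
- by apply: L2_integrable; exact: cont_vanishing_L2.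
- by apply: L2_integrable; exact: cont_vanishing_L2.
Qed.

Let om1 x : R := omega x * w x.

(** [om1] is the coefficient of the divergence form of the operator: (om1 u')' = w L u. *)
Lemma has_derivative_om1 : has_derivative om1 (fun x => - lam * x * w x).
Proof.
have -> : om1 = (fun x => omega x `^ (1 - beta)).
  by apply/funext => x; rewrite omega_powR1.
apply: has_derivative_eq (has_derivative_omega_powR (1 - beta)) => x.
by rewrite (_ : 1 - beta - 1 = - beta); [ring|ring].
Qed.

Record test2 u du ddu : Prop := {
  test2_d : has_derivative u du ;
  test2_dd : has_derivative du ddu ;
  test2_cdd : continuous ddu ;
  test2_v : exists M, [/\ vanishes_beyond M u, vanishes_beyond M du &
                       vanishes_beyond M ddu] }.

Lemma test_function2 u : test_function u -> test2 u (derive1 u) (derive1n 2 u).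
Proof.
move=> /test_functionP[su [M M0 uM]].
have h1 := smooth_derivable su.
have h2 : has_derivative (derive1 u) (derive1n 2 u).
  exact: smooth_derivable (smooth_derive1 su).
have h3 : has_derivative (derive1n 2 u) (derive1n 3 u).
  exact: smooth_derivable (smooth_derive1 (smooth_derive1 su)).
split => //; first exact: has_derivative_continuous h3.
exists (M + 1 + 1); have v1 := vanishes_beyond_derive h1 uM; split.
- by apply: vanishes_beyondW uM; rewrite -addrA lerDl.
- by apply: vanishes_beyondW v1; rewrite lerDl.
- exact: vanishes_beyond_derive h2 v1.
Qed.

Lemma test_function_L0 u : test_function u -> test_function (L u).
Proof.
move=> tu; have [_ _ _ [M [v0 v1 v2]]] := test_function2 tu.
move: tu => /test_functionP[su _]; apply/test_functionP; split.
  have s1 := smooth_derive1 su; have s2 := smooth_derive1 s1.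
  have so : smooth (@omega R).
    have -> : @omega R = (fun x => (fun=> 1) x + id x * id x).
      by apply/funext => x; rewrite /omega expr2.
    exact (smoothD (@smooth_cst R 1) (smoothM (@smooth_id R) (@smooth_id R))).
  have -> : L u = (fun x => omega x * derive1n 2 u x +
      (fun=> - lam) x * (id x * derive1 u x)).
    by apply/funext => x; rewrite /L0 mulNr mulrA.
  exact (smoothD (smoothM so s2)
    (smoothM (@smooth_cst R (- lam)) (smoothM (@smooth_id R) s1))).
exists (`|M| + 1); first by rewrite ltr_wpDl.
move=> x hx; have Mx : M <= `|x|.
  by rewrite (le_trans _ hx)// (le_trans (ler_norm M))// lerDl.
by rewrite /L0 v1// v2// !mulr0 subr0.
Qed.

Lemma test_function_continuous u : test_function u -> continuous u.
Proof.
by move=> /test_function2[h _ _ _]; exact: has_derivative_continuous h.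
Qed.

Lemma test_function_cv u : test_function u -> cont_vanishing u.
Proof.
move=> tu; split; first exact: test_function_continuous.
by have [_ _ _ [M [v _ _]]] := test_function2 tu; exists M.
Qed.

Lemma test_function_L2 u : test_function u -> L2 m u.
Proof. by move=> /test_function_cv/cont_vanishing_L2. Qed.

Lemma test_function_d_cv u : test_function u -> cont_vanishing (derive1 u).
Proof.
move=> /test_function2[_ h _ [M [_ v _]]]; split; last by exists M.
exact: has_derivative_continuous h.
Qed.

Lemma test_function_dd_cv u : test_function u -> cont_vanishing (derive1n 2 u).
Proof. by move=> /test_function2[_ _ h [M [_ _ v]]]; split; last by exists M. Qed.

Ltac cont := repeat first
  [ exact: continuous_idfun | exact: continuous_cstfun | exact: continuous_om
  | exact: continuous_w | assumption | apply: continuous_sqrfun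
  | apply: continuousNfun | apply: continuousDfun | apply: continuousMfun ].

Lemma ip_L0_sym u v : test_function u -> test_function v -> ip u (L v) = ip v (L u).
Proof.
move=> tu tv; have Lu := test_function_L0 tu; have Lv := test_function_L0 tv.
have [u1 u2 cu [M [um _ _]]] := test_function2 tu.
have [v1 v2 cv [N [vm dvm _]]] := test_function2 tv.
apply/eqP; rewrite -subr_eq0 /ip2 -RintegralB//; last 2 first.
- by apply: L2_integrableM; exact: test_function_L2.
- by apply: L2_integrableM; exact: test_function_L2.
apply/eqP.
(* The primitive is [om1] times the Wronskian u v' - v u'. *)
have dF := has_derivativeM has_derivative_om1
  (has_derivativeB (has_derivativeM u1 v2) (has_derivativeM v1 u2)).
apply: (mu_integral_derivative _ (has_derivative_eq _ dF)).
- apply: cont_vanishingD; last apply: cont_vanishingN; apply: cont_vanishingM;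
    by [exact: test_function_continuous|exact: test_function_cv].
- move=> x.
  have key (o c a b a' b' a'' b'' : R) :
      - lam * x * c * (a * b' - b * a') +
      o * c * (a' * b' + a * b'' - (b' * a' + b * a'')) =
      (a * (o * b'' - lam * x * b') - b * (o * a'' - lam * x * a')) * c by ring.
  exact: key.
- by exists N => x Nx; rewrite vm// dvm// mulr0 mul0r subrr mulr0.
Qed.

(** The difference of the two integrands, times the weight, is the derivative of lam om1 (u u' - x
    u'^2); this is checked by expanding the square in omega u'' = L u + lam x u'. *)
Lemma ip_L0_phi u : test_function u ->
  ip (L u) (L u) + lam * ip u (L u) = \int[m]_x (omega x ^+ 2 * derive1n 2 u x ^+ 2).
Proof.
move=> tu; have Lu := test_function_L0 tu.
have [u1 u2 cu [M [um dum ddum]]] := test_function2 tu.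
have cvu := test_function_cv tu; have cvLu := test_function_cv Lu.
have cvdd := test_function_dd_cv tu.
have cvq : cont_vanishing (fun x => omega x ^+ 2 * derive1n 2 u x ^+ 2).
  apply: cont_vanishingM; last exact: cont_vanishing_sqr.
  cont.
have iLL := cont_vanishing_L2 (cont_vanishingM (proj1 cvLu) cvLu).
have iuL := cont_vanishing_L2 (cont_vanishingM (proj1 cvu) cvLu).
have iq := cont_vanishing_L2 cvq.
apply/eqP; rewrite -subr_eq0 /ip2 -RintegralZl//; last exact: L2_integrable.
rewrite -RintegralD//; last 2 first.
- exact: L2_integrable.
- by apply: L2_integrable; exact: L2Z.
rewrite -RintegralB//; last 2 first.
- by apply: L2_integrable; apply: L2D => //; exact: L2Z.
- exact: L2_integrable.
apply/eqP.
have dF := has_derivativeZ lam (has_derivativeM has_derivative_om1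
  (has_derivativeB (has_derivativeM u1 u2)
     (has_derivativeM (@has_derivative_id R) (has_derivative_sqr u2)))).
apply: (mu_integral_derivative _ (has_derivative_eq _ dF)).
- apply: cont_vanishingD; last exact: cont_vanishingN.
  apply: cont_vanishingD; first exact: cont_vanishingM (proj1 cvLu) cvLu.
  apply: cont_vanishingM; first exact: continuous_cstfun.
  exact: cont_vanishingM (proj1 cvu) cvLu.
- by move=> x; rewrite /om1 /L0 /omega/=; ring.
- by exists M => x Mx; rewrite dum// mulr0 expr0n/= mulr0 subrr !mulr0.
Qed.

Lemma ip_L0_energy u : test_function u ->
  - ip u (L u) = \int[m]_x (omega x * derive1 u x ^+ 2).
Proof.
move=> tu; have Lu := test_function_L0 tu.
have [u1 u2 cu [M [um dum ddum]]] := test_function2 tu.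
have cvu := test_function_cv tu; have cvLu := test_function_cv Lu.
have cvd := test_function_d_cv tu.
have cvq : cont_vanishing (fun x => omega x * derive1 u x ^+ 2).
  by apply: cont_vanishingM; [cont|exact: cont_vanishing_sqr].
have cvuL := cont_vanishingM (proj1 cvu) cvLu.
have iuL := cont_vanishing_L2 cvuL.
have iq := cont_vanishing_L2 cvq.
apply/eqP; rewrite eqr_oppLR -addr_eq0 /ip2 -RintegralD//; last 2 first.
- exact: L2_integrable.
- exact: L2_integrable.
apply/eqP.
have dF := has_derivativeM has_derivative_om1 (has_derivativeM u1 u2).
apply: (mu_integral_derivative _ (has_derivative_eq _ dF)).
- exact: cont_vanishingD.
- by move=> x; rewrite /om1 /L0 /omega/=; ring.
- by exists M => x Mx; rewrite dum// !mulr0.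
Qed.

End test_functions.

(** * Weighted primitives and the Poincare inequality for test functions *)

Section cumulative.
Context {R : realType} {beta : R} (hbeta : 3 / 2 <= beta).
Local Notation leb := (@lebesgue_measure R).
Local Notation w := (fun x : R => omega x `^ (- beta)).
Local Notation m := (mu beta).
Local Notation lam := (2 * (beta - 1)).
Local Notation L := (L0 beta).
Local Notation ip := (ip2 m).
Local Notation nrm := (L2norm m).
Implicit Types f g u v p q : R -> R.

Definition cumul (beta : R) g (x : R) : R :=
  \int[leb]_(t in `]-oo, x]) (g t * omega t `^ (- beta)).

Lemma L2_integrable_weight g : L2 m g ->
  leb.-integrable setT (EFin \o (fun x => g x * w x)).
Proof.
move=> hg; apply/(integrable_mu hbeta); first exact: L2_measurable hg.
exact: L2_integrable.
Qed.

Let L2_integrable_weightS g (A : set R) : measurable (A : set (measurableTypeR R)) ->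
  L2 m g -> leb.-integrable A (EFin \o (fun x => g x * w x)).
Proof.
move=> mA hg; apply: (integrableS measurableT) => //.
exact: L2_integrable_weight.
Qed.

Lemma cumul_derivative g : L2 m g -> continuous g ->
  has_derivative (cumul beta g) (fun x => g x * w x).
Proof.
move=> hg cg x.
have xx1 : x < x + 1 by rewrite ltrDl.
have ii : leb.-integrable [set` Interval -oo%O (BRight (x + 1))]
    (EFin \o (fun t => g t * w t)) by exact: L2_integrable_weightS.
have cgw : {for x, continuous (fun t => g t * w t)}.
  by apply: continuousMfun => //; exact: continuous_w.
have [d e] := continuous_FTC1 xx1 ii (ltNyr _) cgw.
by split; [exact: d|rewrite -derive1E; exact: e].
Qed.

Lemma cumulB f g x : L2 m f -> L2 m g ->
  cumul beta (f \- g) x = cumul beta f x - cumul beta g x.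
Proof.
move=> hf hg; rewrite /cumul -RintegralB//; last 2 first.
- exact: L2_integrable_weightS.
- exact: L2_integrable_weightS.
by apply: eq_Rintegral => t _; rewrite mulrBl.
Qed.

(** The bound does not depend on [x]: convergence of g in L^2 gives uniform convergence of its
    weighted primitive. *)
Lemma cumul_bound g x : L2 m g -> `|cumul beta g x| <= mass beta * nrm g.
Proof.
move=> hg; have M0 := mass_gt0 hbeta.
have hn := L2_norm hg.
have e t : `|g t * w t| = `|g t| * w t by rewrite normrM (ger0_norm (powR_ge0 _ _)).
rewrite (le_trans (le_normr_Rintegral _ (L2_integrable_weightS _ hg)))//.
apply: (@le_trans _ _ (\int[leb]_t (`|g t| * w t))).
  have iT := L2_integrable_weight hn.
  have iA : leb.-integrable `]-oo, x] (EFin \o (fun t => `|g t| * w t)).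
    by apply: L2_integrable_weightS.
  under eq_Rintegral do rewrite e.
  apply: fine_le.
  - exact: integrable_fin_num iA.
  - exact: integrable_fin_num iT.
  apply: ge0_subset_integral => //; first exact: measurable_int iT.
  by move=> t _; rewrite lee_fin mulr_ge0// powR_ge0.
have := Rintegral_mu hbeta (L2_integrable hn).
move=> /(congr1 (fun z => mass beta * z)); rewrite mulrA divff ?gt_eqF// mul1r => <-.
rewrite ler_wpM2l ?(ltW M0)// -lee_fin.
apply: le_trans (L1_le_nrm hg).
by rewrite /Rintegral fineK//; exact: integrable_fin_num (L2_integrable hn).
Qed.

(** On the left of the support the integrand is 0; on the right the primitive has reached the full
    integral, which is 0 by the assumption on the mean. *)
Lemma cumul_vanishing f : cont_vanishing f -> \int[m]_x f x = 0 ->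
  exists M, vanishes_beyond M (cumul beta f).
Proof.
move=> cf f0; have [_ [M fM]] := cf; exists `|M| => x Mx.
have fM' t : `|M| <= `|t| -> f t = 0.
  by move=> Mt; apply: fM; exact: le_trans (ler_norm _) Mt.
have [x0|x0] := leP 0 x.
  rewrite /cumul Rintegral_mkcond.
  have -> : \int[leb]_t ((fun t => f t * omega t `^ (- beta)) \_ `]-oo, x]) t =
      \int[leb]_t (f t * w t).
    apply: eq_Rintegral => t _; rewrite patchE; case: ifPn => //.
    rewrite notin_setE/= in_itv/= => /negP; rewrite -ltNge => xt.
    rewrite fM' ?mul0r// (le_trans Mx)// !ger0_norm ?(ltW xt)//.
    by rewrite (le_trans x0)// ltW.
  have := Rintegral_mu hbeta (L2_integrable (cont_vanishing_L2 cf)).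
  rewrite f0 => /esym/eqP; rewrite mulf_eq0 invr_eq0 gt_eqF ?mass_gt0//=.
  by move/eqP.
transitivity (\int[leb]_(t in `]-oo, x]) (0 : R)); last first.
  by rewrite /Rintegral integral0.
apply: eq_Rintegral => t; rewrite inE/= in_itv/= => tx.
rewrite fM' ?mul0r// (le_trans Mx)// !ltr0_norm//; first by rewrite lerN2.
exact: le_lt_trans tx x0.
Qed.

(** Solves the first-order equation omega q' - lam x q = g, which is L v = g for q = v'. *)
Lemma weighted_cumul_derivative g : L2 m g -> continuous g ->
  has_derivative (fun x => omega x `^ (beta - 1) * cumul beta g x)
    (fun x => omega x `^ (-1) *
      (lam * x * (omega x `^ (beta - 1) * cumul beta g x) + g x)).
Proof.
move=> hg cg; have dG := cumul_derivative hg cg.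
apply: has_derivative_eq (has_derivativeM (has_derivative_omega_powR (beta - 1)) dG).
move=> x; apply: (mulfI (omega_neq0 x)).
have o1 : omega x * omega x `^ (-1) = 1.
  by rewrite powR_inv1 ?ltW ?omega_gt0// divff ?omega_neq0.
rewrite [RHS]mulrA o1 mul1r.
have e1 : omega x `^ (beta - 1) = omega x * omega x `^ (beta - 1 - 1).
  by rewrite -omega_powR1; congr (_ `^ _); ring.
have ow : omega x * omega x `^ (beta - 1) * w x = 1.
  rewrite -omega_powR1 -omega_powRD (_ : 1 + (beta - 1) - beta = 0) ?powRr0//.
  by ring.
move: ow; rewrite e1; set a := omega x `^ _; set o := omega x.
set W := _ `^ _; set G := cumul _ _ => h.
have -> : o * ((beta - 1) * a * (2 * x) * G x + o * a * (g x * W)) =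
    lam * x * (o * a * G x) + g x * (o * (o * a) * W) by ring.
by rewrite h mulr1.
Qed.

Lemma poincare_mean0 f : test_function f -> \int[m]_x f x = 0 ->
  lam * ip f f <= - ip f (L f).
Proof.
move=> tf f0; have tLf := test_function_L0 (beta := beta) tf.
have cvf := test_function_cv tf; have cvLf := test_function_cv tLf.
have cvd := test_function_d_cv tf.
have [f1 f2 cddf [N [fN dfN ddfN]]] := test_function2 tf.
have hf : L2 m f by exact: cont_vanishing_L2.
have [M GM] := cumul_vanishing cvf f0.
have dG := cumul_derivative hf (proj1 cvf).
set G := cumul beta f in GM dG.
pose q x := omega x `^ (beta - 1) * G x.
pose dq x := omega x `^ (-1) * (lam * x * q x + f x).
have o1 x : omega x * omega x `^ (-1) = 1.
  by rewrite powR_inv1 ?ltW ?omega_gt0// divff ?omega_neq0.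
have ofq x : omega x * dq x = lam * x * q x + f x by rewrite /dq mulrA o1 mul1r.
have ow x : omega x * omega x `^ (beta - 1) * w x = 1.
  rewrite -omega_powR1 -omega_powRD (_ : 1 + (beta - 1) - beta = 0) ?powRr0//.
  by ring.
have dqE : has_derivative q dq by exact: weighted_cumul_derivative (proj1 cvf).
have cq := has_derivative_continuous dqE.
have cvq : cont_vanishing q.
  by split => //; exists M => x Mx; rewrite /q GM// mulr0.
have cdq : cont_vanishing dq.
  split; last first.
    exists (Num.max M N) => x; rewrite ge_max => /andP[Mx Nx].
    by rewrite /dq fN// /q GM// !mulr0 addr0 mulr0.
  apply: continuousMfun; first exact: continuous_omega_powR.
  apply: continuousDfun; last exact: (proj1 cvf).
  apply: continuousMfun => //; apply: continuousMfun; first exact: continuous_cstfun.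
  exact: continuous_idfun.
(* Both squares vanish when q is constant, since then f = - lam x q and f' = - lam q. *)
pose n x := omega x * (derive1 f x + lam * q x) ^+ 2 + lam * (omega x * dq x) ^+ 2.
have cvn : cont_vanishing n.
  apply: cont_vanishingD; apply: cont_vanishingM.
  - exact: continuous_om.
  - apply: cont_vanishing_sqr; apply: cont_vanishingD => //.
    by apply: cont_vanishingM => //; exact: continuous_cstfun.
  - exact: continuous_cstfun.
  - by apply: cont_vanishing_sqr; apply: cont_vanishingM => //; exact: continuous_om.
have cvff := cont_vanishingM (proj1 cvf) cvf.
have cvfL := cont_vanishingM (proj1 cvf) cvLf.
have cvp : cont_vanishing (fun x => - (f x * L f x) + - lam * (f x * f x)).
  apply: cont_vanishingD; first exact: cont_vanishingN.
  by apply: cont_vanishingM => //; exact: continuous_cstfun.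
have om1 := has_derivative_om1 (beta := beta).
have dA := has_derivativeM om1 (has_derivativeM f1 f2).
have dB := has_derivativeM f1 dG.
have dC := has_derivativeM om1
  (has_derivativeM (@has_derivative_id R) (has_derivative_sqr dqE)).
(* The primitive is - om1 f f' - 2 lam f G - lam^2 om1 x q^2. The first term trades - f L f for
   omega f'^2, the second accounts for the cross term of the first square, and the third for the
   terms quadratic in q. *)
have dF := has_derivativeD (has_derivativeD (has_derivativeZ (-1) dA)
  (has_derivativeZ (- 2 * lam) dB)) (has_derivativeZ (- lam ^+ 2) dC).
have n0 x : 0 <= n x.
  rewrite addr_ge0// mulr_ge0 ?sqr_ge0// ltW ?omega_gt0//.
  exact: (lam_gt0 hbeta).
(* G is rewritten through q so that the remaining identity is polynomial. *)
have GE x : G x = omega x * q x * w x.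
  by rewrite /q -[LHS]mul1r -[X in X * _ = _](ow x); ring.
have := mu_integral_derivative_ge0 hbeta cvp cvn n0 (has_derivative_eq _ dF).
have cvl : L2 m (fun x => f x * f x) by exact: cont_vanishing_L2.
have cvl2 : L2 m (fun x => f x * L f x) by exact: cont_vanishing_L2.
have -> : \int[m]_x (- (f x * L f x) + - lam * (f x * f x)) =
    - ip f (L f) - lam * ip f f.
  rewrite RintegralD//; last 2 first.
  - by apply: L2_integrable; exact: cont_vanishing_L2 (cont_vanishingN cvfL).
  - by apply: L2_integrable; exact: L2Z.
  rewrite RintegralZl//; last exact: L2_integrable.
  rewrite (_ : \int[m]_x - (f x * L f x) = - ip f (L f)); first by rewrite mulNr.
  rewrite /ip2 -mulN1r -RintegralZl//; last exact: L2_integrable.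
  by apply: eq_Rintegral => x _; rewrite mulN1r.
rewrite subr_ge0; apply; last first.
  exists (Num.max M N) => x; rewrite ge_max => /andP[Mx Nx] /=.
  by rewrite fN// /q GM// !(mulr0, mul0r) expr0n/= !mulr0 !addr0.
(* The values are made independent variables, and f is eliminated through omega q' = lam x q + f;
   [ring] then concludes. *)
move=> x; have key (o W y a0 a1 a2 b db : R) : o * db = lam * y * b + a0 ->
    -1 * (- lam * y * W * (a0 * a1) + o * W * (a1 * a1 + a0 * a2)) +
    - 2 * lam * (a1 * (o * b * W) + a0 * (a0 * W)) +
    - lam ^+ 2 * (- lam * y * W * (y * b ^+ 2) +
      o * W * (1 * b ^+ 2 + y * (2 * b * db))) =
    (- (a0 * (o * a2 - lam * y * a1)) + - lam * (a0 * a0) -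
      (o * (a1 + lam * b) ^+ 2 + lam * (o * db) ^+ 2)) * W.
  move=> h; have -> : a0 = o * db - lam * y * b by rewrite h; ring.
  by ring.
rewrite GE; exact: (key _ _ _ _ _ _ _ _ (ofq x)).
Qed.

End cumulative.

(** * The closure of L0 *)

Section L2_convergence.
Context {R : realType} {m : probability (measurableTypeR R) R}.
Implicit Types f g h : R -> R.
Local Notation L2 := (L2 m).
Local Notation ip := (ip2 m).
Local Notation nrm := (L2norm m).

Lemma ip2_cvg (I : Type) (F : set_system I) {FF : Filter F} (u v : I -> R -> R) f g :
  (forall i, L2 (u i)) -> (forall i, L2 (v i)) -> L2 f -> L2 g ->
  nrm (u i \- f) @[i --> F] --> 0 -> nrm (v i \- g) @[i --> F] --> 0 ->
  ip (u i) (v i) @[i --> F] --> ip f g.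
Proof.
move=> hu hv hf hg uf vg.
exact: (ip_cvg ipVP (u := fun i => packL2 (hu i)) (v := fun i => packL2 (hv i))
  (x := packL2 hf) (y := packL2 hg) uf vg).
Qed.

Lemma nrm_lin_cvg (I : Type) (F : set_system I) {FF : Filter F} (a b : I -> R)
    (u v : I -> R -> R) (a0 b0 : R) f g :
  (forall i, L2 (u i)) -> (forall i, L2 (v i)) -> L2 f -> L2 g ->
  a i @[i --> F] --> a0 -> b i @[i --> F] --> b0 ->
  nrm (u i \- f) @[i --> F] --> 0 -> nrm (v i \- g) @[i --> F] --> 0 ->
  nrm ((fun x => a i * u i x + b i * v i x) \- (fun x => a0 * f x + b0 * g x))
    @[i --> F] --> 0.
Proof.
move=> hu hv hf hg ha hb uf vg.
exact: (nm_lin_cvg ipVP (u := fun i => packL2 (hu i)) (v := fun i => packL2 (hv i))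
  (x := packL2 hf) (y := packL2 hg) ha hb uf vg).
Qed.

Lemma L2dist_cvgP (I : Type) (F : set_system I) {FF : Filter F} (u : I -> R -> R) f :
  (forall i, L2 (u i)) -> L2 f ->
  (L2dist m (u i) f @[i --> F] --> 0%E) <-> (nrm (u i \- f) @[i --> F] --> 0).
Proof.
move=> hu hf; under eq_cvg do rewrite L2distE//.
split=> [/fine_cvg //|h]; apply: cvg_EFin; [exact: nearW|exact: h].
Qed.

Lemma L2_dominated (v : nat -> R -> R) (D : R -> R) :
  (forall n, measurable_fun setT (v n)) -> L2 D ->
  (forall n x, `|v n x| <= D x) -> (forall x, v n x @[n --> \oo] --> 0) ->
  (forall n, L2 (v n)) /\ nrm (v n) @[n --> \oo] --> 0.
Proof.
move=> mv hD vD v0.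
have hv n : L2 (v n).
  by apply: (L2_le (mv n) hD) => x; rewrite (le_trans (vD n x))// ler_norm.
split=> //.
have [_ _ h] : [/\ m.-integrable setT (cst 0%E : R -> \bar R),
    ([sequence \int[m]_x `|(v n x ^+ 2)%:E - 0|]_n @ \oo --> 0)%E &
    ([sequence \int[m]_x (v n x ^+ 2)%:E]_n @ \oo --> \int[m]_x 0)%E].
  apply: (@dominated_convergence _ _ _ m setT measurableT _ _
    (fun x => (D x ^+ 2)%:E)) => //.
  - move=> n; apply/measurable_EFinP; apply: measurable_funX; exact: mv.
  - apply: aeW => x _; change ((v n x ^+ 2)%:E @[n --> \oo] --> (0 : R)%:E).
    apply: cvg_EFin; first exact: nearW.
    change (v n x * v n x @[n --> \oo] --> (0 : R)).
    by rewrite -[X in _ --> X](mulr0 0); apply: cvgM; exact: v0.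
  - exact: Lfun2_integrable_sqr.
  - apply: aeW => x n _; rewrite /= lee_fin ger0_norm ?sqr_ge0//.
    rewrite -[leLHS]real_normK ?num_real// lerXn2r ?nnegrE//.
    exact: le_trans (vD n x).
rewrite integral0 in h.
have {}h : ip (v n) (v n) @[n --> \oo] --> 0.
  move: h; rewrite (_ : [sequence _]_n = (fun n => (ip (v n) (v n))%:E)).
    by move/fine_cvg.
  by apply/funext => n; rewrite /= EFin_ip2.
rewrite -(@sqrtr0 R); apply: continuous_cvg => //; exact: sqrt_continuous.
Qed.

End L2_convergence.

Section closure.
Context {R : realType} {beta : R} (hbeta : 3 / 2 <= beta).
Local Notation m := (mu beta).
Local Notation lam := (2 * (beta - 1)).
Local Notation L := (L0 beta).
Local Notation ip := (ip2 m).
Local Notation nrm := (L2norm m).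
Implicit Types f g u v p q : R -> R.

Lemma LopP f g : Lop beta f g <-> [/\ L2 m f, L2 m g & exists u : nat -> R -> R,
  [/\ forall n, test_function (u n), nrm (u n \- f) @[n --> \oo] --> 0 &
      nrm (L (u n) \- g) @[n --> \oo] --> 0]].
Proof.
split=> -[hf hg [u [tu uf Lug]]]; split => //; exists u; split => //.
- by apply/L2dist_cvgP => // n; exact: test_function_L2.
- by apply/L2dist_cvgP => // n; apply: test_function_L2; exact: test_function_L0.
- by apply/L2dist_cvgP => // n; exact: test_function_L2.
- by apply/L2dist_cvgP => // n; apply: test_function_L2; exact: test_function_L0.
Qed.

Lemma Lop_sym f g f' g' : Lop beta f g -> Lop beta f' g' -> ip f g' = ip g f'.
Proof.
move=> /LopP[hf hg [u [tu uf Lug]]] /LopP[hf' hg' [v [tv vf Lvg]]].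
have hu n : L2 m (u n) by exact: test_function_L2.
have hv n : L2 m (v n) by exact: test_function_L2.
have hLu n : L2 m (L (u n)) by apply: test_function_L2; exact: test_function_L0.
have hLv n : L2 m (L (v n)) by apply: test_function_L2; exact: test_function_L0.
have h1 : ip (u n) (L (v n)) @[n --> \oo] --> ip f g' by exact: ip2_cvg.
have h2 : ip (L (u n)) (v n) @[n --> \oo] --> ip g f' by exact: ip2_cvg.
have e : (fun n => ip (u n) (L (v n))) = (fun n => ip (L (u n)) (v n)).
  by apply/funext => n; rewrite (ip_L0_sym hbeta (tu n) (tv n)) ip2C.
by have := cvg_lim (@Rhausdorff R) h1; rewrite e (cvg_lim (@Rhausdorff R) h2) => ->.
Qed.

Lemma test_function_Lop u : test_function u -> Lop beta u (L u).
Proof.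
move=> tu; have hu : L2 m u by exact: test_function_L2.
have hLu : L2 m (L u) by apply: test_function_L2; exact: test_function_L0.
have z f : nrm (f \- f) = 0.
  rewrite /L2norm /ip2 (_ : \int[m]_x _ = 0) ?sqrtr0//.
  under eq_Rintegral do rewrite /= subrr mul0r.
  by rewrite /Rintegral integral0.
by apply/LopP; split => //; exists (fun=> u); split => //; rewrite z; exact: cvg_cst.
Qed.

End closure.

(** * Cutoff functions converging to 1 *)

Section cutoff_sequence.
Context {R : realType} {beta : R} (hbeta : 3 / 2 <= beta).
Local Notation m := (mu beta).
Local Notation lam := (2 * (beta - 1)).
Local Notation L := (L0 beta).
Local Notation ip := (ip2 m).
Local Notation nrm := (L2norm m).
Implicit Types f g u v p q : R -> R.

Lemma cutoff_test_function : test_function (@cutoff R).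
Proof.
apply/test_functionP; split; first exact: smooth_cutoff.
by exists 1 => //; exact: cutoff_eq0.
Qed.

(** The bounds and limits feed dominated convergence. Those on th_n and L th_n put the constant 1 in
    the domain; those on omega th_n' handle the cross term of L (x th_n), where linear growth is
    affordable because x is square integrable. *)
Record cutoff_seq (th : nat -> R -> R) (C : R) : Prop := {
  cs_test : forall n, test_function (th n) ;
  cs_ge0 : 0 <= C ;
  cs_bound : forall n x, `|th n x| <= C ;
  cs_cvg : forall x, th n x @[n --> \oo] --> (1 : R) ;
  cs_L_bound : forall n x, `|L (th n) x| <= C ;
  cs_L_cvg : forall x, L (th n) x @[n --> \oo] --> (0 : R) ;
  cs_d_bound : forall n x, `|omega x * derive1 (th n) x| <= C * (1 + `|x|) ;
  cs_d_cvg : forall x, omega x * derive1 (th n) x @[n --> \oo] --> (0 : R) }.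

Lemma cutoff_seq_exists : exists th C, cutoff_seq th C.
Proof.
have tc := cutoff_test_function.
have [c1 c2 cc2 [M [cM dcM ddcM]]] := test_function2 tc.
have [C0 C00 hC0] := continuous_bounded (test_function_continuous tc) cM.
have [C1 C10 hC1] := continuous_bounded (has_derivative_continuous c2) dcM.
have [C2 C20 hC2] := continuous_bounded cc2 ddcM.
pose s n : R := n.+1%:R^-1.
have s0 n : 0 < s n by rewrite invr_gt0.
have s1 n : s n <= 1 by rewrite invf_le1 ?ler1n.
pose th n x := cutoff (s n * x).
have dth n : has_derivative (th n) (fun x => s n * derive1 cutoff (s n * x)).
  have := has_derivative_comp (has_derivativeZ (s n) (@has_derivative_id R)) c1.
  by apply: has_derivative_eq => x; rewrite mulr1 mulrC.
have ddth n : has_derivative (derive1 (th n))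
    (fun x => s n ^+ 2 * derive1n 2 cutoff (s n * x)).
  rewrite (has_derivativeE (dth n)).
  have := has_derivativeZ (s n)
    (has_derivative_comp (has_derivativeZ (s n) (@has_derivative_id R)) c2).
  by apply: has_derivative_eq => x; rewrite mulr1 expr2 [RHS]mulrAC mulrA.
have LE n x : L (th n) x = omega x * (s n ^+ 2 * derive1n 2 cutoff (s n * x)) -
    lam * x * (s n * derive1 cutoff (s n * x)).
  rewrite /L0 -[derive1n 2 _]/(derive1 (derive1 (th n))).
  by rewrite (has_derivativeE (ddth n)) (has_derivativeE (dth n)).
pose N := `|M|; have N0 : 0 <= N by exact: normr_ge0.
(* With y = s_n x, the unbounded factors x and omega in L th_n are absorbed by the dilation: x s_n =
   y and omega s_n^2 = s_n^2 + y^2, while the derivatives of [cutoff] vanish for |y| beyond N. *)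
have b1 y : `|y| * `|derive1 cutoff y| <= N * C1.
  have [yN|yN] := leP `|y| N; first by rewrite ler_pM.
  rewrite dcM ?normr0 ?mulr0 ?mulr_ge0//.
  by rewrite (le_trans (ler_norm M))// ltW.
have b2 y : y ^+ 2 * `|derive1n 2 cutoff y| <= N ^+ 2 * C2.
  have [yN|yN] := leP `|y| N.
    by rewrite ler_pM ?sqr_ge0// -[leLHS]real_normK ?num_real// lerXn2r ?nnegrE.
  rewrite ddcM ?normr0 ?mulr0 ?mulr_ge0 ?sqr_ge0//.
  by rewrite (le_trans (ler_norm M))// ltW.
have l0 := lam_gt0 hbeta.
have s_cvg : s n @[n --> \oo] --> (0 : R) by exact: cvg_harmonic.
have to0 (f : nat -> R) K : (forall n, `|f n| <= K * s n) -> f n @[n --> \oo] --> (0 : R).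
  move=> fK; apply/norm_cvg0P.
  apply: (@cvg0_le _ _ _ _ _ (fun n => K * s n)).
    by apply: nearW => n; rewrite normr_ge0 fK.
  by rewrite -[X in _ --> X](mulr0 K); apply: cvgM => //; exact: cvg_cst.
have om0 (x : R) : 0 <= omega x by exact: ltW (omega_gt0 x).
have n1 n x : `|omega x * (s n ^+ 2 * derive1n 2 cutoff (s n * x))| =
    omega x * s n ^+ 2 * `|derive1n 2 cutoff (s n * x)|.
  by rewrite 2!normrM (ger0_norm (om0 x)) (ger0_norm (sqr_ge0 _)) mulrA.
have n2 n x : `|lam * x * (s n * derive1 cutoff (s n * x))| =
    lam * (`|s n * x| * `|derive1 cutoff (s n * x)|).
  by rewrite normrM (normrM lam) (gtr0_norm l0) !(normrM (s n)) (gtr0_norm (s0 n)); ring.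
have n3 n x : `|omega x * (s n * derive1 cutoff (s n * x))| =
    omega x * s n * `|derive1 cutoff (s n * x)|.
  by rewrite !normrM (ger0_norm (om0 x)) (gtr0_norm (s0 n)); ring.
have s2 n : s n ^+ 2 <= s n by rewrite expr2 ler_piMl// ltW.
have NC1 : 0 <= N * C1 by rewrite mulr_ge0.
have NC2 : 0 <= N ^+ 2 * C2 by rewrite mulr_ge0// sqr_ge0.
have lNC1 : 0 <= lam * (N * C1) by rewrite mulr_ge0// ltW.
(* The three summands bound th_n, L th_n and omega th_n' / (1 + |x|), respectively. *)
exists th, (C0 + ((1 + N ^+ 2) * C2 + lam * (N * C1)) + (1 + N) * C1).
have C2' : 0 <= (1 + N ^+ 2) * C2 by rewrite mulrDl mul1r addr_ge0.
have C1' : 0 <= (1 + N) * C1 by rewrite mulrDl mul1r addr_ge0.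
split.
- move=> n; apply/test_functionP; split.
    exact (smooth_comp (smoothM (@smooth_cst R (s n)) (@smooth_id R)) (@smooth_cutoff R)).
  exists (N / s n + 1); first by rewrite ltr_wpDl// divr_ge0// ltW.
  move=> x hx; apply: cM; rewrite normrM (gtr0_norm (s0 n)).
  have : N / s n <= `|x| by apply: le_trans hx; rewrite lerDl.
  by rewrite ler_pdivrMr// mulrC; apply: le_trans; exact: ler_norm.
- by lra.
- by move=> n x; apply: le_trans (hC0 _) _; lra.
- move=> x; rewrite -(@cutoff0 R); apply: continuous_cvg.
    exact: (test_function_continuous tc).
  rewrite -[X in _ --> X](mul0r x); apply: cvgM => //; exact: cvg_cst.
- move=> n x; rewrite LE (le_trans (ler_normB _ _))// n1 n2.
  have h1 := b1 (s n * x); have h2 := b2 (s n * x).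
  have : omega x * s n ^+ 2 * `|derive1n 2 cutoff (s n * x)| <= (1 + N ^+ 2) * C2.
    rewrite (_ : omega x * _ ^+ 2 = s n ^+ 2 + (s n * x) ^+ 2); last first.
      by rewrite /omega; ring.
    rewrite mulrDl [leRHS]mulrDl mul1r lerD//.
    apply: le_trans (hC2 (s n * x)); rewrite ler_piMl//.
    exact: le_trans (s2 n) (s1 n).
  have := ler_wpM2l (ltW l0) h1.
  by set a := _ * `|_|; set b := lam * (`|_| * _); lra.
- move=> x; apply: (to0 _ (omega x * C2 + lam * `|x| * C1)) => n.
  rewrite LE (le_trans (ler_normB _ _))// n1 n2 [leRHS]mulrDl lerD//.
    by rewrite -mulrA -[leRHS]mulrA ler_wpM2l// mulrC ler_pM ?sqr_ge0.
  rewrite -[leRHS]mulrA -[leRHS]mulrA ler_wpM2l ?(ltW l0)//.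
  rewrite normrM (gtr0_norm (s0 n)).
  rewrite (_ : s n * `|x| * _ = `|x| * (`|derive1 cutoff (s n * x)| * s n)); last by ring.
  by rewrite ler_wpM2l// ler_wpM2r// ltW.
- move=> n x; rewrite (has_derivativeE (dth n)) n3.
  have h1 := b1 (s n * x).
  rewrite (_ : omega x * s n * _ = s n * `|derive1 cutoff (s n * x)| +
      `|x| * (`|s n * x| * `|derive1 cutoff (s n * x)|)); last first.
    rewrite normrM (gtr0_norm (s0 n)) /omega -[x ^+ 2]real_normK ?num_real//.
    by ring.
  have h2 : s n * `|derive1 cutoff (s n * x)| <= C1.
    by apply: le_trans (hC1 (s n * x)); rewrite ler_piMl.
  have h3 := ler_wpM2l (normr_ge0 x) h1.
  have h4 : 0 <= `|x| * C1 by rewrite mulr_ge0.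
  have h5 : 0 <= `|x| * (C0 + ((1 + N ^+ 2) * C2 + lam * (N * C1))).
    by rewrite mulr_ge0// ?addr_ge0.
  move: h2 h3; set a := s n * _; set b := `|x| * (_ * `|_|) => h2 h3.
  by nra.
- move=> x; apply: (to0 _ (omega x * C1)) => n.
  rewrite (has_derivativeE (dth n)) n3 -!mulrA ler_wpM2l// mulrC.
  by rewrite ler_wpM2r// ltW.
Qed.

End cutoff_sequence.

Section closure_facts.
Context {R : realType} {beta : R} (hbeta : 3 / 2 <= beta).
Local Notation leb := (@lebesgue_measure R).
Local Notation w := (fun x : R => omega x `^ (- beta)).
Local Notation m := (mu beta).
Local Notation lam := (2 * (beta - 1)).
Local Notation L := (L0 beta).
Local Notation ip := (ip2 m).
Local Notation nrm := (L2norm m).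
Implicit Types f g u v p q : R -> R.

Lemma ip2_lin2 a b f g h : L2 m f -> L2 m g -> L2 m h ->
  ip (fun x => a * f x + b * g x) h = a * ip f h + b * ip g h.
Proof.
move=> hf hg hh; rewrite ip2_lin//; last exact: L2Z.
congr (_ + _).
have := ip2_lin b hg (L2_cst 0) hh.
rewrite (_ : (fun x => b * g x + cst 0 x) = (fun x => b * g x)); last first.
  by apply/funext => x; rewrite addr0.
move=> ->; rewrite (_ : ip (cst 0) h = 0) ?addr0//.
by rewrite /ip2; under eq_Rintegral do rewrite mul0r; rewrite /Rintegral integral0.
Qed.

Lemma test_function_lin a b u v : test_function u -> test_function v ->
  test_function (fun x => a * u x + b * v x).
Proof.
move=> /test_functionP[su [M M0 uM]] /test_functionP[sv [N N0 vN]].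
apply/test_functionP; split.
  exact (smoothD (smoothM (@smooth_cst R a) su) (smoothM (@smooth_cst R b) sv)).
exists (M + N); first exact: addr_gt0.
move=> x hx; rewrite uM ?vN ?mulr0 ?addr0//.
  by apply: le_trans hx; rewrite lerDr ltW.
by apply: le_trans hx; rewrite lerDl ltW.
Qed.

Lemma derive_lin a b u v : test_function u -> test_function v ->
  let z x := a * u x + b * v x in
  (forall x, derive1 z x = a * derive1 u x + b * derive1 v x) /\
  (forall x, derive1n 2 z x = a * derive1n 2 u x + b * derive1n 2 v x).
Proof.
move=> tu tv z.
have [u1 u2 _ _] := test_function2 tu; have [v1 v2 _ _] := test_function2 tv.
have z1 : derive1 z = (fun x => a * derive1 u x + b * derive1 v x).
  exact: has_derivativeE (has_derivativeD (has_derivativeZ a u1) (has_derivativeZ b v1)).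
have z2 : derive1n 2 z = (fun x => a * derive1n 2 u x + b * derive1n 2 v x).
  rewrite -[derive1n 2 z]/(derive1 (derive1 z)) z1.
  exact: has_derivativeE (has_derivativeD (has_derivativeZ a u2) (has_derivativeZ b v2)).
by split => x; [rewrite z1|rewrite z2].
Qed.

Lemma L0_lin a b u v : test_function u -> test_function v ->
  L (fun x => a * u x + b * v x) = (fun x => a * L u x + b * L v x).
Proof.
move=> tu tv; have [z1 z2] := derive_lin a b tu tv.
apply/funext => x; rewrite /L0 z1 z2.
have key (o y c u1 u2 v1 v2 : R) : o * (a * u2 + b * v2) - c * y * (a * u1 + b * v1) =
  a * (o * u2 - c * y * u1) + b * (o * v2 - c * y * v1) by ring.
exact: key.
Qed.

Lemma integral_L0 u : test_function u -> \int[m]_x L u x = 0.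
Proof.
move=> tu; have cvL := test_function_cv (test_function_L0 (beta := beta) tu).
have [u1 u2 cu [M [um dum ddum]]] := test_function2 tu.
have dF := has_derivativeM (has_derivative_om1 (beta := beta)) u2.
apply: (mu_integral_derivative hbeta cvL (has_derivative_eq _ dF)).
  by move=> x; rewrite /L0; ring.
by exists M => x Mx; rewrite dum// mulr0.
Qed.

Lemma omega_powRV x : omega x * omega x `^ (beta - 1) * w x = 1.
Proof.
rewrite -omega_powR1 -omega_powRD (_ : 1 + (beta - 1) - beta = 0) ?powRr0//.
by ring.
Qed.

(** Both om1 u' and the weighted primitive of L u have derivative w L u, and both vanish far to the
    right. Thus u' depends on u only through L u, continuously for the L^2 norm. *)
Lemma test_function_cumul u x : test_function u ->
  derive1 u x = omega x `^ (beta - 1) * cumul beta (L u) x.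
Proof.
move=> tu; have tL := test_function_L0 (beta := beta) tu.
have cvL := test_function_cv tL.
have hL : L2 m (L u) by exact: cont_vanishing_L2.
have [u1 u2 cu [M [um dum ddum]]] := test_function2 tu.
have [N cN] := cumul_vanishing hbeta cvL (integral_L0 tu).
have dC := cumul_derivative hbeta hL (proj1 cvL).
have dF := has_derivativeM (has_derivative_om1 (beta := beta)) u2.
have d0 : has_derivative
    (fun x => omega x * w x * derive1 u x - cumul beta (L u) x) (fun=> 0).
  apply: has_derivative_eq (has_derivativeB dF dC) => y; rewrite /L0; ring.
have E : omega x * w x * derive1 u x = cumul beta (L u) x.
  (* The comparison point |M| + |N| lies beyond both supports. *)
  have y0 : 0 <= `|M| + `|N| by rewrite addr_ge0.
  have e1 : derive1 u (`|M| + `|N|) = 0.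
    by apply: dum; rewrite [leRHS]ger0_norm// (le_trans (ler_norm M))// lerDl.
  have e2 : cumul beta (L u) (`|M| + `|N|) = 0.
    by apply: cN; rewrite [leRHS]ger0_norm// (le_trans (ler_norm N))// lerDr.
  have := is_derive_0_is_cst x (`|M| + `|N|) d0 => /eqP.
  by rewrite [X in _ == X](_ : _ = 0) ?subr_eq0; [move/eqP|rewrite e1 e2 mulr0 subrr].
by rewrite -E -[LHS]mul1r -[X in X * _ = _](omega_powRV x); ring.
Qed.

Lemma Lop_1 : Lop beta (cst 1) (cst 0).
Proof.
have [th [C [tth C0 thb thc Lb Lc _ _]]] := cutoff_seq_exists hbeta.
apply/LopP; split; [exact: L2_cst|exact: L2_cst|exists th; split => //].
- apply: (proj2 (L2_dominated (D := cst (C + 1)) _ _ _ _)).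
  + move=> n; apply: measurable_funB => //.
    exact: measurable_continuous (test_function_continuous (tth n)).
  + exact: L2_cst.
  + move=> n x; rewrite (le_trans (ler_normB _ _))//= normr1.
    by rewrite lerD2r.
  + by move=> x; apply/subr_cvg0; exact: thc.
- apply: (proj2 (L2_dominated (D := cst C) _ _ _ _)).
  + move=> n; apply: measurable_funB => //.
    exact: measurable_continuous (test_function_continuous (test_function_L0 (tth n))).
  + exact: L2_cst.
  + by move=> n x; rewrite /= subr0.
  + by move=> x; under eq_cvg do rewrite /= subr0; exact: Lc.
Qed.

Lemma Lop_mean0 f g : Lop beta f g -> ip g (cst 1) = 0.
Proof.
move=> fg; rewrite -(Lop_sym hbeta fg Lop_1) /ip2.
by under eq_Rintegral do rewrite mulr0; rewrite /Rintegral integral0.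
Qed.

(** Test functions approximating f - int f need not have mean zero, as [poincare_mean0] demands. The
    mean is corrected inside the test functions, with cutoffs th_n in place of the constant 1,
    before passing to the limit. *)
Lemma Lop_poincare f g : Lop beta f g ->
  lam * (ip f f - ip f (cst 1) ^+ 2) <= - ip f g.
Proof.
move=> fg; have g1 := Lop_mean0 fg.
have := fg => /LopP[hf hg [u [tu uf Lug]]].
have := Lop_1 => /LopP[h1 h0 [th [tth th1 Lth0]]].
have hu n : L2 m (u n) by exact: test_function_L2.
have hth n : L2 m (th n) by exact: test_function_L2.
have hLu n : L2 m (L (u n)) by apply: test_function_L2; exact: test_function_L0.
have hLth n : L2 m (L (th n)) by apply: test_function_L2; exact: test_function_L0.
(* With these coefficients a_n u_n + b_n th_n has mean exactly 0, without division by the mean of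
   th_n; a_n tends to 1 and b_n to - int f. *)
pose a n := ip (th n) (cst 1); pose b n := - ip (u n) (cst 1).
pose c := ip f (cst 1).
have nrm0 h : nrm (h \- h) = 0.
  rewrite /L2norm /ip2 (_ : \int[m]_x _ = 0) ?sqrtr0//.
  under eq_Rintegral do rewrite /= subrr mul0r.
  by rewrite /Rintegral integral0.
have c1 : nrm ((cst 1 : R -> R) \- cst 1) @[_ --> \oo] --> (0 : R).
  by rewrite nrm0; exact: cvg_cst.
have ca : a n @[n --> \oo] --> (1 : R).
  rewrite -(@ip2_11 R m).
  exact: (ip2_cvg (u := th) (v := fun=> cst 1) hth (fun=> h1) h1 h1 th1 c1).
have cb : b n @[n --> \oo] --> - c.
  apply: cvgN.
  exact: (ip2_cvg (u := u) (v := fun=> cst 1) hu (fun=> h1) hf h1 uf c1).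
pose v n x := a n * u n x + b n * th n x.
have tv n : test_function (v n) by exact: test_function_lin.
pose V x := 1 * f x + - c * cst 1 x.
pose G x := 1 * g x + - c * cst 0 x.
have hv n : L2 m (v n) by exact: test_function_L2.
have hLv n : L2 m (L (v n)) by apply: test_function_L2; exact: test_function_L0.
have hV : L2 m V by apply: L2_lin => //; exact: L2Z.
have hG : L2 m G by apply: L2_lin => //; exact: L2Z.
have vV : nrm (v n \- V) @[n --> \oo] --> (0 : R).
  exact: (nrm_lin_cvg hu hth hf h1 ca cb uf th1).
have LvG : nrm (L (v n) \- G) @[n --> \oo] --> (0 : R).
  have -> : (fun n => nrm (L (v n) \- G)) =
      (fun n => nrm ((fun x => a n * L (u n) x + b n * L (th n) x) \- G)).
    by apply/funext => n; rewrite (L0_lin (a n) (b n) (tu n) (tth n)).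
  exact: (nrm_lin_cvg (u := fun n => L (u n)) (v := fun n => L (th n))
    hLu hLth hg h0 ca cb Lug Lth0).
have mean n : \int[m]_x v n x = 0.
  rewrite -ip2_cst1 ip2_lin2// /a /b; ring.
have key n : 0 <= - ip (v n) (L (v n)) - lam * ip (v n) (v n).
  by rewrite subr_ge0; exact: (poincare_mean0 hbeta (tv n) (mean n)).
have cv : - ip (v n) (L (v n)) - lam * ip (v n) (v n) @[n --> \oo] -->
    (- ip V G - lam * ip V V).
  apply: cvgB; first by apply: cvgN; exact: (ip2_cvg hv hLv hV hG vV LvG).
  by apply: cvgM; [exact: cvg_cst|exact: (ip2_cvg hv hv hV hV vV vV)].
have : 0 <= - ip V G - lam * ip V V.
  rewrite -(cvg_lim (@Rhausdorff R) cv); apply: limr_ge.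
    by apply/cvg_ex; exists (- ip V G - lam * ip V V).
  exact: nearW.
have z1 h : L2 m h -> ip (cst 0) h = 0.
  move=> hh; rewrite /ip2.
  by under eq_Rintegral do rewrite mul0r; rewrite /Rintegral integral0.
have EG h : L2 m h -> ip h G = ip h g.
  by move=> hh; rewrite ip2C ip2_lin2// z1// mulr0 addr0 mul1r ip2C.
have EV h : L2 m h -> ip V h = ip f h - c * ip (cst 1) h.
  by move=> hh; rewrite ip2_lin2// mul1r mulNr.
rewrite EG// (EV V)// (EV g)// ![ip _ V]ip2C (EV f)// (EV (cst 1))//.
rewrite [ip (cst 1) g]ip2C g1 [ip (cst 1) f]ip2C ip2_11 -/c => h2.
rewrite -subr_ge0; apply: le_trans h2 _; rewrite le_eqVlt; apply/orP; left.
by apply/eqP; ring.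
Qed.

End closure_facts.

(** * Linear functions for beta > 3/2 *)

Section linear_eigenfunction.
Context {R : realType} {beta : R} (hbeta : 3 / 2 < beta).
Local Notation leb := (@lebesgue_measure R).
Local Notation w := (fun x : R => omega x `^ (- beta)).
Local Notation m := (mu beta).
Local Notation lam := (2 * (beta - 1)).
Local Notation L := (L0 beta).
Local Notation nrm := (L2norm m).

Let hb : 3 / 2 <= beta := ltW hbeta.

(* [x omega^(1 - beta)] has derivative [w - (lam - 1) x^2 w], and is odd and
   nonnegative on the right, so the integrals of [x^2 w] over [[-n, n]] are
   bounded. *)
Lemma integral_sqr_le (n : nat) :
  (\int[leb]_(x in `[(- n%:R)%R, n%:R]) (x ^+ 2 * w x)%:E <=
   (mass beta / (lam - 1))%:E)%E.
Proof.
(* The strict inequality on beta enters here, through the division by lam - 1. *)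
have l1 : 0 < lam - 1 by have := hbeta; lra.
case: n => [|n].
  rewrite oppr0 set_itv1 integral_set1 lee_fin divr_ge0// ltW//.
  exact: mass_gt0.
have dF := has_derivativeZ (- (lam - 1)^-1)
  (has_derivativeM (@has_derivative_id R) (has_derivative_om1 (beta := beta))).
set F := (fun x : R => _) in dF; set f := (X in has_derivative _ X) in dF.
have cw := @continuous_w R beta.
have cq : continuous (fun x : R => x ^+ 2 * w x).
  apply: continuousMfun => //; apply: continuous_sqrfun; exact: continuous_idfun.
have fE x : f x = x ^+ 2 * w x - (lam - 1)^-1 * w x.
  by rewrite /f /omega /=; field; rewrite gt_eqF.
have cf : continuous f.
  have -> : f = (fun x => x ^+ 2 * w x + (- (lam - 1)^-1) * w x).
    by apply/funext => x; rewrite fE mulNr.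
  by apply: continuousDfun => //; apply: continuousMfun => //; exact: continuous_cstfun.
have N0 : - n.+1%:R < n.+1%:R :> R by rewrite gtrN.
have cF := has_derivative_continuous dF.
have FTC : (\int[leb]_(x in `[(- n.+1%:R)%R, n.+1%:R]) (f x)%:E =
    (F n.+1%:R)%:E - (F (- n.+1%:R)%R)%:E)%E.
  apply: continuous_FTC2 => //.
  - exact: continuous_subspaceT.
  - split; first by move=> x _; exact: (has_derivative_derivable dF).
    + exact: cvg_at_right_filter (cF _).
    + exact: cvg_at_left_filter (cF _).
  - by move=> x _; rewrite (has_derivativeE dF).
have le0 : F n.+1%:R - F (- n.+1%:R) <= 0.
  rewrite /F /omega /= sqrrN.
  have p0 : 0 < (1 + n.+1%:R ^+ 2) * (1 + n.+1%:R ^+ 2) `^ (- beta) :> R.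
    by rewrite mulr_gt0 ?powR_gt0// ltr_wpDr// sqr_ge0.
  have i0 : 0 < (lam - 1)^-1 by rewrite invr_gt0.
  have n0 : 0 < n.+1%:R :> R by [].
  move: p0 i0 n0; set a := (1 + _) * _; set b := _^-1; set c := n.+1%:R => p0 i0 n0.
  have : 0 <= b * (c * a) by rewrite !mulr_ge0// ltW.
  lra.
pose A : set R := `[(- n.+1%:R)%R, n.+1%:R]%classic.
have mA : measurable (A : set (measurableTypeR R)) by exact: measurable_itv.
have iw : leb.-integrable A (EFin \o w).
  by apply: (integrableS measurableT) => //; exact: integrable_weight.
have iq : leb.-integrable A (EFin \o (fun x => x ^+ 2 * w x)).
  by apply: continuous_compact_integrable; [exact: segment_compact|exact: continuous_subspaceT].
have iZ : leb.-integrable A (EFin \o (fun x => (lam - 1)^-1 * w x)).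
  apply: continuous_compact_integrable; first exact: segment_compact.
  apply: continuous_subspaceT; apply: continuousMfun => //; exact: continuous_cstfun.
have E : (\int[leb]_(x in A) (f x)%:E =
    \int[leb]_(x in A) (x ^+ 2 * w x)%:E - \int[leb]_(x in A) ((lam - 1)^-1 * w x)%:E)%E.
  rewrite -integralB_EFin//; apply: eq_integral => x _.
  by rewrite fE EFinB.
have h : (\int[leb]_(x in A) (x ^+ 2 * w x)%:E <=
    \int[leb]_(x in A) ((lam - 1)^-1 * w x)%:E)%E.
  rewrite -sube_le0 -?E ?FTC -?EFinB ?lee_fin//.
apply: (le_trans h).
have -> : (\int[leb]_(x in A) ((lam - 1)^-1 * w x)%:E =
    (lam - 1)^-1%:E * \int[leb]_(x in A) (w x)%:E)%E.
  by under eq_integral do rewrite EFinM; rewrite integralZl.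
rewrite [mass beta / _]mulrC EFinM; apply: lee_wpmul2l; first by rewrite lee_fin invr_ge0 ltW.
rewrite -(EFin_mass hb) /weight; apply: ge0_subset_integral => //.
- by apply/measurable_EFinP; exact: measurable_omega_powR.
- by move=> x _; rewrite lee_fin powR_ge0.
Qed.

(** Fatou applied to the truncations of x to [-n, n], whose second moments are bounded by
    [integral_sqr_le]. *)
Lemma L2_id : L2 m (id : R -> R).
Proof.
pose v n (x : R) := x * \1_(`[- n%:R, n%:R] : set R) x.
have mI n : measurable (`[- n%:R, n%:R] : set (measurableTypeR R)) by [].
have mv n : measurable_fun setT (v n).
  by apply: measurable_funM => //; exact: measurable_indic.
apply: (proj1 (@L2_fatou _ m v id ((mass beta)^-1 * (mass beta / (lam - 1))) _ _ _ _)) => //.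
- apply: aeW => x; apply/cvgrPdist_lt => /= e e0; near=> n.
  rewrite /v indicE mem_set ?mulr1 ?subrr ?normr0//= in_itv/= -ler_norml.
  by near: n; exact: nbhs_infty_ger.
- move=> n; rewrite (ge0_integral_mu hb); last 2 first.
  + by apply/measurable_EFinP; exact: measurable_funX.
  + by move=> x; rewrite lee_fin sqr_ge0.
  have k0 : 0 < (mass beta)^-1 by rewrite invr_gt0 mass_gt0.
  rewrite EFinM; apply: (le_trans _ (lee_wpmul2l _ (integral_sqr_le n))); last first.
    by rewrite lee_fin ltW.
  rewrite -ge0_integralZl//; last 3 first.
  + apply/measurable_EFinP; apply: measurable_funTS; apply: measurable_funM => //.
    exact: measurable_omega_powR.
  + by move=> x _; rewrite lee_fin mulr_ge0 ?sqr_ge0 ?powR_ge0.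
  + by rewrite lee_fin ltW.
  rewrite [leRHS]integral_mkcond le_eqVlt; apply/orP; left; apply/eqP.
  apply: eq_integral => x _; rewrite patchE /v indicE.
  case: ifPn => _; rewrite ?mulr1 ?mulr0 ?expr0n ?mul0e//.
  by rewrite -!EFinM; congr EFin; ring.
Unshelve. all: by end_near. Qed.

(** The approximants are a x th_n. By the Leibniz rule L (a x th_n) + lam a x consists of terms in L
    th_n and th_n - 1 and of the cross term 2 a omega th_n', all dominated by a multiple of |a x|
    plus a constant. *)
Lemma Lop_linear a : Lop beta (fun x => a * x) (fun x => - (lam * (a * x))).
Proof.
have [th [C [tth C0 thb thc Lb Lc db dc]]] := cutoff_seq_exists hb.
have hid := L2Z a L2_id.
have hl : L2 m (fun x => - (lam * (a * x))).
  have := L2Z (- lam) hid; congr (Defs.L2 _ _).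
  by apply/funext => x; rewrite mulNr.
pose u n x := (a * x) * th n x.
have tu n : test_function (u n).
  have [sth [M M0 vM]] := (test_functionP _).1 (tth n).
  apply/test_functionP; split; last by exists M => // x Mx; rewrite /u vM ?mulr0.
  exact (smoothM (smoothM (@smooth_cst R a) (@smooth_id R)) sth).
have LuE n x : L (u n) x + lam * (a * x) =
    a * x * L (th n) x + 2 * a * (omega x * derive1 (th n) x) -
    lam * (a * x) * (th n x - 1).
  have [t1 t2 _ _] := test_function2 (tth n).
  have d1 : has_derivative (fun x : R => a * x) (fun=> a).
    by apply: has_derivative_eq (has_derivativeZ a (@has_derivative_id R)) => y; rewrite mulr1.
  have u1 := has_derivativeM d1 t1.
  have u2 := has_derivativeD (has_derivativeZ a t1) (has_derivativeM d1 t2).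
  have e1 : derive1 (u n) = (fun x => a * th n x + a * x * derive1 (th n) x).
    exact: has_derivativeE u1.
  have e2 : derive1n 2 (u n) = (fun x => a * derive1 (th n) x +
      (a * derive1 (th n) x + a * x * derive1n 2 (th n) x)).
    rewrite -[derive1n 2 _]/(derive1 (derive1 (u n))) e1.
    exact: has_derivativeE u2.
  have key (o y c r0 r1 r2 : R) :
      o * (a * r1 + (a * r1 + a * y * r2)) - c * y * (a * r0 + a * y * r1) + c * (a * y) =
      a * y * (o * r2 - c * y * r1) + 2 * a * (o * r1) - c * (a * y) * (r0 - 1) by ring.
  by rewrite /L0 e1 e2; exact: key.
have mx : measurable_fun setT (fun x : R => a * x).
  apply: measurable_continuous; apply: continuousMfun; first exact: continuous_cstfun.
  exact: continuous_idfun.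
have mu n : measurable_fun setT (u n).
  exact: measurable_continuous (test_function_continuous (tu n)).
have mLu n : measurable_fun setT (L (u n)).
  exact: measurable_continuous (test_function_continuous (test_function_L0 (tu n))).
have l0 := lam_gt0 hb.
apply/LopP; split => //; exists u; split => //.
- apply: (proj2 (L2_dominated (D := fun x => (C + 1) * `|a * x|) _ _ _ _)).
  + by move=> n; exact: measurable_funB.
  + exact: L2Z (L2_norm hid).
  + move=> n x; rewrite /u /= -[X in _ - X]mulr1 -mulrBr normrM mulrC ler_wpM2r//.
    by rewrite (le_trans (ler_normB _ _))// normr1 lerD2r.
  + move=> x; rewrite /u /=; apply/subr_cvg0.
    rewrite -[X in _ --> X]mulr1; apply: cvgM; first exact: cvg_cst.
    exact: thc.
- apply: (proj2 (L2_dominated (D := fun x => (C + lam * (C + 1) + 2 * C) * `|a * x| +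
    2 * `|a| * C) _ _ _ _)).
  + move=> n; apply: measurable_funB => //.
    exact: L2_measurable hl.
  + apply: L2D; last exact: L2_cst.
    exact: L2Z (L2_norm hid).
  + move=> n x /=; rewrite opprK LuE.
    rewrite (le_trans (ler_normB _ _))// (le_trans (lerD (ler_normD _ _) (lexx _)))//.
    have -> : `|a * x * L (th n) x| = `|a| * `|x| * `|L (th n) x| by rewrite !normrM.
    have -> : `|2 * a * (omega x * derive1 (th n) x)| =
        2 * (`|a| * `|omega x * derive1 (th n) x|).
      by rewrite (normrM (2 * a)) (normrM 2) (ger0_norm (ler0n _ 2)) mulrA.
    have -> : `|lam * (a * x) * (th n x - 1)| = lam * (`|a| * `|x|) * `|th n x - 1|.
      by rewrite (normrM (lam * _)) (normrM lam) (gtr0_norm l0) (normrM a).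
    rewrite (normrM a).
    have h1 := ler_wpM2l (mulr_ge0 (normr_ge0 a) (normr_ge0 x)) (Lb n x).
    have h2 : `|th n x - 1| <= C + 1.
      by rewrite (le_trans (ler_normB _ _))// normr1 lerD2r.
    have h3 := ler_wpM2l (normr_ge0 a) (db n x).
    have h4 := ler_wpM2l (mulr_ge0 (ltW l0) (mulr_ge0 (normr_ge0 a) (normr_ge0 x))) h2.
    apply: le_trans (lerD (lerD h1 (ler_wpM2l _ h3)) h4) _ => //.
    by rewrite le_eqVlt; apply/orP; left; apply/eqP; ring.
  + move=> x; rewrite [X in X @ \oo --> _](_ : _ = fun n => a * x * L (th n) x +
        2 * a * (omega x * derive1 (th n) x) - lam * (a * x) * (th n x - 1)); last first.
      by apply/funext => n; rewrite /= opprK LuE.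
    have e0 : a * x * 0 + 2 * a * 0 - lam * (a * x) * (1 - 1) = 0 by ring.
    rewrite -[X in _ --> X]e0.
    apply: cvgB; first apply: cvgD.
    * apply: cvgM; [exact: cvg_cst|exact: Lc].
    * apply: cvgM; [exact: cvg_cst|exact: dc].
    * apply: cvgM; [exact: cvg_cst|apply: cvgB; [exact: thc|exact: cvg_cst]].
Qed.

End linear_eigenfunction.

(** * Regularity in the domain of the closure *)

Section limits.
Context {R : realType}.
Implicit Types f h df p : R -> R.

Lemma has_derivative_MVT f df a b : has_derivative f df ->
  exists2 c, `|c - a| <= `|b - a| & f b - f a = df c * (b - a).
Proof.
move=> fdf; have cf := has_derivative_continuous fdf.
have [ab|ab] := leP a b.
  have [c] := MVT_segment ab (fun x _ => fdf x) (continuous_subspaceT cf).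
  rewrite in_itv/= => /andP[ac cb] e; exists c => //.
  by rewrite !ger0_norm ?subr_ge0// lerD2r.
have [c] := MVT_segment (ltW ab) (fun x _ => fdf x) (continuous_subspaceT cf).
rewrite in_itv/= => /andP[bc ca] e; exists c.
  by rewrite !ler0_norm ?subr_le0 ?(ltW ab)// lerN2 lerD2r.
by rewrite -[LHS]opprB e -[b - a]opprB mulrN.
Qed.

(** The mean value theorem is applied to u_n with the increment t fixed, and n tends to infinity
    before t tends to 0. *)
Lemma has_derivative_limit (u du : nat -> R -> R) h p :
  (forall n, has_derivative (u n) (du n)) -> continuous p ->
  (forall x, u n x @[n --> \oo] --> h x) ->
  (forall x, exists2 e : nat -> R, e n @[n --> \oo] --> 0 &
    forall n y, `|y - x| <= 1 -> `|du n y - p y| <= e n) ->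
  has_derivative h p.
Proof.
move=> dudu cp uh dup x; have [e e0 he] := dup x.
have key : (fun t => t^-1 *: ((h \o shift x) (t *: (1 : R)) - h x)) @ 0^' --> p x.
  apply/cvgrPdist_le => /= d d0.
  have /cvgrPdist_le/(_ d d0)[r /= r0 pr] := cp x.
  near=> t.
  have t0 : t != 0 by near: t; exact: nbhs_dnbhs_neq.
  have tr : `|t| < Num.min r 1 by near: t; apply: dnbhs0_lt; rewrite lt_min r0/=.
  move: tr; rewrite lt_min => /andP[tr t1].
  rewrite /shift [t *: 1]mulr1.
  have c1 : `|t * p x - (u n (t + x) - u n x)| @[n --> \oo] -->
      `|t * p x - (h (t + x) - h x)|.
    by apply: cvg_norm; apply: cvgB; [exact: cvg_cst|apply: cvgB; exact: uh].
  have c2 : `|t| * (d + e n) @[n --> \oo] --> `|t| * (d + 0).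
    by apply: cvgM; [exact: cvg_cst|apply: cvgD; [exact: cvg_cst|exact: e0]].
  have : `|t * p x - (h (t + x) - h x)| <= `|t| * (d + 0).
    apply: ler_cvg_to c1 c2 _; apply: nearW => n.
    have [c cx ->] := has_derivative_MVT x (t + x) (dudu n).
    move: cx; rewrite addrK => cx.
    rewrite mulrC -mulrBl normrM mulrC ler_wpM2l//.
    have -> : p x - du n c = (p x - p c) - (du n c - p c) by ring.
    rewrite (le_trans (ler_normB _ _))// lerD//.
      by apply: pr; rewrite /= distrC (le_lt_trans cx).
    by apply: he; exact: le_trans cx (ltW t1).
  rewrite addr0 => hh.
  have -> : p x - t^-1 *: (h (t + x) - h x) = t^-1 * (t * p x - (h (t + x) - h x)).
    by rewrite -[_ *: _]/(_ * _) [RHS]mulrBr mulKf.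
  by rewrite normrM normfV ler_pdivrMl ?normr_gt0.
split; first by apply/cvg_ex; exists (p x).
exact/cvg_lim.
Unshelve. all: by end_near. Qed.

Lemma continuous_uniform_limit (u : nat -> R -> R) h (e : nat -> R) :
  (forall n, continuous (u n)) -> e n @[n --> \oo] --> 0 ->
  (forall n x, `|u n x - h x| <= e n) -> continuous h.
Proof.
move=> cu e0 uh x; apply/cvgrPdist_le => /= d d0.
have d3 : 0 < d / 3 by rewrite divr_gt0.
have [n en] : exists n, e n <= d / 3.
  have /cvgrPdist_le/(_ _ d3)[n _ hn] := e0; exists n.
  have := hn n (leqnn n); rewrite sub0r normrN; apply: le_trans; exact: ler_norm.
have /cvgrPdist_le/(_ _ d3) := cu n x; apply: filterS => y uxy.
have -> : h x - h y = (u n x - u n y) - (u n x - h x) + (u n y - h y) by ring.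
have h1 := le_trans (uh n x) en; have h2 := le_trans (uh n y) en.
rewrite (le_trans (ler_normD _ _))// (le_trans (lerD (ler_normB _ _) (lexx _)))//.
lra.
Qed.

Lemma cauchy_cvg_seq (v e : nat -> R) : e n @[n --> \oo] --> 0 ->
  (forall n k, `|v n - v k| <= e n + e k) -> cvgn v.
Proof.
move=> e0 ve; apply: cauchy_cvg; apply: cauchy_exP => d d0.
have d2 : 0 < d / 2 by rewrite divr_gt0.
have /cvgrPdist_lt/(_ _ d2)[n _ hn] := e0; exists (v n).
exists n => // k nk /=; rewrite /ball/=.
apply: le_lt_trans (ve n k) _.
have h1 := hn n (leqnn n); have h2 := hn k nk.
rewrite sub0r normrN in h1; rewrite sub0r normrN in h2.
have := ler_norm (e n); have := ler_norm (e k); lra.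
Qed.

End limits.

Section L2_pointwise.
Context {R : realType} {m : probability (measurableTypeR R) R}.
Local Notation nrm := (L2norm m).

(** Identifies the pointwise limit with the L^2 limit: Fatou is applied to v_n - v_k as k tends to
    infinity. *)
Lemma L2_cauchy_pointwise (v : nat -> R -> R) (V : R -> R) (e : nat -> R) :
  (forall n, L2 m (v n)) -> (forall x, v n x @[n --> \oo] --> V x) ->
  e n @[n --> \oo] --> 0 -> (forall n k, nrm (v n \- v k) <= e n + e k) ->
  L2 m V /\ nrm (v n \- V) @[n --> \oo] --> 0.
Proof.
move=> hv vV e0 ve.
have mv n : measurable_fun setT (v n) by exact: L2_measurable (hv n).
have mV : measurable_fun setT V.
  by apply: measurable_fun_cvg mv _ => x _; exact: vV.
have main d : 0 < d -> \forall n \near \oo, L2 m (v n \- V) /\ nrm (v n \- V) <= d.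
  move=> d0; have d2 : 0 < d / 2 by rewrite divr_gt0.
  have /cvgrPdist_le/(_ _ d2)[N _ hN] := e0; exists N => // n /= Nn.
  have eN k : (N <= k)%N -> e k <= d / 2.
    by move=> /hN; rewrite /= sub0r normrN; apply: le_trans; exact: ler_norm.
  have [h1 h2] : L2 m (v n \- V) /\ ip2 m (v n \- V) (v n \- V) <= d ^+ 2.
    apply: (@L2_fatou _ m (fun k => v n \- v (k + N)%N)).
    - by move=> k; exact: measurable_funB.
    - exact: measurable_funB.
    - apply: aeW => x; apply: cvgB; first exact: cvg_cst.
      by rewrite (cvg_shiftn N (fun k => v k x)); exact: vV.
    - move=> k; have hk : L2 m (v n \- v (k + N)%N) by exact: L2B.
      rewrite -EFin_ip2// lee_fin -nrm_sq lerXn2r ?nnegrE ?sqrtr_ge0 ?(ltW d0)//.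
      apply: le_trans (ve _ _) _.
      have := eN n Nn; have := eN _ (leq_addl k N); lra.
  by split => //; exact: nrm_le (ltW d0) h2.
have hV : L2 m V.
  have [n _ hn] := main 1 ltr01; have [h _] := hn n (leqnn n).
  have := L2B (hv n) h; congr (Defs.L2 _ _); apply/funext => x /=; ring.
split => //; apply/cvgrPdist_le => /= d d0; apply: filterS (main d d0) => n [_ h].
by rewrite sub0r normrN ger0_norm// sqrtr_ge0.
Qed.

End L2_pointwise.

Section regularity.
Context {R : realType} {beta : R} (hbeta : 3 / 2 <= beta).
Local Notation w := (fun x : R => omega x `^ (- beta)).
Local Notation m := (mu beta).
Local Notation lam := (2 * (beta - 1)).
Local Notation L := (L0 beta).
Local Notation ip := (ip2 m).
Local Notation nrm := (L2norm m).
Implicit Types f g u v p q : R -> R.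

Lemma cumul_cvg (u : nat -> R -> R) g x : (forall n, L2 m (u n)) -> L2 m g ->
  nrm (u n \- g) @[n --> \oo] --> 0 ->
  cumul beta (u n) x @[n --> \oo] --> cumul beta g x.
Proof.
move=> hu hg ug; apply/subr_cvg0; apply/norm_cvg0P.
apply: (@cvg0_le _ _ _ _ _ (fun n => mass beta * nrm (u n \- g))).
  apply: nearW => n; rewrite normr_ge0 -cumulB//.
  by apply: cumul_bound => //; exact: L2B.
by rewrite -[X in _ --> X](mulr0 (mass beta)); apply: cvgM => //; exact: cvg_cst.
Qed.

Lemma Lop_cumul_continuous f g : Lop beta f g -> continuous (cumul beta g).
Proof.
move=> /LopP[hf hg [u [tu uf Lug]]].
have hLu n : L2 m (L (u n)) by apply: test_function_L2; exact: test_function_L0.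
apply: (continuous_uniform_limit (u := fun n => cumul beta (L (u n)))
    (e := fun n => mass beta * nrm (L (u n) \- g))).
- move=> n; apply: has_derivative_continuous.
  apply: (cumul_derivative hbeta (hLu n)).
  exact: test_function_continuous (test_function_L0 (tu n)).
- by rewrite -[X in _ --> X](mulr0 (mass beta)); apply: cvgM => //; exact: cvg_cst.
- by move=> n x; rewrite -cumulB//; apply: cumul_bound => //; exact: L2B.
Qed.

Lemma Lop_cauchy (u : nat -> R -> R) g n k : (forall n, L2 m (u n)) -> L2 m g ->
  nrm (u n \- u k) <= nrm (u n \- g) + nrm (u k \- g).
Proof. by move=> hu hg; rewrite (nrmBC (u k)); exact: nrmB. Qed.

Lemma test_functionB u v : test_function u -> test_function v ->
  test_function (u \- v) /\ L (u \- v) = L u \- L v.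
Proof.
move=> tu tv.
have e (p q : R -> R) : (fun x => 1 * p x + (-1) * q x) = p \- q.
  by apply/funext => x; rewrite mul1r mulN1r.
have := test_function_lin 1 (-1) tu tv; have := L0_lin (beta := beta) 1 (-1) tu tv.
by rewrite !e.
Qed.

(** The square of the left side is |L u|^2 + lam <u, L u>, and <u, L u> is nonpositive by the energy
    identity. *)
Lemma test_function_phi_le u : test_function u ->
  nrm (fun x => omega x * derive1n 2 u x) <= nrm (L u).
Proof.
move=> tu; apply: ler_wsqrtr; have h1 := ip_L0_phi hbeta tu.
have h2 := ip_L0_energy hbeta tu.
have -> : ip (fun x => omega x * derive1n 2 u x) (fun x => omega x * derive1n 2 u x) =
    \int[m]_x (omega x ^+ 2 * derive1n 2 u x ^+ 2).
  by rewrite /ip2; apply: eq_Rintegral => x _; rewrite -expr2 exprMn.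
rewrite -h1 gerDl; have := lam_gt0 hbeta.
have : 0 <= - ip u (L u).
  rewrite h2; apply: Rintegral_ge0 => x _.
  by rewrite mulr_ge0 ?sqr_ge0// ltW// omega_gt0.
by move=> a b; rewrite pmulr_rle0// -oppr_ge0.
Qed.

(** [Y] stands for lam x f' and [g \+ Y] for omega f'', with f' replaced by its integral expression,
    which makes sense before any regularity is known. For test functions lam x u' = omega u'' - L u
    has norm at most 2 |L u|, hence the convergence of these terms. *)
Lemma Lop_phi f g : Lop beta f g ->
  let Y x := lam * x * (omega x `^ (beta - 1) * cumul beta g x) in
  L2 m Y /\ ip (g \+ Y) (g \+ Y) = ip g g + lam * ip f g.
Proof.
move=> fg Y; have := fg => /LopP[hf hg [u [tu uf Lug]]].
have hu n : L2 m (u n) by exact: test_function_L2.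
have tLu n : test_function (L (u n)) by exact: test_function_L0.
have hLu n : L2 m (L (u n)) by exact: test_function_L2.
pose y v (x : R) := lam * x * derive1 v x.
pose s v (x : R) := omega x * derive1n 2 v x.
have sE v : s v = L v \+ y v by apply/funext => x; rewrite /s /y /L0 /= subrK.
have hs v : test_function v -> L2 m (s v).
  move=> tv; apply: cont_vanishing_L2; apply: cont_vanishingM.
    exact: continuous_om.
  exact: test_function_dd_cv.
have hy v : test_function v -> L2 m (y v).
  move=> tv; have -> : y v = s v \- L v by rewrite sE; apply/funext => x /=; ring.
  by apply: L2B; [exact: hs|apply: test_function_L2; exact: test_function_L0].
have y_le v : test_function v -> nrm (y v) <= 2 * nrm (L v).
  move=> tv; have -> : y v = s v \- L v by rewrite sE; apply/funext => x /=; ring.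
  have hLv : L2 m (L v) by apply: test_function_L2; exact: test_function_L0.
  have e0 : s v \- cst 0 = s v by apply/funext => x /=; rewrite subr0.
  have e1 : cst 0 \- L v = (fun x => - L v x) by apply/funext => x /=; rewrite sub0r.
  apply: le_trans (nrmB (hs _ tv) (L2_cst 0) hLv) _; rewrite e0.
  have := test_function_phi_le tv; rewrite -/(s v).
  rewrite nrmBC (_ : L v \- cst 0 = L v); last by apply/funext => x /=; rewrite subr0.
  lra.
have yB n k : y (u n) \- y (u k) = y (u n \- u k).
  have [dz _] := derive_lin 1 (-1) (tu n) (tu k).
  apply/funext => x; rewrite /y /=.
  have -> : derive1 (u n \- u k) x = 1 * derive1 (u n) x + -1 * derive1 (u k) x.
    rewrite -dz; apply: (congr1 (fun z => derive1 z x)).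
    by apply/funext => z; rewrite mul1r mulN1r.
  by move: (derive1 (u n) x) (derive1 (u k) x) => a b; ring.
have [hY yY] : L2 m Y /\ nrm (y (u n) \- Y) @[n --> \oo] --> 0.
  apply: (L2_cauchy_pointwise (e := fun n => 2 * nrm (L (u n) \- g))).
  - by move=> n; exact: hy.
  - move=> x; rewrite /y /Y; under eq_cvg => n do rewrite (test_function_cumul hbeta x (tu n)).
    apply: cvgM; first exact: cvg_cst.
    by apply: cvgM; [exact: cvg_cst|exact: cumul_cvg].
  - by rewrite -[X in _ --> X](mulr0 2); apply: cvgM => //; exact: cvg_cst.
  - move=> n k; have [tb LB] := test_functionB (tu n) (tu k).
    rewrite yB -mulrDr (le_trans (y_le _ tb))// LB ler_wpM2l//.
    exact: (Lop_cauchy (u := fun n => L (u n))).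
split => //.
have hgY : L2 m (g \+ Y) by exact: L2D.
have sgY : nrm (s (u n) \- (g \+ Y)) @[n --> \oo] --> 0.
  have := nrm_lin_cvg (u := fun n => L (u n)) (v := fun n => y (u n)) hLu
    (fun n => hy _ (tu n)) hg hY (cvg_cst (1 : R)) (cvg_cst (1 : R)) Lug yY.
  have e1 n : (fun x => 1 * L (u n) x + 1 * y (u n) x) \-
      (fun x => 1 * g x + 1 * Y x) = s (u n) \- (g \+ Y).
    by rewrite sE; apply/funext => x /=; rewrite !mul1r.
  by move=> h; under eq_cvg => n do rewrite -e1; exact: h.
have c1 : ip (s (u n)) (s (u n)) @[n --> \oo] --> ip (g \+ Y) (g \+ Y).
  exact: (ip2_cvg (fun n => hs _ (tu n)) (fun n => hs _ (tu n)) hgY hgY sgY sgY).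
have c2 : ip (L (u n)) (L (u n)) + lam * ip (u n) (L (u n)) @[n --> \oo] -->
    ip g g + lam * ip f g.
  apply: cvgD; first exact: (ip2_cvg hLu hLu hg hg Lug Lug).
  by apply: cvgM; [exact: cvg_cst|exact: (ip2_cvg hu hLu hf hg uf Lug)].
have e : (fun n => ip (s (u n)) (s (u n))) =
    (fun n => ip (L (u n)) (L (u n)) + lam * ip (u n) (L (u n))).
  apply/funext => n; rewrite (ip_L0_phi hbeta (tu n)) /ip2; apply: eq_Rintegral => x _.
  by rewrite /s -expr2 exprMn.
by rewrite -(cvg_lim (@Rhausdorff R) c1) e (cvg_lim (@Rhausdorff R) c2).
Qed.

Lemma Lop_phi_ge0 f g : Lop beta f g -> 0 <= ip g g + lam * ip f g.
Proof. by move=> /Lop_phi[_ <-]; exact: ip2_ge0. Qed.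

Let omega_powR_le x c : `|c| <= `|x| ->
  omega c `^ (beta - 1) <= omega x `^ (beta - 1).
Proof.
move=> cx; have b1 : 0 <= beta - 1 by have := lam_gt0 hbeta; lra.
apply: ge0_ler_powR => //; rewrite ?nnegrE ?(ltW (omega_gt0 _))//.
by rewrite /omega lerD2l -[leLHS]real_normK ?num_real// -[leRHS]real_normK ?num_real// lerXn2r.
Qed.

Let growth (x : R) := `|x| * omega x `^ (beta - 1).

Lemma test_function_growth u x : test_function u ->
  `|u x - u 0| <= growth x * (mass beta * nrm (L u)).
Proof.
move=> tu; have [u1 _ _ _] := test_function2 tu.
have [c] := has_derivative_MVT 0 x u1; rewrite !subr0 => cx ->.
have hL : L2 m (L u) by apply: test_function_L2; exact: test_function_L0.
rewrite (test_function_cumul hbeta c tu) 2!normrM (ger0_norm (powR_ge0 _ _)).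
rewrite mulrC /growth -mulrA ler_wpM2l//.
apply: ler_pM; rewrite ?powR_ge0//; first exact: omega_powR_le.
exact: cumul_bound.
Qed.

(* [u - u 0] is only bounded by a multiple of [growth], which need not be square
   integrable; hence the weight [k]. *)
Lemma test_function_value_le : exists2 K : R, 0 <= K &
  forall u, test_function u -> `|u 0| <= K * (nrm u + nrm (L u)).
Proof.
(* Chosen bounded, with k and k [growth] both at most 1. *)
pose k (x : R) := (1 + growth x)^-1.
have g0 x : 0 <= growth x by rewrite mulr_ge0 ?powR_ge0.
have k0 x : 0 < k x by rewrite invr_gt0 ltr_wpDr.
have k1 x : k x <= 1 by rewrite invf_le1 ?ltr_wpDr// lerDl.
have kg x : k x * growth x <= 1.
  by rewrite mulrC ler_pdivrMr ?ltr_wpDr// mul1r lerDr.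
have ck : continuous k.
  move=> x; apply: cvgV; first by rewrite gt_eqF// ltr_wpDr.
  apply: cvgD; first exact: cvg_cst.
  apply: cvgM; first by apply: cvg_norm; exact: cvg_id.
  exact: continuous_omega_powR.
have hk : L2 m k.
  apply: (L2_bounded (c := 1)); first exact: measurable_continuous.
  by move=> x; rewrite gtr0_norm.
have nk : 0 < nrm k.
  rewrite lt_neqAle sqrtr_ge0 andbT eq_sym; apply/eqP => /(nrm_eq0 hk) h.
  have : {ae m, forall x : R, False}.
    apply: (@filterS _ _ (ae_filter_ringOfSetsType m) _ _ _ h) => x /(_ I) /= kx.
    by have := k0 x; rewrite kx ltxx.
  move=> [A [mA A0 sA]].
  have AT : A = setT by apply/seteqP; split => // x _; apply: sA.
  have := @probability_setT _ _ _ m; rewrite -AT A0 => /eqP.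
  by rewrite eqe eq_sym oner_eq0.
exists ((1 + mass beta) / nrm k).
  by rewrite divr_ge0 ?sqrtr_ge0// addr_ge0// ltW// mass_gt0.
move=> u tu; have hu : L2 m u by exact: test_function_L2.
have hL : L2 m (L u) by apply: test_function_L2; exact: test_function_L0.
have nu : 0 <= nrm u by exact: sqrtr_ge0.
have nL : 0 <= nrm (L u) by exact: sqrtr_ge0.
have M0 := ltW (mass_gt0 hbeta).
rewrite mulrAC ler_pdivlMr//.
have -> : `|u 0| * nrm k = nrm (fun x => `|u 0| * k x).
  have := @nmZ _ _ _ ipVP `|u 0| (packL2 hk).
  by rewrite normr_id => <-.
have hD : L2 m (fun x => `|u x| + cst (mass beta * nrm (L u)) x).
  by apply: (L2D (L2_norm hu)); exact: L2_cst.
apply: (@le_trans _ _ (nrm (fun x => `|u x| + cst (mass beta * nrm (L u)) x))).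
  apply: nrm_le_fun => //; first exact: L2Z.
  move=> x; rewrite normrM normr_id (gtr0_norm (k0 x)) [leRHS]ger0_norm; last first.
    by rewrite addr_ge0//= mulr_ge0.
  (* Multiplied by k, this bounds |u 0| k(x) by |u x| plus a constant multiple of the norm of L u;
     taking L^2 norms in x isolates |u 0|. *)
  have h : `|u 0| <= `|u x| + growth x * (mass beta * nrm (L u)).
    rewrite -[u 0](subrK (u x)) (le_trans (ler_normD _ _))// addrC lerD2l distrC.
    exact: test_function_growth.
  rewrite mulrC (le_trans (ler_wpM2l (ltW (k0 x)) h))// mulrDr lerD//.
    by rewrite ler_piMl.
  by rewrite mulrA ler_piMl// mulr_ge0.
apply: le_trans (nrmD (L2_norm hu) (L2_cst _)) _.
have -> : nrm (fun x => `|u x|) = nrm u.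
  rewrite /L2norm /ip2; congr Num.sqrt; apply: eq_Rintegral => x _.
  by rewrite -!expr2 real_normK ?num_real.
have -> : nrm (cst (mass beta * nrm (L u))) = mass beta * nrm (L u).
  rewrite -[LHS]/(nrm (fun=> _)) /L2norm /ip2 Rintegral_cst//.
  have := @probability_setT _ _ _ m => /= ->.
  by rewrite mulr1 -expr2 sqrtr_sqr ger0_norm// mulr_ge0.
have : 0 <= mass beta * nrm u by rewrite mulr_ge0.
lra.
Qed.

(** The arithmetic of the Cauchy estimate in [Lop_regular]: P and Q are the norms of u_n - u_k and
    of L u_n - L u_k, and a, b bound its values at 0 and at x. *)
Let value_cauchy (K A P Q p1 p2 q1 q2 a b c : R) : 0 <= K -> 0 <= A ->
  0 <= p1 -> 0 <= p2 -> P <= p1 + p2 -> Q <= q1 + q2 ->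
  a <= K * (P + Q) -> c <= A * Q -> b <= c + a ->
  b <= (K + A) * (p1 + q1 + (p2 + q2)).
Proof.
move=> K0 A0 p10 p20 Pp Qq aK cA bc; have h3 := ler_wpM2l K0 (lerD Pp Qq).
have h4 := ler_wpM2l A0 Qq; have h5 := mulr_ge0 A0 (addr_ge0 p10 p20).
apply: le_trans bc _; apply: le_trans (lerD (le_trans cA h4) (le_trans aK h3)) _.
rewrite -subr_ge0; apply: le_trans h5 _; rewrite le_eqVlt; apply/orP; left.
by apply/eqP; ring.
Qed.

(** Control of the value at 0 together with [test_function_growth] makes u_n(x) Cauchy at every
    point, so the representative is the pointwise limit; the derivatives converge locally uniformly
    because the weighted primitives of L u_n converge uniformly. *)
Lemma Lop_regular f g : Lop beta f g -> exists h,
  [/\ L2 m h, f = h %[ae m] &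
      has_derivative h (fun x => omega x `^ (beta - 1) * cumul beta g x)].
Proof.
move=> fg; have := fg => /LopP[hf hg [u [tu uf Lug]]].
have hu n : L2 m (u n) by exact: test_function_L2.
have hLu n : L2 m (L (u n)) by apply: test_function_L2; exact: test_function_L0.
have [K K0 hK] := test_function_value_le.
have M0 := ltW (mass_gt0 hbeta).
pose e n := nrm (u n \- f) + nrm (L (u n) \- g).
have e0 : e n @[n --> \oo] --> 0.
  by rewrite -[X in _ --> X](addr0 0); apply: cvgD.
have Mc c : c * e n @[n --> \oo] --> 0.
  by rewrite -[X in _ --> X](mulr0 c); apply: cvgM => //; exact: cvg_cst.
have uc x : cvgn (fun n => u n x).
  apply: (cauchy_cvg_seq (Mc (K + growth x * mass beta))) => n k.
  have [tb LB] := test_functionB (tu n) (tu k).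
  have h1 := Lop_cauchy n k hu hf; have h2 := Lop_cauchy (u := fun n => L (u n)) n k hLu hg.
  have g1 := test_function_growth x tb; have v1 := hK _ tb.
  rewrite LB in g1 v1.
  have gx : 0 <= growth x * mass beta by rewrite !mulr_ge0 ?powR_ge0.
  rewrite -mulrDr; apply: (value_cauchy K0 gx _ _ h1 h2 v1 _ _).
  - exact: sqrtr_ge0.
  - exact: sqrtr_ge0.
  - by rewrite -mulrA; exact: g1.
  - have := ler_normD ((u n \- u k) x - (u n \- u k) 0) ((u n \- u k) 0).
    by rewrite subrK.
pose h x := limn (fun n => u n x).
have uh x : u n x @[n --> \oo] --> h x by exact: uc.
have [hh nh] := L2_cauchy_pointwise hu uh uf (fun n k => Lop_cauchy n k hu hf).
exists h; split => //.
  have n0 : nrm (f \- h) = 0.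
    apply/eqP; rewrite eq_le sqrtr_ge0 andbT.
    have c : nrm (u n \- f) + nrm (u n \- h) @[n --> \oo] --> 0 + 0 by exact: cvgD.
    rewrite addr0 in c; apply: (ler_cvg_to (cvg_cst _) c); apply: nearW => n.
    by rewrite (nrmBC (u n)); exact: nrmB.
  have hB : L2 m (f \- h) by exact: L2B.
  apply: (@filterS _ _ (ae_filter_ringOfSetsType m) _ _ _ (nrm_eq0 hB n0)).
  by move=> x /(_ I) /= fh _; apply/eqP; rewrite -subr_eq0 fh.
apply: (has_derivative_limit (u := u) (du := fun n => derive1 (u n))) => //.
- by move=> n; have [] := test_function2 (tu n).
- apply: continuousMfun; first exact: continuous_omega_powR.
  exact: Lop_cumul_continuous fg.
(* On the unit ball around x the factor omega^(beta - 1) is at most its value at |x| + 1. *)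
move=> x; exists (fun n => omega (`|x| + 1) `^ (beta - 1) * (mass beta * nrm (L (u n) \- g))).
  rewrite -[X in _ --> X](mulr0 (omega (`|x| + 1) `^ (beta - 1))).
  apply: cvgM; first exact: cvg_cst.
  by rewrite -[X in _ --> X](mulr0 (mass beta)); apply: cvgM => //; exact: cvg_cst.
move=> n y yx; rewrite (test_function_cumul hbeta y (tu n)) -mulrBr normrM.
rewrite (ger0_norm (powR_ge0 _ _)) ler_pM ?powR_ge0//.
  apply: omega_powR_le; rewrite [leRHS]ger0_norm ?addr_ge0//.
  rewrite -[y](subrK x) (le_trans (ler_normD _ _))// addrC lerD2l //.
by rewrite -cumulB//; apply: cumul_bound => //; exact: L2B.
Qed.

End regularity.

(** * Smooth representatives of orbits *)

Section smooth_orbits.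
Context {R : realType} {beta : R} (hbeta : 3 / 2 <= beta).
Local Notation m := (mu beta).
Local Notation lam := (2 * (beta - 1)).
Local Notation ip := (ip2 m).
Local Notation nrm := (L2norm m).
Implicit Types f g h : R -> R.

Lemma cumul_ae f g : L2 m f -> L2 m g -> f = g %[ae m] ->
  cumul beta f = cumul beta g.
Proof.
move=> hf hg fg; apply/funext => x; apply/eqP; rewrite -subr_eq0 -normr_eq0.
rewrite eq_le normr_ge0 andbT -cumulB//.
have hB : L2 m (f \- g) by exact: L2B.
have z : f \- g = cst 0 %[ae m].
  apply: (@filterS _ _ (ae_filter_ringOfSetsType m) _ _ _ fg) => y /(_ I) e _.
  by rewrite /= e subrr.
apply: le_trans (cumul_bound hbeta x hB) _.
rewrite /L2norm (ip2_ae hB hB (L2_cst 0) (L2_cst 0) z z).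
rewrite /ip2; under eq_Rintegral do rewrite mul0r.
by rewrite /Rintegral integral0 sqrtr0 mulr0.
Qed.

(* The representatives [h k] of the successive images [f k] under the operator
   satisfy [h_k'' = omega^-1 (lam x h_k' + h_(k+1))], so that the algebra
   generated by all [h_k], [h_k'], [x] and [omega^-1] is closed under
   differentiation. *)
Lemma Lop_smooth (f : nat -> R -> R) : (forall k, Lop beta (f k) (f k.+1)) ->
  exists h, [/\ smooth h, h = f 0%N %[ae m] &
    (\int[m]_x (omega x ^+ 2 * derive1n 2 h x ^+ 2)%:E =
      (ip (f 1%N) (f 1%N) + lam * ip (f 0%N) (f 1%N))%:E)%E].
Proof.
move=> ff.
have [h hP] := choice (fun k => Lop_regular hbeta (ff k)).
have hf k : L2 m (f k) by have /LopP[] := ff k.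
have hh k : L2 m (h k) by have [] := hP k.
have fh k : f k = h k %[ae m] by have [] := hP k.
pose q k x := omega x `^ (beta - 1) * cumul beta (h k.+1) x.
have hq k : has_derivative (h k) (q k).
  have [_ _] := hP k; apply: has_derivative_eq => x.
  by rewrite (cumul_ae (hf k.+1) (hh k.+1) (fh k.+1)).
have ch k : continuous (h k) by exact: has_derivative_continuous (hq k).
have qq k : has_derivative (q k)
    (fun x => omega x `^ (-1) * (lam * x * q k x + h k.+1 x)).
  exact: weighted_cumul_derivative (hh k.+1) (ch k.+1).
pose G (g : R -> R) := [\/ exists k, g = h k, exists k, g = q k,
  g = id | g = (fun x => omega x `^ (-1))].
have Gh k : algebra_over G (h k) by apply: alg_gen; apply: Or41; exists k.
have Gq k : algebra_over G (q k) by apply: alg_gen; apply: Or42; exists k.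
have Gid : algebra_over G id by apply: alg_gen; exact: Or43.
have Go : algebra_over G (fun x => omega x `^ (-1)) by apply: alg_gen; exact: Or44.
exists (h 0%N); split.
- apply: (algebra_smooth (G := G)) (Gh 0%N) => _ [[k ->]|[k ->]|->|->].
  + by exists (q k).
  + exists (fun x => omega x `^ (-1) * (lam * x * q k x + h k.+1 x)) => //.
    apply: (alg_mul Go); apply: alg_add (Gh k.+1).
    apply: (alg_mul (f := fun x => lam * x)) (Gq k).
    exact: alg_mul (alg_cst _ lam) Gid.
  + by exists (fun=> 1); [exact: has_derivative_id|exact: alg_cst].
  + exists (fun x => -1 * (omega x `^ (-1) * omega x `^ (-1)) * (2 * x)).
      apply: has_derivative_eq (has_derivative_omega_powR (-1)) => x.
      by rewrite omega_powRD.
    apply: (alg_mul (f := fun x => -1 * (omega x `^ (-1) * omega x `^ (-1))) (g := fun x => 2 * x)).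
      by apply: (alg_mul (f := fun=> -1)); [exact: alg_cst|exact: alg_mul].
    by apply: (alg_mul (f := fun=> 2)); first exact: alg_cst.
- apply: (@filterS _ _ (ae_filter_ringOfSetsType m) _ _ _ (fh 0%N)) => x e xI.
  by rewrite e.
have [hY phi] := Lop_phi hbeta (ff 0%N).
set Y := (fun x => lam * x * _) in hY phi.
have hS f' : L2 m f' -> L2 m (f' \+ Y) by move=> hf'; exact: L2D.
have aeS : f 1%N \+ Y = h 1%N \+ Y %[ae m].
  apply: (@filterS _ _ (ae_filter_ringOfSetsType m) _ _ _ (fh 1%N)) => x e xI.
  by rewrite /= e.
rewrite -phi (ip2_ae (hS _ (hf 1%N)) (hS _ (hf 1%N)) (hS _ (hh 1%N)) (hS _ (hh 1%N)) aeS aeS).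
rewrite EFin_ip2; last exact: hS.
(* By the equation for q_0, omega h_0'' = lam x h_0' + h_1, which is h_1 + Y. *)
apply: eq_integral => x _; congr EFin.
rewrite -[derive1n 2 _]/(derive1 (derive1 (h 0%N))) (has_derivativeE (hq 0%N)).
rewrite (has_derivativeE (qq 0%N)) -exprMn mulrA powR_inv1 ?ltW ?omega_gt0//.
rewrite divff ?omega_neq0// mul1r addrC.
by rewrite /= /Y /q (cumul_ae (hf 1%N) (hh 1%N) (fh 1%N)).
Qed.

End smooth_orbits.

(** * Spectral gap and variance identity *)

Section spectral_gap.
Context {R : realType} {beta : R}.
Local Notation m := (mu beta).
Local Notation lam := (2 * (beta - 1)).
Local Notation ip := (ip2 m).
Local Notation nrm := (L2norm m).

Lemma variance_L2 (f : R -> R) : L2 m f ->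
  ('V_m[f] = (ip f f - ip f (cst 1) ^+ 2)%:E)%E.
Proof.
move=> hf; have i1 := L2_integrable hf; have i2 := L2_integrableM hf hf.
have e1 : ('E_m[f] = (ip f (cst 1))%:E)%E.
  by rewrite ip2_cst1 unlock /Rintegral fineK//; exact: integrable_fin_num i1.
have e2 : ('E_m[(f ^+ 2)%R] = (ip f f)%:E)%E.
  rewrite unlock EFin_ip2//; apply: eq_integral => x _; congr EFin.
rewrite varianceE; last exact: hf.
by rewrite e1 e2 EFinB EFin_expe.
Qed.

Lemma spectral_gap_ge (hbeta : 3 / 2 <= beta) :
  (lam%:E <= spectral_gap_opp m (Lop beta))%E.
Proof.
apply/ereal_infP => _ [f [g [fg + ->]]]; have /LopP[hf hg _] := fg.
rewrite variance_L2// eqe /= => v0; rewrite lee_fin.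
have v1 : 0 < ip f f - ip f (cst 1) ^+ 2.
  by rewrite lt_neqAle eq_sym v0 -lee_fin -variance_L2// variance_ge0.
rewrite ler_pdivlMr//; apply: le_trans (Lop_poincare hbeta fg) _.
rewrite le_eqVlt; apply/orP; left; apply/eqP.
rewrite /ip2 -mulN1r -RintegralZl//; last exact: L2_integrableM.
by apply: eq_Rintegral => x _; rewrite mulN1r mulNr.
Qed.

(** Otherwise the line would be the union of a null set and the point c / a, itself null since the
    measure has a density. *)
Lemma linear_not_ae_cst (hbeta : 3 / 2 <= beta) (a c : R) : a != 0 ->
  ~ ((fun x => a * x) = cst c %[ae m]).
Proof.
move=> a0 [A [mA A0 sA]].
have x0 : m [set c / a] = 0%E.
  by rewrite (mu_integral hbeta (measurable_set1 _)) integral_set1.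
have : m (A `|` [set c / a]) = 1%E.
  rewrite (_ : _ `|` _ = setT); first exact: probability_setT.
  apply/seteqP; split => // x _; have [->|xc] := eqVneq x (c / a); first by right.
  left; apply: sA => /= /(_ I) e; move/eqP : xc; apply.
  by rewrite -e mulrC mulKf.
have : (m (A `|` [set (c / a)%R]) <= m A + m [set (c / a)%R])%E by exact: measureU2.
by rewrite A0 x0 adde0 => /[swap] ->; rewrite lee_fin ler10.
Qed.

Lemma linear_variance_neq0 (hbeta : 3 / 2 < beta) (a : R) : a != 0 ->
  ('V_m[(fun x => (a * x)%R)] != 0)%E.
Proof.
move=> a0; have hf := L2Z a (L2_id hbeta).
rewrite variance_L2// eqe; apply/eqP => v0.
set c := ip _ (cst 1) in v0.
apply: (linear_not_ae_cst (ltW hbeta) (c := c) a0).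
have hB : L2 m ((fun x : R => a * x) \- cst c) by apply: L2B => //; exact: L2_cst.
have n0 : nrm ((fun x => a * x) \- cst c) = 0.
  have e : (fun x => a * x) \- cst c = (fun x : R => 1 * (a * x) + (- c) * cst 1 x).
    by apply/funext => x /=; rewrite mul1r mulr1.
  have h1 : L2 m (cst 1) by exact: L2_cst.
  have E h : L2 m h -> ip ((fun x : R => a * x) \- cst c) h =
      ip (fun x => a * x) h - c * ip (cst 1) h.
    by move=> hh; rewrite e ip2_lin2// mul1r mulNr.
  rewrite /L2norm E// ![ip _ ((fun x : R => a * x) \- cst c)]ip2C !E//.
  rewrite ip2_11 (ip2C (cst 1)) -/c -[RHS](@sqrtr0 R) -v0; congr Num.sqrt.
  by ring.
apply: (@filterS _ _ (ae_filter_ringOfSetsType m) _ _ _ (nrm_eq0 hB n0)).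
by move=> x /(_ I) /= e _; apply/eqP; rewrite -subr_eq0 e.
Qed.

Lemma spectral_gap_linear (hbeta : 3 / 2 < beta) :
  spectral_gap_opp m (Lop beta) = lam%:E.
Proof.
apply/eqP; rewrite eq_le; apply/andP; split; last exact: spectral_gap_ge (ltW hbeta).
apply: ereal_inf_lbound.
have fg := Lop_linear hbeta 1; have v0 := linear_variance_neq0 hbeta (oner_neq0 R).
set f := (fun x => 1 * x) in fg v0; set g := (fun x => _) in fg.
have /LopP[hf hg _] := fg.
exists f, g; split => //; congr EFin.
have l0 := lam_gt0 (ltW hbeta).
have gE h : L2 m h -> ip g h = - lam * ip f h.
  move=> hh; have -> : g = (fun x => - lam * f x + 0 * f x).
    by apply/funext => x; rewrite /g mul0r addr0 mulNr.
  by rewrite ip2_lin2// mul0r addr0.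
(* The image - lam f has mean zero by [Lop_mean0], hence so does f, and the variance is [ip f f]. *)
have f1 : ip f (cst 1) = 0.
  have := Lop_mean0 (ltW hbeta) fg; rewrite gE; last exact: L2_cst.
  by move=> /eqP; rewrite mulf_eq0 oppr_eq0 gt_eqF//= => /eqP.
move: v0; rewrite variance_L2// f1 expr0n/= subr0 eqe => v0.
have -> : \int[m]_x (- f x * g x) = - ip g f.
  rewrite /ip2 -mulN1r -RintegralZl//; last exact: L2_integrableM.
  by apply: eq_Rintegral => x _; rewrite mulN1r mulNr [f x * _]mulrC.
by rewrite gE// !mulNr opprK mulfK.
Qed.

End spectral_gap.

(** * Application to the generated semigroup *)

Section generated_semigroup.
Context {R : realType} {beta : R} (hbeta : 3 / 2 <= beta).
Local Notation m := (mu beta).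
Local Notation lam := (2 * (beta - 1)).
Local Notation L := (L0 beta).
Local Notation ip := (ip2 m).
Local Notation nrm := (L2norm m).
Local Notation V := (LfunType m (lee1n 2)).
Local Notation nm := (seminorm (@ipV R m)).
Context {P : R -> (R -> R) -> R -> R} (hP : generates m (Lop beta) P).
Implicit Types (f g : R -> R) (t : R).

Let PP := proj1 hP.

(** The abstract theory wants operators on bundled elements at all times, while P_t f is known to be
    in L^2 for t >= 0 only; 0 is the default value. *)
Definition L2_element f : V :=
  if pselect (L2 m f) is left hf then packL2 hf else 0.

Lemma L2_elementE f : L2 m f -> L2_element f = f :> (R -> R).
Proof. by move=> hf; rewrite /L2_element; case: pselect. Qed.

Let Q t (x : V) : V := L2_element (P t x).

Let L2P t (x : V) : 0 <= t -> L2 m (P t x).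
Proof. by move=> t0; apply: (semigroup_L2 PP t0); exact: LfunP. Qed.

Let QE t (x : V) : 0 <= t -> Q t x = P t x :> (R -> R).
Proof. by move=> t0; apply: L2_elementE; exact: L2P. Qed.

Let nmE (x y : V) : nm (x - y) = nrm ((x : R -> R) \- (y : R -> R)).
Proof. by []. Qed.

Let nrm_ae f g : L2 m f -> L2 m g -> f = g %[ae m] -> nrm (f \- g) = 0.
Proof.
move=> hf hg fg; have hB : L2 m (f \- g) by exact: L2B.
have z : f \- g = cst 0 %[ae m].
  apply: (@filterS _ _ (ae_filter_ringOfSetsType m) _ _ _ fg) => a /(_ I) e _.
  by rewrite /= e subrr.
rewrite /L2norm (ip2_ae hB hB (L2_cst 0) (L2_cst 0) z z) /ip2.
by under eq_Rintegral do rewrite mul0r; rewrite /Rintegral integral0 sqrtr0.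
Qed.

Let complete (u : nat -> V) : (forall n, nm (u n.+1 - u n) <= 3^-1 ^+ n) ->
  exists x, nm (u n - x) @[n --> \oo] --> 0.
Proof.
move=> hu; have [f hf uf] := L2_complete (u := fun n => u n : R -> R) (fun n => LfunP (u n)) hu.
by exists (packL2 hf).
Qed.

Let nonneg0 : \forall t \near (0 : R)^'+, 0 <= t.
Proof. exact: nbhs_right_ge. Qed.

Let QP : semigroup_mod_null nm Q.
Proof.
split.
- move=> t a x y t0; rewrite nmE.
  rewrite QE// -[X in _ \- X]/(fun z => a * Q t x z + Q t y z) !QE//.
  apply: nrm_ae; [exact: L2P|by apply: L2_lin; exact: L2P|].
  exact: (semigroup_linear PP a t0 (LfunP x) (LfunP y)).
- move=> t t0; have [M hM] := semigroup_bounded PP t0; exists M => x.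
  have := hM x (LfunP x).
  rewrite (Lnorm2E (L2P x t0)) (Lnorm2E (LfunP x)) -EFinM lee_fin.
  by rewrite -[nm (Q t x)]/(nrm (Q t x)) QE.
- move=> x; rewrite nmE QE//; apply: nrm_ae; [exact: L2P|exact: LfunP|].
  exact: (semigroup_0 PP (LfunP x)).
- move=> s t x s0 t0; rewrite nmE !QE ?addr_ge0//.
  apply: nrm_ae; [by apply: L2P; exact: addr_ge0|exact: (semigroup_L2 PP s0 (L2P x t0))|].
  exact: (semigroup_D PP s0 t0 (LfunP x)).
- move=> x; apply: (proj1 (L2dist_cvgP (u := fun t => Q t x) (fun t => LfunP (Q t x)) (LfunP x))).
  apply: cvg_trans (semigroup_cvg PP (LfunP x)); apply: near_eq_cvg.
  by apply: filterS nonneg0 => t t0; rewrite QE.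
Qed.

(** The quotients built from [Q] and from [P] agree for t >= 0, which is enough for a limit from the
    right. *)
Let QinfP (x y : V) : infinitesimal nm Q x y <-> Lop beta x y.
Proof.
rewrite (proj2 hP x y (LfunP x) (LfunP y)).
have h := L2dist_cvgP (F := 0^'+) (u := fun t => t^-1 *: (Q t x - x) : V)
  (fun t => LfunP (t^-1 *: (Q t x - x))) (LfunP y).
have {}h := h (@at_right_proper_filter R 0).
have e t : 0 <= t -> (t^-1 *: (Q t x - x) : V) =
    (fun z => t^-1 * (P t x z - x z)) :> (R -> R).
  by move=> t0; rewrite -(QE x t0).
rewrite /infinitesimal; split=> [/(proj2 h)|h'].
  apply: cvg_trans; apply: near_eq_cvg; apply: filterS nonneg0 => t t0.
  by rewrite (e t t0).
apply: (proj1 h); apply: cvg_trans h'; apply: near_eq_cvg.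
by apply: filterS nonneg0 => t t0; rewrite (e t t0).
Qed.

Lemma generates_Lop t f g : 0 <= t -> Lop beta f g -> Lop beta (P t f) (P t g).
Proof.
move=> t0 fg; have /LopP[hf hg _] := fg.
have : infinitesimal nm Q (packL2 hf) (packL2 hg) by apply/QinfP.
by move=> /(infinitesimal_sg ipVP complete QP t0)/QinfP; rewrite !QE.
Qed.

Lemma integral_generates f0 f1 f2 : Lop beta f0 f1 -> Lop beta f1 f2 ->
  (\int[lebesgue_measure]_(t in `[0%R, +oo[)
     (ip (P t f1) (P t f1) + lam * ip (P t f0) (P t f1))%:E =
   ((- ip f0 f1 - lam * (ip f0 f0 - ip f0 (cst 1) ^+ 2)) / 2)%:E)%E.
Proof.
move=> f01 f12; have /LopP[h0 h1 _] := f01; have /LopP[_ h2 _] := f12.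
have h11 : L2 m (cst 1) by exact: L2_cst.
have sym x y x' y' : infinitesimal nm Q x y -> infinitesimal nm Q x' y' ->
    ipV x y' = ipV y x' by move=> /QinfP xy /QinfP xy'; exact: (Lop_sym hbeta xy xy').
have mean x y : infinitesimal nm Q x y -> ipV y (packL2 h11) = 0.
  by move=> /QinfP; exact: Lop_mean0.
have poinc x y : infinitesimal nm Q x y ->
    lam * (ipV x x - ipV x (packL2 h11) ^+ 2) <= - ipV x y.
  by move=> /QinfP; exact: Lop_poincare.
have pos x y : infinitesimal nm Q x y -> 0 <= ipV y y + lam * ipV x y.
  by move=> /QinfP; exact: Lop_phi_ge0.
have g01 : infinitesimal nm Q (packL2 h0) (packL2 h1) by apply/QinfP.
have g12 : infinitesimal nm Q (packL2 h1) (packL2 h2) by apply/QinfP.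
have c11 : ipV (packL2 h11) (packL2 h11) = 1 by exact: ip2_11.
have h := integral_semigroup ipVP complete QP sym c11
  mean (lam_gt0 hbeta) poinc pos g01 g12.
apply: etrans h; apply: eq_integral => t; rewrite inE/= in_itv/= andbT => t0.
by rewrite /ipV !QE.
Qed.

(** The iterates L^k f of a test function are test functions, so P_t L^k f is a chain in the domain
    to which both the regularity bootstrap and the time integral apply. *)
Lemma variance_identity f : test_function f -> exists u : R -> R -> R,
  (forall t, 0 <= t -> smooth (u t) /\ u t = P t f %[ae m]) /\
  (lam%:E * 'V_m[f] = \int[m]_x (omega x * derive1 f x ^+ 2)%:E -
     2%:E * \int[lebesgue_measure]_(t in `[0%R, +oo[)
       \int[m]_x (omega x ^+ 2 * derive1n 2 (u t) x ^+ 2)%:E)%E.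
Proof.
move=> tf; pose F k := iter k L f.
have tF k : test_function (F k) by elim: k => //= k; exact: test_function_L0.
have LF k : Lop beta (F k) (F k.+1) by exact: test_function_Lop.
have ex t : exists v : R -> R, 0 <= t -> [/\ smooth v, v = P t f %[ae m] &
    (\int[m]_x (omega x ^+ 2 * derive1n 2 v x ^+ 2)%:E =
      (ip (P t (F 1%N)) (P t (F 1%N)) + lam * ip (P t f) (P t (F 1%N)))%:E)%E].
  (* At negative times the representative is arbitrary; f is the default value. *)
  have [t0|t0] := leP 0 t; last by exists f.
  by have [h hP'] := Lop_smooth hbeta (fun k => generates_Lop t0 (LF k)); exists h.
have [u uP] := choice ex.
exists u; split; first by move=> t /uP[].
have hf : L2 m f by exact: test_function_L2.
have -> : (\int[m]_x (omega x * derive1 f x ^+ 2)%:E = (- ip f (L f))%:E)%E.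
  have cv : cont_vanishing (fun x => omega x * derive1 f x ^+ 2).
    apply: cont_vanishingM; first exact: continuous_om.
    by apply: cont_vanishing_sqr; exact: test_function_d_cv.
  rewrite (ip_L0_energy hbeta tf) /Rintegral fineK//.
  exact: integrable_fin_num (L2_integrable (cont_vanishing_L2 cv)).
have -> : (\int[lebesgue_measure]_(t in `[0%R, +oo[)
    \int[m]_x (omega x ^+ 2 * derive1n 2 (u t) x ^+ 2)%:E =
    \int[lebesgue_measure]_(t in `[0%R, +oo[)
     (ip (P t (F 1%N)) (P t (F 1%N)) + lam * ip (P t f) (P t (F 1%N)))%:E)%E.
  by apply: eq_integral => t; rewrite inE/= in_itv/= andbT => /uP[].
rewrite (integral_generates (LF 0%N) (LF 1%N)) variance_L2// -!EFinM -EFinB.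
by congr EFin; rewrite /F /=; field.
Qed.

End generated_semigroup.

Theorem corollary5p1 (R : realType) (beta : R) (hbeta : 3 / 2 <= beta) :
  [/\ ((2 * (beta - 1))%:E <= spectral_gap_opp (mu beta) (Lop beta))%E,
      forall P : R -> (R -> R) -> R -> R,
        generates (mu beta) (Lop beta) P ->
        forall f : R -> R, test_function f ->
        exists u : R -> R -> R,
          (forall t : R, 0 <= t -> smooth (u t) /\ u t = P t f %[ae mu beta]) /\
          ((2 * (beta - 1))%:E * 'V_(mu beta)[f] =
             \int[mu beta]_x (omega x * (f^`())%classic x ^+ 2)%:E
             - 2%:E * \int[lebesgue_measure]_(t in `[0%R, +oo[)
                        \int[mu beta]_x (omega x ^+ 2 * ((u t)^`(2))%classic x ^+ 2)%:E)%E
    & 3 / 2 < beta ->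
        spectral_gap_opp (mu beta) (Lop beta) = (2 * (beta - 1))%:E /\
        forall a : R, a != 0 ->
          eigenfunction_opp (mu beta) (Lop beta) (2 * (beta - 1))
            (fun x => a * x)].
Proof.
split; first exact: spectral_gap_ge.
  by move=> P hP f tf; exact: variance_identity.
move=> hb; split; first exact: spectral_gap_linear.
move=> a a0; split; last exact: Lop_linear.
exact: linear_not_ae_cst.
Qed.
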